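(* For $N\ge2$ let $Sp(N,1)$ be the spider graph with $N$ legs each equal to the segment $[0,1]$, and let $b(t)$ be the Brownian motion on $Sp(N,1)$ with Kirchhoff gluing at the origin and reflection at the $N$ endpoints $x_i=1$, started at $0$. Define $\sigma_0=0$ and for $k\ge1$: $\rho_k=\inf\{t>\sigma_{k-1}:|b(t)|=1\}$, $\sigma_k=\inf\{t>\rho_k:b(t)=0\}$ (the $k$-th complete covering of a leg: from $0$ to an endpoint and back). Let $\nu_N=\min\{k:\{b(\rho_1),\dots,b(\rho_k)\}\text{ contains all }N\text{ endpoints}\}$ and let $T_N=\sigma_{\nu_N}$ be the total time for the Brownian motion to cover $Sp(N,1)$. Put $a=2$, $\sigma=\sqrt{4/3}$. Then there are random variables $\zeta_N,\eta_N$ such that $$T_N=aN\ln N+aN\zeta_N+\sigma\sqrt{N\ln N}\,\eta_N+R_N,\qquad R_N=O\Big(\sqrt{\tfrac{N}{\ln N}}\Big)$$ (in the sense that $R_N\sqrt{\ln N/N}$ is bounded in probability as $N\to\infty$), where $\zeta_N,\eta_N$ are asymptotically independent, $\zeta_N$ converges in law to the Gumbel distribution $P\{\zeta\le x\}=e^{-e^{-x}}$, and $\eta_N$ converges in law to the standard normal distribution $\mathcal N(0,1)$.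
   Context: A spider graph consists of legs $l_1,\dots,l_N$ (here each a copy of $[0,1]$ with coordinate $x_i$) glued at their common endpoint $0$; for a point $x$ on leg $l_i$, $|x|=x_i$. The Brownian motion $b(t)$ is the continuous strong Markov process with generator $\frac12\frac{d^2}{dx_i^2}$ on each leg, acting on functions continuous at $0$, twice differentiable on each leg, satisfying Kirchhoff's condition $\sum_{i=1}^N f_i'(0)=0$ at the origin and the Neumann (reflection) condition $f_i'(1)=0$ at each endpoint. Equivalently, away from $0$ it is one-dimensional Brownian motion on the leg reflected at $x_i=1$, and from $0$ it enters each leg with equal probability $1/N$. ''Asymptotically independent'' means that the pair $(\zeta_N,\eta_N)$ converges in law to a pair of independent random variables with the stated marginals. *)

(* Defs.v *)
From HB Require Import structures.
From mathcomp Require Import all_boot all_order all_algebra.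
From mathcomp Require Import all_classical all_reals all_analysis.
Set Implicit Arguments. Unset Strict Implicit. Unset Printing Implicit Defensive.
Import Order.TTheory GRing.Theory Num.Theory.
Import numFieldNormedType.Exports.
Local Open Scope classical_set_scope.
Local Open Scope ring_scope.

Section Spider.
Variable R : realType.

(* A point of the spider Sp(N,1) is encoded by its embedding in R^N:
   the point at distance x_i from 0 on leg l_i is the vector x_i e_i.
   So a point is a vector x : 'I_N -> R with all coordinates in [0,1]
   and at most one nonzero coordinate; the origin is the zero vector. *)
Definition spider_point (N : nat) (x : 'I_N -> R) : Prop :=
  (forall i, 0 <= x i <= 1) /\ (forall i j, x i != 0 -> x j != 0 -> i = j).

(* |x| for a point of the spider (only one coordinate is nonzero). *)
Definition spider_abs (N : nat) (x : 'I_N -> R) : R := \sum_(i < N) x i.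

(* Evaluation at a spider point of a function f = (f_i)_i given legwise
   (f_i : [0,1] -> R, extended to R); at the origin we use f_i(0) for
   some leg (all f_i(0) agree for functions continuous at 0). *)
Definition spider_eval (N : nat) (f : 'I_N -> R -> R) (x : 'I_N -> R) : R :=
  match [pick i | x i != 0] with
  | Some i => f i (x i)
  | None => match [pick i : 'I_N] with Some i => f i 0 | None => 0 end
  end.

(* The domain of the generator: legwise C^2 functions (a C^2 function on
   [0,1] is the restriction of a C^2 function on R), continuous at 0,
   with (1/2) f'' continuous at 0, Kirchhoff condition at 0, Neumann
   condition at the endpoints. *)
Definition spider_dom (N : nat) (f : 'I_N -> R -> R) : Prop :=
  [/\ forall i, (forall x, derivable (f i) x 1) /\
                (forall x, derivable (derive1 (f i)) x 1) /\
                continuous (derive1 (derive1 (f i))),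
      forall i j, f i 0 = f j 0,
      forall i j, derive1 (derive1 (f i)) 0 = derive1 (derive1 (f j)) 0,
      \sum_(i < N) derive1 (f i) 0 = 0 &
      forall i, derive1 (f i) 1 = 0].

Definition spider_gen (N : nat) (f : 'I_N -> R -> R) : 'I_N -> R -> R :=
  fun i x => 2^-1 * derive1 (derive1 (f i)) x.

(* Brownian motion on Sp(N,1) started at 0, characterized as the
   (well-posed) martingale problem for its generator with respect to the
   natural filtration: X i t w is the i-th coordinate of b(t)(w). *)
Definition spider_BM d (T : measurableType d) (P : probability T R) (N : nat)
    (X : 'I_N -> R -> T -> R) : Prop :=
  [/\
      forall i t, measurable_fun setT (X i t),
      forall t w, 0 <= t -> spider_point (fun i => X i t w),
      forall i w, {within [set t : R | 0 <= t], continuous (fun t => X i t w)},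
      forall i w, X i 0 w = 0 &
      (* martingale problem: M^f_t = f(b_t) - f(b_0) - int_0^t Lf(b_s) ds
         is a martingale for the natural filtration; it suffices to test
         against the generating pi-system of events
         {b_{u_1}^{(i_1)} in B_1, ..., b_{u_m}^{(i_m)} in B_m}, u_j <= s. *)
      forall f, spider_dom f ->
      let M := fun t w => spider_eval f (fun i => X i t w)
                 - spider_eval f (fun i => X i 0 w)
                 - (\int[lebesgue_measure]_(s in `[0, t])
                      spider_eval (spider_gen f) (fun i => X i s w)) in
      forall s t, 0 <= s -> s <= t ->
      forall (m : nat) (leg : 'I_m -> 'I_N) (u : 'I_m -> R) (B : 'I_m -> set R),
      (forall j, 0 <= u j <= s) -> (forall j, measurable (B j)) ->
      (\int[P]_w ((M t w - M s w) *
          \1_[set w' | forall j, B j (X (leg j) (u j) w')] w)%:E = 0)%E].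

Section Path.
Variables (N : nat) (x : 'I_N -> R -> R).
Local Open Scope ereal_scope.

Definition next_rho (s : \bar R) : \bar R :=
  ereal_inf [set t%:E | t in [set t : R | s < t%:E /\ spider_abs (fun i => x i t) = 1%R]].
Definition next_sigma (r : \bar R) : \bar R :=
  ereal_inf [set t%:E | t in [set t : R | r < t%:E /\ forall i, x i t = 0%R]].

Fixpoint cov_sigma (k : nat) : \bar R :=
  match k with
  | 0%N => 0
  | k'.+1 => next_sigma (next_rho (cov_sigma k'))
  end.
Definition cov_rho (k : nat) : \bar R := next_rho (cov_sigma k.-1).

Definition covered (k : nat) : Prop :=
  forall i : 'I_N, exists j, (1 <= j <= k)%N /\
    exists r : R, cov_rho j = r%:E /\ x i r = 1%R.

Definition cover_time : \bar R :=
  if `[< exists k, covered k >] then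
    cov_sigma (xget 0%N [set k | covered k /\ forall j, covered j -> (k <= j)%N])
  else +oo.
End Path.

(* Gumbel density: P(zeta <= x) = exp(-exp(-x)) *)
Definition gumbel_pdf (x : R) : R := expR (- x) * expR (- expR (- x)).

End Spider.

(* Main.v *)
(* A cycle (from 0 to an endpoint and back) picks its leg uniformly and independently of the
   past; given the past and the leg, optional sampling of [exp (- l t) f (b t)], with [f]
   hyperbolic on each leg, gives the Laplace transform [1 / cosh (sqrt (2 l)) ^ 2] for its
   duration, hence mean 2, variance 4/3 and a bounded third moment.  So the number [nu] of
   cycles is a coupon collector time: inclusion-exclusion and Tannery's theorem give
   [nu / N - ln N -> Gumbel].  Given the whole sequence of visited legs, a Lindeberg
   replacement along the heat flow [u (v, y) = Phi ((b - y) / sqrt v)] compares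
   [sigma_n - 2 n] with a centred Gaussian of variance [4/3 n], with an error that sums over
   all leg sequences of length [n]; restricting to those with [nu = n], where
   [n / (N ln N) -> 1], yields the joint law.  For [zeta = nu / N - ln N] and
   [eta = (T - 2 nu) / (sqrt (4/3) sqrt (N ln N))] the remainder vanishes on [T < +oo]. *)
Require Import Defs.
From HB Require Import structures.
From mathcomp Require Import all_boot all_order all_algebra.
From mathcomp Require Import all_classical all_reals all_analysis.
From mathcomp Require Import measurable_realfun ring lra.
Set Implicit Arguments. Unset Strict Implicit. Unset Printing Implicit Defensive.
Import Order.TTheory GRing.Theory Num.Theory.
Import numFieldNormedType.Exports.
Local Open Scope classical_set_scope.
Local Open Scope ring_scope.

(** * Expectations *)

(** Two features of [spider_BM] shape the proof: increments are tested only against cylinder events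
    of the natural filtration, and only for functions in [spider_dom]. Hence no conditional
    expectation occurs: conditional statements are integrals over an arbitrary event [A] of the
    past, and stopping times are optional times, for which sampling discretises from the right. The
    hyperbolic functions are not in [spider_dom]: the one for the way out violates the Neumann
    condition, the one for the way back Kirchhoff's. Each fails only at the target of its phase, so
    a cubic correction is added within distance [e] of the target, the path is stopped on entering
    that neighbourhood, and [e] tends to 0. Asymptotic independence needs no decoupling argument:
    the bounds for the durations are proportional to the probability of the leg sequence on which
    they are made, so they may be summed over the sequences with [nu = n]. For every [n] in the
    window that carries the Gumbel limit the rescaled variance is close to 1, so the Gaussian factor
    splits off. *)

Section Expectation.
Context {R : realType} {d : measure_display} {T : measurableType d}.
Variable P : probability T R.
Implicit Types (f g h : T -> R).

Definition bmf g := measurable_fun setT g /\ exists K, forall w, `|g w| <= K.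
Definition igr g := P.-integrable setT (EFin \o g).

Lemma bmf_igr g : bmf g -> igr g.
Proof.
move=> [mg [K gK]]; apply: measurable_bounded_integrable => //.
  by rewrite (le_lt_trans (probability_le1 P measurableT))// ltry.
exists K; split; first by rewrite num_real.
by move=> x Kx w _ /=; rewrite (le_trans (gK w))// ltW.
Qed.

Lemma bmf_cst (c : R) : bmf (fun=> c).
Proof. by split=> //; exists `|c|. Qed.

Lemma bmf_ind (A : set T) : measurable A -> bmf \1_A.
Proof.
move=> mA; split; first exact: measurable_indic.
by exists 1 => w; rewrite indicE; case: (_ \in _); rewrite ?normr1 ?normr0.
Qed.

Lemma bmfD f g : bmf f -> bmf g -> bmf (fun w => f w + g w).
Proof.
move=> [mf [K fK]] [mg [L gL]]; split; first exact: measurable_funD.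
by exists (K + L) => w; rewrite (le_trans (ler_normD _ _))// lerD.
Qed.

Lemma bmfM f g : bmf f -> bmf g -> bmf (fun w => f w * g w).
Proof.
move=> [mf [K fK]] [mg [L gL]]; split; first exact: measurable_funM.
by exists (K * L) => w; rewrite normrM ler_pM.
Qed.

Lemma bmfN f : bmf f -> bmf (fun w => - f w).
Proof.
move=> [mf [K fK]]; split; first exact: measurable_funN.
by exists K => w; rewrite normrN.
Qed.

Lemma bmfB f g : bmf f -> bmf g -> bmf (fun w => f w - g w).
Proof. by move=> bf bg; apply: bmfD => //; exact: bmfN. Qed.

Lemma bmf_sum (I : Type) (s : seq I) (F : I -> T -> R) :
  (forall i, bmf (F i)) -> bmf (fun w => \sum_(i <- s) F i w).
Proof.
move=> bF; elim: s => [|i s IH].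
  rewrite (_ : (fun w => _) = fun=> 0); first exact: bmf_cst.
  by apply/funext => w; rewrite big_nil.
rewrite (_ : (fun w => _) = fun w => F i w + \sum_(j <- s) F j w).
  exact: bmfD.
by apply/funext => w; rewrite big_cons.
Qed.

Lemma igr_meas g : igr g -> measurable_fun setT g.
Proof. by move=> /measurable_int/measurable_EFinP. Qed.

Lemma igrD f g : igr f -> igr g -> igr (fun w => f w + g w).
Proof.
move=> If Ig; rewrite /igr (_ : _ \o _ = (EFin \o f) \+ (EFin \o g))%E.
  exact: integrableD.
by apply/funext => w /=; rewrite EFinD.
Qed.

Lemma igrN f : igr f -> igr (fun w => - f w).
Proof.
move=> If; rewrite /igr (_ : _ \o _ = \- (EFin \o f))%E.
  exact: integrableN.
by apply/funext => w /=; rewrite EFinN.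
Qed.

Lemma igrB f g : igr f -> igr g -> igr (fun w => f w - g w).
Proof. by move=> If Ig; apply: igrD => //; exact: igrN. Qed.

Lemma igrM h f : bmf h -> igr f -> igr (fun w => h w * f w).
Proof.
move=> [mh [K hK]] If.
rewrite /igr (_ : _ \o _ = (EFin \o h) \* (EFin \o f))%E.
  apply: integrableMr => //; exists K; split; first by rewrite num_real.
  by move=> x Kx w _ /=; rewrite (le_trans (hK w))// ltW.
by apply/funext => w /=; rewrite EFinM.
Qed.

Lemma igrZ (c : R) f : igr f -> igr (fun w => c * f w).
Proof. by move=> If; apply: igrM => //; exact: bmf_cst. Qed.

Lemma igr_le f g : measurable_fun setT f -> (forall w, `|f w| <= g w) ->
  igr g -> igr f.
Proof.
move=> mf fg; apply: le_integrable => //; first exact/measurable_EFinP.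
by move=> w _ /=; rewrite lee_fin (le_trans (fg w))// ler_norm.
Qed.

Lemma igr_sum (I : Type) (s : seq I) (F : I -> T -> R) :
  (forall i, igr (F i)) -> igr (fun w => \sum_(i <- s) F i w).
Proof.
move=> bF; elim: s => [|i s IH].
  rewrite (_ : (fun w => _) = fun=> 0); first exact/bmf_igr/bmf_cst.
  by apply/funext => w; rewrite big_nil.
rewrite (_ : (fun w => _) = fun w => F i w + \sum_(j <- s) F j w).
  exact: igrD.
by apply/funext => w; rewrite big_cons.
Qed.

Lemma ED f g : igr f -> igr g ->
  \int[P]_w (f w + g w) = \int[P]_w f w + \int[P]_w g w.
Proof. by move=> If Ig; rewrite RintegralD. Qed.

Lemma EB f g : igr f -> igr g ->
  \int[P]_w (f w - g w) = \int[P]_w f w - \int[P]_w g w.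
Proof. by move=> If Ig; rewrite RintegralB. Qed.

Lemma EZ (c : R) f : igr f -> \int[P]_w (c * f w) = c * \int[P]_w f w.
Proof. by move=> If; rewrite RintegralZl. Qed.

Lemma E_sum (I : Type) (s : seq I) (F : I -> T -> R) :
  (forall i, igr (F i)) ->
  \int[P]_w (\sum_(i <- s) F i w) = \sum_(i <- s) \int[P]_w F i w.
Proof.
move=> bF; elim: s => [|i s IH].
  rewrite big_nil (_ : (fun w => _) = fun=> 0).
    by rewrite Rintegral_cst// mul0r.
  by apply/funext => w; rewrite big_nil.
rewrite big_cons -IH -ED//; last exact: igr_sum.
by apply: eq_Rintegral => w _; rewrite big_cons.
Qed.

Lemma E_cst (c : R) : \int[P]_w c = c.
Proof. transitivity (c * fine (P setT)); first exact: Rintegral_cst.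
by rewrite probability_setT mulr1. Qed.

Lemma le_E f g : igr f -> igr g -> (forall w, f w <= g w) ->
  \int[P]_w f w <= \int[P]_w g w.
Proof. by move=> If Ig fg; apply: le_Rintegral. Qed.

Lemma norm_E_le f g : igr f -> igr g -> (forall w, `|f w| <= g w) ->
  `|\int[P]_w f w| <= \int[P]_w g w.
Proof.
move=> If Ig fg; rewrite ler_norml; apply/andP; split.
  rewrite -mulN1r -EZ//; apply: le_E => //; first exact: igrZ.
  by move=> w; rewrite mulN1r; have := fg w; rewrite ler_norml => /andP[].
by apply: le_E => // w; have := fg w; rewrite ler_norml => /andP[].
Qed.

Lemma E_ind (A : set T) : measurable A -> \int[P]_w \1_A w = fine (P A).
Proof.
by move=> mA; rewrite /Rintegral integral_indic// setIT.
Qed.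

Lemma eqE f g : (forall w, f w = g w) -> \int[P]_w f w = \int[P]_w g w.
Proof. by move=> fg; apply: eq_Rintegral => w _. Qed.

Lemma EFin_E f : igr f -> (\int[P]_w f w)%:E = (\int[P]_w (f w)%:E)%E.
Proof. by move=> If; rewrite /Rintegral fineK// integrable_fin_num. Qed.

Lemma E_dct (f_ : nat -> T -> R) f g :
  (forall n, measurable_fun setT (f_ n)) -> igr g ->
  (forall n w, `|f_ n w| <= g w) -> (forall w, f_ ^~ w @ \oo --> f w) ->
  igr f /\ (fun n => \int[P]_w f_ n w) @ \oo --> \int[P]_w f w.
Proof.
move=> mf Ig fg ff.
have mlim : measurable_fun setT f.
  by apply: (measurable_fun_cvg mf) => w _; exact: ff.
have [||||IF _ cF] := @dominated_convergence _ _ _ P setT measurableT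
  (fun n => EFin \o f_ n) (EFin \o f) (EFin \o g) _ _ _ Ig _.
- by move=> n; exact/measurable_EFinP.
- exact/measurable_EFinP.
- by apply: aeW => w _; apply: cvg_EFin; [exact: nearW|exact: ff].
- by apply: aeW => w n _ /=; rewrite lee_fin.
by split=> //; apply: fine_cvg; rewrite EFin_E.
Qed.

Lemma E_bct (f_ : nat -> T -> R) f (K : R) :
  (forall n, measurable_fun setT (f_ n)) ->
  (forall n w, `|f_ n w| <= K) -> (forall w, f_ ^~ w @ \oo --> f w) ->
  igr f /\ (fun n => \int[P]_w f_ n w) @ \oo --> \int[P]_w f w.
Proof. by move=> mf; apply: E_dct => //; exact/bmf_igr/bmf_cst. Qed.

(** Integrability of the limit is part of the conclusion: the moments of a duration are not known to
    be finite beforehand, only the expectations of their approximations are bounded. *)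
Lemma E_fatou (f_ : nat -> T -> R) f (C : R) :
  (forall n, igr (f_ n)) -> (forall n w, 0 <= f_ n w) ->
  (forall w, f_ ^~ w @ \oo --> f w) -> (forall n, \int[P]_w f_ n w <= C) ->
  igr f /\ \int[P]_w f w <= C.
Proof.
move=> If f0 ff fC.
have mf n : measurable_fun setT (f_ n) by exact: igr_meas.
have mlim : measurable_fun setT f.
  by apply: (measurable_fun_cvg mf) => w _; exact: ff.
have g0 w : 0 <= f w.
  rewrite -(cvg_lim (@Rhausdorff R) (ff w)); apply: limr_ge; first exact: cvgP (ff w).
  by apply: nearW => n; exact: f0.
have le : (\int[P]_w (f w)%:E <= C%:E)%E.
  rewrite (eq_integral (fun w => limn_einf (fun n => (f_ n w)%:E))); last first.
    move=> w _; have cw : (EFin \o f_^~ w) n @[n --> \oo] --> (f w)%:E.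
      by apply: cvg_EFin; [exact: nearW|exact: ff].
    by rewrite is_cvg_limn_einfE; [rewrite (cvg_lim _ cw)|exact: cvgP cw].
  apply: (le_trans (@fatou _ _ _ P setT measurableT (fun n => EFin \o f_ n) _ _)).
  - by move=> n; exact/measurable_EFinP.
  - by move=> n w _; rewrite lee_fin.
  rewrite limn_einf_lim; apply: lime_le; first exact: is_cvg_einfs.
  apply: nearW => n; apply: (@le_trans _ _ (\int[P]_w (f_ n w)%:E)%E).
    by apply: ereal_inf_lbound; exists n => //=.
  by rewrite -EFin_E// lee_fin.
have Iff : igr f.
  apply/integrableP; split; first exact/measurable_EFinP.
  rewrite (eq_integral (EFin \o f)); last by move=> w _ /=; rewrite ger0_norm.
  by rewrite (le_lt_trans le)// ltry.
by split=> //; rewrite -lee_fin EFin_E.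
Qed.
End Expectation.

(** * Resolvent of a martingale problem *)

Section Joint.
Context {R : realType} {d : measure_display} {T : measurableType d}.

Lemma floor_div_cvg (t : R) :
  (fun n : nat => (Num.floor (t * n.+1%:R))%:~R / n.+1%:R) @ \oo --> t.
Proof.
apply/cvgrPdist_le => e e0.
have [m _ H] := (near_infty_natSinv_lt (PosNum e0)).
near=> n.
have n0 : 0 < n.+1%:R :> R by [].
have /andP[l1 l2] := floor_itv (t * n.+1%:R).
have : `|t - (Num.floor (t * n.+1%:R))%:~R / n.+1%:R| <= n.+1%:R^-1.
  rewrite -(@ler_pM2r _ n.+1%:R)// mulVf ?gt_eqF// -[X in _ * X](gtr0_norm n0).
  rewrite -normrM mulrBl divfK ?gt_eqF// ger0_norm ?subr_ge0//.
  by rewrite lerBlDl -intrD1 ltW.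
move=> /le_trans; apply; apply: ltW.
by apply: H; near: n; exists m.
Unshelve. all: by end_near. Qed.

(** Rounding [t] down to a multiple of [1 / (n + 1)] gives functions that are constant in [t] on
    countably many cells, hence jointly measurable; continuity in [t] makes them converge
    pointwise. *)
Lemma measurable_joint (g : R -> T -> R) : (forall t, measurable_fun setT (g t)) ->
  (forall w, continuous (fun t => g t w)) ->
  measurable_fun setT (fun p : T * R => g p.2 p.1).
Proof.
move=> mg cg.
pose q (n : nat) (t : R) := (Num.floor (t * n.+1%:R))%:~R / n.+1%:R : R.
apply: (@measurable_fun_cvg _ _ _ _ (fun n (p : T * R) => g (q n p.2) p.1)) => //; last first.
  move=> [w t] _ /=; apply: (cvg_comp (fun n => q n t) (fun s => g s w)); last exact: cg.
  exact: floor_div_cvg.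
move=> n _ B mB; rewrite setTI.
rewrite (_ : _ @^-1` B = \bigcup_(k : int) ((g (k%:~R / n.+1%:R) @^-1` B) `*`
   `[k%:~R / n.+1%:R, (k + 1)%:~R / n.+1%:R[%classic)); last first.
  apply/seteqP; split => [[w t] /= Bw|[w t] /= [k _ [/= Bw]]].
    exists (Num.floor (t * n.+1%:R)) => //; split => //=.
    by rewrite in_itv/= ler_pdivrMr// ltr_pdivlMr// floor_itv.
  rewrite in_itv/= ler_pdivrMr// ltr_pdivlMr// => H.
  by rewrite /q (floor_def H).
apply: countable_bigcupT_measurable => // k; apply: measurableX => //.
by rewrite -[X in measurable X]setTI; exact: mg.
Qed.

Variable P : probability T R.
Local Notation mu := (@lebesgue_measure R).

(** Fubini on [T] times [[s, t]], a space of finite measure on which the bounded [c] is integrable;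
    joint measurability comes from [measurable_joint]. *)
Lemma E_exchange (c : R -> T -> R) (s t K : R) :
  (forall r, measurable_fun setT (c r)) ->
  (forall w, continuous (fun r => c r w)) ->
  (forall r w, s <= r <= t -> `|c r w| <= K) ->
  bmf (fun w => \int[mu]_(r in `[s, t]) c r w) /\
  \int[P]_w (\int[mu]_(r in `[s, t]) c r w) = \int[mu]_(r in `[s, t]) (\int[P]_w c r w).
Proof.
move=> mc cc cK.
pose f (p : T * measurableTypeR R) := c p.2 p.1.
pose A : set (T * measurableTypeR R) := [set: T] `*` `[s, t]%classic.
have mA : measurable A by exact: measurableX.
have mf : measurable_fun setT f by exact: measurable_joint.
have fin : ((P \x mu) A < +oo)%E.
  rewrite product_measure1E//=; apply: lte_mul_pinfty => //.
    by rewrite probability_setT.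
  by rewrite lebesgue_measure_itv/=; case: ifP; rewrite ?ltry// -EFinB ltry.
have IA : (P \x mu)%E.-integrable A (EFin \o f).
  apply: measurable_bounded_integrable => //; first exact: measurable_funTS.
  exists K; split; first by rewrite num_real.
  move=> x Kx [w r] [/= _]; rewrite in_itv/= => rst.
  by rewrite (le_trans (cK _ _ rst))// ltW.
have I := (integrable_mkcond (EFin \o f) mA).1 IA.
have E1 w : (\int[mu]_r ((EFin \o f) \_ A) (w, r) = \int[mu]_(r in `[s, t]) (c r w)%:E)%E.
  rewrite [RHS]integral_mkcond; apply: eq_integral => r _.
  by rewrite !patchE /A in_setX in_setT.
have If r : s <= r <= t -> igr P (c r).
  move=> rst; apply: bmf_igr; split; first exact: mc.
  by exists K => w; exact: cK.
pose Ec r := \int[P]_w c r w.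
have E2 r : (\int[P]_w ((EFin \o f) \_ A) (w, r) =
   ((EFin \o Ec) \_ `[s, t]) r)%E.
  rewrite patchE; case: ifPn => rs.
    rewrite /= EFin_E; last by apply: If; move: rs; rewrite inE/= in_itv.
    by apply: eq_integral => w _; rewrite patchE /A in_setX in_setT rs.
  apply: integral0_eq => w _; rewrite patchE /A in_setX in_setT /=.
  by rewrite (negbTE rs).
have Iw w : mu.-integrable `[s, t] (EFin \o c ^~ w).
  apply: continuous_compact_integrable; first exact: segment_compact.
  exact: continuous_subspaceT.
have E1' w : fubini_F mu ((EFin \o f) \_ A) w = (\int[mu]_(r in `[s, t]) c r w)%:E.
  by rewrite /fubini_F E1 /Rintegral fineK//; apply: integrable_fin_num => //; exact: Iw.
have B1 : bmf (fun w => \int[mu]_(r in `[s, t]) c r w).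
  split.
    apply/measurable_EFinP; move: (measurable_fubini_F I).
    by congr measurable_fun; apply/funext => w; rewrite E1'.
  exists (\int[mu]_(r in `[s, t]) K) => w.
  have Ic : mu.-integrable `[s, t] (EFin \o (fun=> K)).
    apply: continuous_compact_integrable; first exact: segment_compact.
    by apply: continuous_subspaceT => x; exact: cvg_cst.
  have In : mu.-integrable `[s, t] (EFin \o (fun r => `|c r w|)).
    by have := integrable_norm (Iw w).
  apply: (le_trans (le_normr_Rintegral _ (Iw w))) => //.
  by apply: le_Rintegral => // r /=; rewrite in_itv => rst; exact: cK.
split=> //.
apply: EFin_inj; rewrite EFin_E; last exact: bmf_igr.
have := Fubini I; under eq_integral do rewrite E1.
under [X in _ = X -> _]eq_integral do rewrite E2.
rewrite -integral_mkcond => H.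
have Hw : (\int[P]_w (\int[mu]_(r in `[s, t]) c r w)%:E =
           \int[P]_w \int[mu]_(r in `[s, t]) (c r w)%:E)%E.
  by apply: eq_integral => w _; rewrite -E1' /fubini_F E1.
rewrite Hw H /Rintegral fineK//.
suff : (\int[mu]_(r in `[s, t]) (EFin \o Ec) r)%E \is a fin_num by [].
by rewrite -H -Hw; apply: integrable_fin_num => //; exact: bmf_igr B1.
Qed.
End Joint.

Section Resolvent.
Context {R : realType} {d : measure_display} {T : measurableType d}.
Variable P : probability T R.
Local Notation mu := (@lebesgue_measure R).

Lemma E_continuous (c : R -> T -> R) (K : R) :
  (forall r, measurable_fun setT (c r)) ->
  (forall w, continuous (fun r => c r w)) ->
  (forall r w, `|c r w| <= K) ->
  continuous (fun r => \int[P]_w c r w).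
Proof.
move=> mc cc cK r; apply/continuous_withinNx/cvgr_dnbhsP => u [_ ur].
apply: (proj2 (@E_bct _ _ _ P _ _ K _ _ _)) => // w.
exact: (cvg_comp u (c ^~ w) ur (cc w r)).
Qed.

(** Put [a r = E[1_A phi r]] and [b r = E[1_A psi r]]. The hypothesis and Fubini say that [a' = b]
    on []s, t[], so [exp (- l r) a r] has derivative [exp (- l r) (b r - l a r)]. Integrating this
    and undoing Fubini gives the discounted identity. *)
Lemma resolvent (phi psi : R -> T -> R) (A : set T) (K l s t : R) : 0 < l ->
  (forall r, measurable_fun setT (phi r)) ->
  (forall r, measurable_fun setT (psi r)) ->
  (forall w, continuous (fun r => phi r w)) ->
  (forall w, continuous (fun r => psi r w)) ->
  (forall r w, `|phi r w| <= K) -> (forall r w, `|psi r w| <= K) ->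
  measurable A -> s < t ->
  (forall r, s <= r <= t -> \int[P]_w (\1_A w *
     (phi r w - phi s w - \int[mu]_(q in `[s, r]) psi q w)) = 0) ->
  \int[P]_w (\1_A w * (expR (- l * t) * phi t w - expR (- l * s) * phi s w -
    \int[mu]_(q in `[s, t]) (expR (- l * q) * (psi q w - l * phi q w)))) = 0.
Proof.
move=> l0 mphi mpsi cphi cpsi bphi bpsi mA st H.
pose a r := \int[P]_w (\1_A w * phi r w).
pose b r := \int[P]_w (\1_A w * psi r w).
have bA := bmf_ind mA.
have i1 w : `|\1_A w : R| <= 1 by rewrite indicE; case: (_ \in _); rewrite ?normr1 ?normr0.
have bph r : bmf (phi r) by split => //; exists K.
have bps r : bmf (psi r) by split => //; exists K.
have cc (c : R -> T -> R) : (forall w, continuous (fun r => c r w)) ->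
   forall w, continuous (fun r => \1_A w * c r w).
  by move=> cc w r; apply: cvgM; [exact: cvg_cst|exact: cc].
have mc (c : R -> T -> R) : (forall r, measurable_fun setT (c r)) ->
   forall r, measurable_fun setT (fun w => \1_A w * c r w).
  by move=> mc r; apply: measurable_funM => //; case: bA.
have bc (c : R -> T -> R) (L : R) : (forall r w, `|c r w| <= L) ->
   forall r w, `|\1_A w * c r w| <= L.
  move=> bc r w; rewrite normrM; apply: (le_trans _ (bc r w)).
  by rewrite -[leRHS]mul1r ler_wpM2r.
have ca : continuous a.
  by apply: (@E_continuous (fun r w => \1_A w * phi r w) K); [exact: mc|exact: cc|exact: bc].
have cb : continuous b.
  by apply: (@E_continuous (fun r w => \1_A w * psi r w) K); [exact: mc|exact: cc|exact: bc].
have X (c : R -> T -> R) (L : R) r : (forall r, measurable_fun setT (c r)) ->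
   (forall w, continuous (fun r => c r w)) -> (forall r w, s <= r <= t -> `|c r w| <= L) ->
   r <= t ->
   bmf (fun w => \1_A w * \int[mu]_(q in `[s, r]) c q w) /\
   \int[P]_w (\1_A w * \int[mu]_(q in `[s, r]) c q w) =
   \int[mu]_(q in `[s, r]) (\int[P]_w (\1_A w * c q w)).
  move=> mc' cc' bc' rt.
  have bc2 q w : s <= q <= r -> `|c q w| <= L.
    by move=> /andP[sq qr]; rewrite bc'// sq (le_trans qr).
  have bc1 q w : s <= q <= r -> `|\1_A w * c q w| <= L.
    move=> /bc2 bq; rewrite normrM; apply: (le_trans _ (bq w)).
    by rewrite -[leRHS]mul1r ler_wpM2r.
  have [B0 _] := @E_exchange _ _ _ P c s r L mc' cc' bc2.
  have [B1 E1] := @E_exchange _ _ _ P (fun r w => \1_A w * c r w) s r L (mc _ mc') (cc _ cc') bc1.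
  split; first exact: bmfM.
  rewrite -E1; apply: eqE => w; rewrite RintegralZl//.
  apply: continuous_compact_integrable; first exact: segment_compact.
  exact: continuous_subspaceT.
have aE r : s <= r <= t -> a r = a s + \int[mu]_(q in `[s, r]) b q.
  move=> rst; have [B1 E1] := X psi K r mpsi cpsi (fun r w _ => bpsi r w) (proj2 (andP rst)).
  move: (H r rst); under eqE do rewrite 2!mulrBr.
  rewrite !EB; [|exact/bmf_igr/bmfM..|apply/igrB; exact/bmf_igr/bmfM|exact: bmf_igr].
  rewrite E1 -/(a r) -/(a s) -/b => /eqP.
  by rewrite !subr_eq add0r addrC => /eqP.
have Ib x y : mu.-integrable `[x, y] (EFin \o b).
  apply: continuous_compact_integrable; first exact: segment_compact.
  exact: continuous_subspaceT.
have da r : s < r -> r < t -> is_derive r 1 a (b r).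
  move=> sr rt.
  have [D1 D2] := @continuous_FTC1_closed _ b s r t rt (Ib _ _) sr (cb r).
  apply: (@near_eq_is_derive _ _ _ (fun x => a s + \int[mu]_(q in `[s, x]) b q)).
    near=> x; rewrite [RHS]aE//; apply/andP; split; apply: ltW; near: x.
      exact: lt_nbhsr.
    exact: lt_nbhsl.
  have ? : is_derive r 1 (fun x => \int[mu]_(q in `[s, x]) b q) (b r).
    by rewrite -D2 derive1E; exact: derivableP.
  by rewrite -[b r]add0r; apply: is_deriveD.
pose G r := expR (- l * r) * a r.
have cG : continuous G.
  move=> r; apply: cvgM; last exact: ca.
  by apply: continuous_comp; [exact: mulrl_continuous|exact: continuous_expR].
pose g r := expR (- l * r) * (b r - l * a r).
have cg : continuous g.
  move=> r; apply: cvgM.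
    by apply: continuous_comp; [exact: mulrl_continuous|exact: continuous_expR].
  by apply: cvgB; [exact: cb|apply: cvgM; [exact: cvg_cst|exact: ca]].
have dG r : s < r -> r < t -> is_derive r 1 G (g r).
  move=> sr rt; have := da r sr rt => ?.
  rewrite /G /g; apply: is_derive_eq.
  by rewrite /GRing.scale /=; ring.
have FT : \int[mu]_(q in `[s, t]) g q = G t - G s.
  apply: EFin_inj; rewrite /Rintegral (@continuous_FTC2 _ g G)//.
  - exact: continuous_subspaceT.
  - split.
    + by move=> r; rewrite in_itv => /andP[sr rt]; have [] := dG r sr rt.
    + by apply: cvg_at_right_filter; exact: cG.
    + by apply: cvg_at_left_filter; exact: cG.
  - by move=> r; rewrite in_itv => /andP[sr rt]; rewrite derive1E; apply: derive_val; exact: dG.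
have bexp r : s <= r -> `|expR (- l * r)| <= expR (- l * s).
  by move=> sr; rewrite ger0_norm ?expR_ge0// ler_expR !mulNr lerN2 ler_wpM2l// ltW.
have mc2 r : measurable_fun setT (fun w => expR (- l * r) * (psi r w - l * phi r w)).
  apply: measurable_funM => //; apply: measurable_funB => //.
  exact: measurable_funM.
have cc2 w : continuous (fun r => expR (- l * r) * (psi r w - l * phi r w)).
  move=> r; apply: cvgM.
    by apply: continuous_comp; [exact: mulrl_continuous|exact: continuous_expR].
  by apply: cvgB; [exact: cpsi|apply: cvgM; [exact: cvg_cst|exact: cphi]].
have [|B1 E1] := X (fun r w => expR (- l * r) * (psi r w - l * phi r w))
    (expR (- l * s) * (K + l * K)) t mc2 cc2 _ (lexx _).
  move=> r w /andP[sr _]; rewrite normrM ler_pM//; first exact: bexp.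
  by rewrite (le_trans (ler_normB _ _))// normrM lerD// (gtr0_norm l0) ler_wpM2l// ltW.
have E2 : \int[mu]_(q in `[s, t]) (\int[P]_w (\1_A w * (expR (- l * q) * (psi q w - l * phi q w)))) =
   \int[mu]_(q in `[s, t]) g q.
  apply: eq_Rintegral => q _; rewrite /g /a /b -EZ; last exact/bmf_igr/bmfM.
  rewrite -EB; [|exact/bmf_igr/bmfM|exact/igrZ/bmf_igr/bmfM].
  rewrite -EZ; last by apply: igrB; [exact/bmf_igr/bmfM|exact/igrZ/bmf_igr/bmfM].
  by apply: eqE => w; ring.
under eqE do rewrite 2!mulrBr.
rewrite !EB; [|by do ?[apply: bmfM => //|apply: bmf_igr|exact: bmf_cst]..|apply: igrB|exact: bmf_igr].
- rewrite E1 E2 FT /G /a -!EZ; [|exact/bmf_igr/bmfM..].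
  by apply/eqP; rewrite subr_eq0; apply/eqP; congr (_ - _); apply: eqE => w; ring.
- by do ?[apply: bmfM => //|apply: bmf_igr|exact: bmf_cst].
- by do ?[apply: bmfM => //|apply: bmf_igr|exact: bmf_cst].
Unshelve. all: by end_near. Qed.
End Resolvent.

(** * Observables and the martingale problem *)

Section SpiderEval.
Context {R : realType}.
Variables (N : nat) (i0 : 'I_N).
Implicit Types (f : 'I_N -> R -> R).

(** A sum of legwise increments replaces the choice of a leg in [spider_eval]. It is continuous and
    measurable in the coordinates, and agrees with [spider_eval] at spider points because at most
    one increment is nonzero there. *)
Definition obs f (x : 'I_N -> R) : R := f i0 0 + \sum_(i < N) (f i (x i) - f i 0).

Lemma spider_evalE f x : spider_point x -> (forall i j, f i 0 = f j 0) ->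
  spider_eval f x = obs f x.
Proof.
move=> [_ px] f0; rewrite /spider_eval /obs; case: pickP => [i xi|x0].
  rewrite (bigD1 i)//= big1 ?addr0 => [|j ji]; first by rewrite (f0 i i0) subrKC.
  case: (eqVneq (x j) 0) => [->|xj]; first by rewrite subrr.
  by rewrite (px j i xj xi) eqxx in ji.
rewrite big1 ?addr0 => [|j _]; last by have := x0 j => /negbFE/eqP->; rewrite subrr.
case: pickP => [i _|/(_ i0)//]; exact: f0.
Qed.

Lemma spider_point_abs x i : @spider_point R N x -> x i != 0 -> spider_abs x = x i.
Proof.
move=> [_ px] xi; rewrite /spider_abs (bigD1 i)//= big1 ?addr0// => j ji.
by apply/eqP/negPn/negP => xj; rewrite (px j i xj xi) eqxx in ji.
Qed.

Lemma spider_abs_ge x i : @spider_point R N x -> x i <= spider_abs x.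
Proof.
move=> [p _]; rewrite /spider_abs (bigD1 i)//= lerDl sumr_ge0// => j _.
by case/andP: (p j).
Qed.

Lemma spider_abs_le1 x : @spider_point R N x -> 0 <= spider_abs x <= 1.
Proof.
move=> px; have [i xi|x0] := pickP (fun i => x i != 0).
  by rewrite (spider_point_abs px xi); case: px.
rewrite /spider_abs big1 ?lexx ?ler01// => i _.
by have := x0 i => /negbFE/eqP.
Qed.

Lemma spider_abs_eq0 x : @spider_point R N x -> (spider_abs x = 0) <-> (forall i, x i = 0).
Proof.
move=> px; split=> [H i|H]; last by rewrite /spider_abs big1.
apply/eqP; rewrite eq_le -{1}H spider_abs_ge//=.
by case: px => p _; case/andP: (p i).
Qed.

Lemma itv01_bounded f : (forall i, continuous (f i)) ->
  exists K, forall i x, 0 <= x <= 1 -> `|f i x| <= K.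
Proof.
move=> cf.
have H i : exists K, forall x, 0 <= x <= 1 -> `|f i x| <= K.
  have [|c _ H] := @EVT_max R (fun x => `|f i x|) 0 1 ler01.
    apply: continuous_subspaceT => x; apply: cvg_norm; exact: cf.
  by exists `|f i c| => x x01; apply: H; rewrite in_itv.
have [K HK] := choice H; exists (\sum_i `|K i|) => i x x01.
rewrite (bigD1 i)//= (le_trans (HK i x x01))// (le_trans (ler_norm _))// lerDl.
by rewrite sumr_ge0.
Qed.

Lemma obs_bounded f : (forall i, continuous (f i)) ->
  exists K, forall x, spider_point x -> `|obs f x| <= K.
Proof.
move=> cf; have [K HK] := itv01_bounded cf.
exists (`|f i0 0| + \sum_(i < N) (K + `|f i 0|)) => x [p _].
rewrite (le_trans (ler_normD _ _))// lerD2l (le_trans (ler_norm_sum _ _ _))//.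
apply: ler_sum => i _; rewrite (le_trans (ler_normB _ _))// lerD2r.
exact: HK.
Qed.

Lemma spider_dom_continuous f : spider_dom f ->
  [/\ forall i, continuous (f i), forall i, continuous (spider_gen f i),
   forall i j, f i 0 = f j 0 & forall i j, spider_gen f i 0 = spider_gen f j 0].
Proof.
move=> [D f0 g0 _ _]; split.
- by move=> i x; have [D1 _] := D i; exact/differentiable_continuous/derivable1_diffP.
- by move=> i x; apply: cvgM; [exact: cvg_cst|have [_ [_]] := D i; exact].
- exact: f0.
- by move=> i j; rewrite /spider_gen (g0 i j).
Qed.
End SpiderEval.

(** * Natural filtration, and extension from cylinder events to the whole of it *)

Section Filtration.
Context {R : realType} {d : measure_display} {T : measurableType d}.
Variables (N : nat) (X : 'I_N -> R -> T -> R).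

(** These are exactly the test events of the martingale problem; they are closed under intersection,
    as the Dynkin argument requires. *)
Definition cyl (s : R) : set (set T) := [set C | exists m (leg : 'I_m -> 'I_N)
  (u : 'I_m -> R) (B : 'I_m -> set R), [/\ forall j, 0 <= u j <= s,
  forall j, measurable (B j) & C = [set w | forall j, B j (X (leg j) (u j) w)]]].

Definition Ft (s : R) : set (set T) := <<s cyl s >>.

Lemma cylI s : setI_closed (cyl s).
Proof.
move=> _ _ [m1 [l1 [u1 [B1 [hu1 hB1 ->]]]]] [m2 [l2 [u2 [B2 [hu2 hB2 ->]]]]].
exists (m1 + m2)%N, (fun j => match fintype.split j with inl j => l1 j | inr j => l2 j end).
exists (fun j => match fintype.split j with inl j => u1 j | inr j => u2 j end).
exists (fun j => match fintype.split j with inl j => B1 j | inr j => B2 j end).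
split; [by move=> j; case: fintype.split|by move=> j; case: fintype.split|].
apply/seteqP; split => w /=.
  by move=> [H1 H2] j; case: fintype.split.
move=> H; split => j.
  by have := H (lshift m2 j); rewrite (unsplitK (inl j : 'I_m1 + 'I_m2)).
by have := H (rshift m1 j); rewrite (unsplitK (inr j : 'I_m1 + 'I_m2)).
Qed.

Lemma cylT s : cyl s setT.
Proof.
exists 0%N, (fun j : 'I_0 => match j with Ordinal _ H => False_rect _ (notF H) end).
exists (fun=> 0), (fun=> setT); split => [[]//|[]//|].
by apply/seteqP; split => // w _ [].
Qed.

Lemma Ft_mono s t : s <= t -> Ft s `<=` Ft t.
Proof.
move=> st; apply: sub_smallest2r => // _ [m [l [u [B [hu hB ->]]]]].
exists m, l, u, B; split => // j; have /andP[-> us] := hu j.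
exact: le_trans us st.
Qed.

Lemma Ft_X s i u B : 0 <= u <= s -> measurable B -> Ft s [set w | B (X i u w)].
Proof.
move=> us mB; apply: sub_sigma_algebra.
exists 1%N, (fun=> i), (fun=> u), (fun=> B); split => //.
by apply/seteqP; split => w /=; [move=> ? _|move=> /(_ ord0)].
Qed.

(** Measurability of [g] is asked over every measurable space so that it can be instantiated on [T]
    with the sigma-algebra generated by [cyl s] in place of the ambient one. *)
Lemma Ft_fun (g : ('I_N -> R) -> R) s u B : 0 <= u <= s -> measurable B ->
  (forall d' (T' : measurableType d') (Y : 'I_N -> T' -> R),
    (forall i, measurable_fun setT (Y i)) -> measurable_fun setT (fun w => g (Y ^~ w))) ->
  Ft s [set w | B (g (fun i => X i u w))].
Proof.
move=> us mB mg.
have := mg _ (g_sigma_algebraType (cyl s)) (fun i => X i u).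
move=> /(_ _ measurableT B mB); rewrite setTI; apply.
by move=> i _ B' mB'; rewrite setTI; exact: Ft_X.
Qed.

Lemma Ft_abs s u B : 0 <= u <= s -> measurable B ->
  Ft s [set w | B (spider_abs (fun i => X i u w))].
Proof.
move=> us mB; apply: (@Ft_fun (@spider_abs R N)) => // d' T' Y mY.
exact: measurable_sum.
Qed.

Hypothesis mX : forall i t, measurable_fun setT (X i t).

Lemma Ft_measurable s A : Ft s A -> measurable A.
Proof.
apply: smallest_sub; first exact: sigma_algebra_measurable.
move=> _ [m [l [u [B [hu hB ->]]]]].
rewrite (_ : [set w | _] = \bigcap_(j in [set: 'I_m]) (X (l j) (u j) @^-1` B j)).
  apply: fin_bigcap_measurable => // j _.
  by rewrite -[X in measurable X]setTI; exact: mX.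
by apply/seteqP; split => w /= H j => [_|]; exact: H.
Qed.

Variable P : probability T R.

(** The events satisfying the identity form a Dynkin class: complements use the identity for the
    whole space, itself a cylinder event, and disjoint unions use bounded convergence along the
    partial unions. *)
Lemma Ft_martingale s (Z : T -> R) : bmf Z ->
  (forall A, cyl s A -> \int[P]_w (\1_A w * Z w) = 0) ->
  forall A, Ft s A -> \int[P]_w (\1_A w * Z w) = 0.
Proof.
move=> bZ H A.
have mF (B : set T) : Ft s B -> measurable B by exact: Ft_measurable.
have bI (B : set T) : Ft s B -> bmf (fun w => \1_B w * Z w).
  by move=> /mF/bmf_ind => bB; apply: bmfM.
have FT : Ft s setT by apply: sub_sigma_algebra; exact: cylT.
have bZ1 := bI setT FT.
apply: (@dynkin_induction _ (g_sigma_algebraType (cyl s)) (cyl s)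
  (fun A => \int[P]_w (\1_A w * Z w) = 0)) => //.
- exact: cylI.
- exact: H (cylT s).
- move=> B FB HB.
  transitivity (\int[P]_w (\1_setT w * Z w - \1_B w * Z w)).
    by apply: eqE => w; rewrite -mulrBl !indicE in_setT in_setC; case: (w \in B); rewrite /= ?subr0 ?subrr ?mul0r.
  by rewrite EB ?(H _ (cylT s)) ?HB ?subrr//; exact/bmf_igr/bI.
- move=> F mFn tF HF.
  pose U n := \bigcup_(k < n) F k.
  have FU n : Ft s (U n).
    rewrite /U bigcup_mkord.
    by apply: (@bigsetU_measurable _ (g_sigma_algebraType (cyl s))) => k _; exact: mFn.
  have Hn n : \int[P]_w (\1_(U n) w * Z w) = 0.
    elim: n => [|n IH].
      rewrite (eqE _ (g := fun=> 0)) ?E_cst// => w; rewrite /U indicE memNset ?mul0r//.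
      by move=> [k].
    transitivity (\int[P]_w (\1_(U n : set T) w * Z w + \1_(F n : set T) w * Z w)); last first.
      rewrite ED ?IH ?HF ?addr0//; apply/bmf_igr/bI; first exact: FU.
      exact: mFn.
    apply: eqE => w; rewrite -mulrDl; congr (_ * _); rewrite !indicE.
    have [wn|wn] := boolP (w \in F n).
      rewrite mem_set; last by exists n; rewrite /= ?ltnS//; move: wn; rewrite inE.
      rewrite memNset ?add0r// => -[k /= kn Fk].
      have := tF k n I I; rewrite inE in wn.
      by move=> /(_ (ex_intro _ w (conj Fk wn))) kn'; rewrite kn' ltnn in kn.
    rewrite addr0; congr (_%:R); congr nat_of_bool; apply/idP/idP; rewrite !inE.
      move=> [k /= kn Fk]; exists k => //=.
      move: kn; rewrite ltnS leq_eqVlt => /orP[/eqP kn|//].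
      by move: wn; rewrite -kn notin_setE.
    by move=> [k /= kn Fk]; exists k => //=; rewrite ltnS ltnW.
  have [K ZK] := bZ.2.
  have := @E_bct _ _ _ P (fun n w => \1_(U n) w * Z w) (fun w => \1_(\bigcup_k F k) w * Z w) K.
  case.
  + by move=> n; apply: (bI _ _).1; exact: FU.
  + move=> n w; rewrite normrM (le_trans _ (ZK w))//.
    by rewrite -[leRHS]mul1r ler_wpM2r// indicE; case: (_ \in _); rewrite ?normr1 ?normr0.
  + move=> w; apply: cvgM; last exact: cvg_cst.
    apply: cvg_near_cst; rewrite !indicE.
    have [|wn] := boolP (w \in \bigcup_k F k).
      rewrite inE => -[k _ Fk]; exists k.+1 => // n /= kn.
      by rewrite /= indicE mem_set//; exists k.
    apply: nearW => n; rewrite /= indicE memNset// => -[k _ Fk].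
    by move: wn; rewrite notin_setE; apply; exists k.
  move=> _; rewrite (eq_cvg _ _ Hn) => /(cvg_lim (@Rhausdorff R)) <-.
  by rewrite lim_cst.
Qed.
End Filtration.

Lemma continuous_sum {R : realType} (I : Type) (s : seq I) (F : I -> R -> R) :
  (forall i, continuous (F i)) -> continuous (fun x => \sum_(i <- s) F i x).
Proof.
move=> cF; elim: s => [|i s IH] x.
  under eq_fun do rewrite big_nil.
  exact: cvg_cst.
under eq_fun do rewrite big_cons.
by apply: cvgD; [exact: cF|exact: IH].
Qed.

(** * Plain and discounted martingales along the path *)

Section SpiderMartingale.
Context {R : realType} {d : measure_display} {T : measurableType d}.
Variable P : probability T R.
Variables (N : nat) (i0 : 'I_N) (X : 'I_N -> R -> T -> R).
Hypothesis hX : spider_BM P X.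
Local Notation mu := (@lebesgue_measure R).

(* Paths are only controlled at nonnegative times; [Num.max t 0] freezes them before 0. *)
Definition ob (f : 'I_N -> R -> R) (t : R) (w : T) : R :=
  obs i0 f (fun i => X i (Num.max t 0) w).

Lemma max0_continuous : continuous (fun t : R => Num.max t 0).
Proof.
rewrite (_ : (fun t => _) = fun t : R => (t + `|t|) / 2); last first.
  apply/funext => t; rewrite maxr_absE subr0 addr0//.
move=> t; apply: cvgM; last exact: cvg_cst.
by apply: cvgD; [exact: cvg_id|apply: cvg_norm; exact: cvg_id].
Qed.

Lemma path_continuous i w : continuous (fun t : R => X i (Num.max t 0) w).
Proof.
have [_ _ cX _ _] := hX.
move=> t; have := cX i w.
have m0 : [set t : R | 0 <= t] (Num.max t 0) by rewrite /= le_max lexx orbT.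
move=> /(_ (Num.max t 0)) H.
apply: (@cvg_comp _ _ _ (fun t : R => Num.max t 0) (X i ^~ w) (nbhs t) _ _ _ H).
apply/subspace_cvgP => // A /= nA.
have : nbhs (Num.max t 0) [set x | 0 <= x -> A x] by exact: nA.
move=> nH; have H1 : nbhs t ((fun t : R => Num.max t 0) @^-1` [set x | 0 <= x -> A x]).
  exact: (@max0_continuous t _ nH).
change (nbhs t ((fun t : R => Num.max t 0) @^-1` A)).
move: H1; apply: filterS => x /=; apply.
by rewrite le_max lexx orbT.
Qed.

Lemma ob_continuous f w : (forall i, continuous (f i)) -> continuous (fun t => ob f t w).
Proof.
move=> cf t; apply: cvgD; first exact: cvg_cst.
apply: continuous_sum => i {}t; apply: cvgB; last exact: cvg_cst.
apply: (cvg_comp (fun t => X i (Num.max t 0) w) (f i)); first exact: path_continuous.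
exact: cf.
Qed.

Lemma obs_measurable f d' (T' : measurableType d') (Y : 'I_N -> T' -> R) :
  (forall i, continuous (f i)) -> (forall i, measurable_fun setT (Y i)) ->
  measurable_fun setT (fun w => obs i0 f (Y ^~ w)).
Proof.
move=> cf mY; apply: measurable_funD => //.
apply: measurable_sum => i; apply: measurable_funB => //.
by apply: measurableT_comp => //; exact: continuous_measurable_fun.
Qed.

Lemma ob_measurable f t : (forall i, continuous (f i)) -> measurable_fun setT (ob f t).
Proof. by move=> cf; apply: obs_measurable => // i; case: hX. Qed.

Lemma ob_bounded f : (forall i, continuous (f i)) ->
  exists K, forall t w, `|ob f t w| <= K.
Proof.
move=> cf; have [K HK] := obs_bounded i0 cf; exists K => t w; apply: HK.
by have [_ pX _ _ _] := hX; apply: pX; rewrite le_max lexx orbT.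
Qed.

Lemma obE f t w : (forall i j, f i 0 = f j 0) -> 0 <= t ->
  spider_eval f (fun i => X i t w) = ob f t w.
Proof.
move=> f0 t0; rewrite (spider_evalE i0)//; first by rewrite /ob max_l.
by have [_ pX _ _ _] := hX; exact: pX.
Qed.

Lemma Rintegral_split (c : R -> R) (x y z : R) : continuous c -> x <= y -> y <= z ->
  \int[mu]_(q in `[x, z]) c q - \int[mu]_(q in `[x, y]) c q = \int[mu]_(q in `[y, z]) c q.
Proof.
move=> cc xy yz.
have I (u v : R) : mu.-integrable `[u, v] (EFin \o c).
  apply: continuous_compact_integrable; first exact: segment_compact.
  exact: continuous_subspaceT.
rewrite Rintegral_itvB ?bnd_simp//= Rintegral_itv_obnd_cbnd//.
by apply: integrableS (I y z) => //; apply: subset_itvr; rewrite bnd_simp.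
Qed.

Lemma spider_martingale f s t A : spider_dom f -> 0 <= s -> s <= t -> Ft X s A ->
  \int[P]_w (\1_A w * (ob f t w - ob f s w -
     \int[mu]_(q in `[s, t]) ob (spider_gen f) q w)) = 0.
Proof.
move=> Df s0 st FA.
have [cf cg f0 g0] := spider_dom_continuous Df.
have [mX pX _ _ /(_ f Df) HM] := hX.
have [K gK] := ob_bounded cg.
have cgw w := @ob_continuous _ w cg.
have bf r : bmf (ob f r) by split; [exact: ob_measurable|have [L HL] := ob_bounded cf; exists L].
have [bI _] := @E_exchange _ _ _ P (ob (spider_gen f)) s t K
  (fun r => @ob_measurable _ r cg) cgw (fun r w _ => gK r w).
have bZ : bmf (fun w => ob f t w - ob f s w - \int[mu]_(q in `[s, t]) ob (spider_gen f) q w).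
  by apply: bmfB => //; exact: bmfB.
apply: (Ft_martingale mX bZ) FA => B [m [l [u [C [hu hC ->]]]]].
have := HM s t s0 st m l u C hu hC.
rewrite /= => H; apply: EFin_inj; rewrite EFin_E.
  apply: etrans H; apply: eq_integral => w _; congr EFin; rewrite mulrC; congr (_ * _).
  have E r : 0 <= r -> \int[mu]_(q in `[0, r]) spider_eval (spider_gen f) (fun i => X i q w)
     = \int[mu]_(q in `[0, r]) ob (spider_gen f) q w.
    move=> r0; apply: eq_Rintegral => q; rewrite inE/= in_itv/= => /andP[q0 _].
    exact: obE.
  rewrite !E ?(le_trans s0 st)// !obE// ?(le_trans s0 st)//.
  rewrite -(Rintegral_split (cgw w) s0 st); ring.
apply/bmf_igr/bmfM => //; apply: bmf_ind.
by apply: (Ft_measurable mX (s := s)); apply: sub_sigma_algebra; exists m, l, u, C.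
Qed.

(** Starting at [-1] keeps every [t >= 0] away from the left end, so the fundamental theorem of
    calculus gives continuity at [t = 0] as well. The part over [[-1, 0]] cancels in all
    increments. *)
Definition stopint (c : R -> T -> R) (t : R) (w : T) : R := \int[mu]_(q in `[-1, t]) c q w.

(** This is [(l - L) f] for the generator [L]. As long as it vanishes along the path, the increments
    of [Zp] below reduce to those of [exp (- l t) f (b t)]. *)
Definition resid (l : R) (f : 'I_N -> R -> R) (i : 'I_N) (x : R) : R :=
  l * f i x - spider_gen f i x.

Definition Zp (l : R) f (t : R) (w : T) : R :=
  expR (- l * t) * ob f t w + stopint (fun q w => expR (- l * q) * ob (resid l f) q w) t w.

Lemma expRl_continuous (l : R) : continuous (fun t => expR (- l * t)).
Proof. by move=> t; apply: continuous_comp; [exact: mulrl_continuous|exact: continuous_expR]. Qed.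

Lemma ob_resid l f t w : ob (resid l f) t w = l * ob f t w - ob (spider_gen f) t w.
Proof.
rewrite /ob /obs /resid mulrDr mulr_sumr opprD addrACA -sumrB; congr (_ + _).
have H (a b c e : R) : l * a - b - (l * c - e) = l * (a - c) - (b - e) by ring.
by apply: eq_bigr => i _; exact: H.
Qed.

Lemma Zp_diff l f s t w : spider_dom f -> 0 <= s -> s <= t ->
  Zp l f t w - Zp l f s w = expR (- l * t) * ob f t w - expR (- l * s) * ob f s w +
    \int[mu]_(q in `[s, t]) (expR (- l * q) * ob (resid l f) q w).
Proof.
move=> Df s0 st; have [cf cg f0 g0] := spider_dom_continuous Df.
have cr : continuous (fun q => expR (- l * q) * ob (resid l f) q w).
  move=> q; apply: cvgM; first exact: expRl_continuous.
  apply: ob_continuous => i x; apply: cvgB; last exact: cg.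
  by apply: cvgM; [exact: cvg_cst|exact: cf].
rewrite -(Rintegral_split (x := -1) cr)// ?(le_trans (lerN10 R))//.
rewrite /Zp /stopint; ring.
Qed.

Lemma Zp_continuous l f w : spider_dom f -> forall t, 0 <= t -> {for t, continuous (fun t => Zp l f t w)}.
Proof.
move=> Df t t0; have [cf cg f0 g0] := spider_dom_continuous Df.
have cr : continuous (fun q => expR (- l * q) * ob (resid l f) q w).
  move=> q; apply: cvgM; first exact: expRl_continuous.
  apply: ob_continuous => i x; apply: cvgB; last exact: cg.
  by apply: cvgM; [exact: cvg_cst|exact: cf].
apply: cvgD.
  by apply: cvgM; [exact: expRl_continuous|exact: ob_continuous].
apply/differentiable_continuous/derivable1_diffP.
have [|||//] := @continuous_FTC1_closed _ _ (-1) t (t + 1) _ _ _ (cr t).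
- by rewrite ltrDl.
- apply: continuous_compact_integrable; first exact: segment_compact.
  exact: continuous_subspaceT.
- by rewrite (lt_le_trans _ t0)// ltrN10.
Qed.

Lemma Zp_bmf l f (t : R) : spider_dom f -> 0 < l -> 0 <= t ->
  measurable_fun setT (Zp l f t) /\
  exists K, forall s w, 0 <= s <= t -> `|Zp l f s w| <= K.
Proof.
move=> Df l0 t0; have [cf cg f0 g0] := spider_dom_continuous Df.
have cr i : continuous (resid l f i).
  by move=> x; apply: cvgB; [apply: cvgM; [exact: cvg_cst|exact: cf]|exact: cg].
have [K1 fK] := ob_bounded cf; have [K2 rK] := ob_bounded cr.
have ccr w : continuous (fun q => expR (- l * q) * ob (resid l f) q w).
  by move=> q; apply: cvgM; [exact: expRl_continuous|exact: ob_continuous].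
have mr q : measurable_fun setT (fun w => expR (- l * q) * ob (resid l f) q w).
  by apply: measurable_funM => //; exact: ob_measurable.
have bnd q w : -1 <= q -> `|expR (- l * q) * ob (resid l f) q w| <= expR l * K2.
  move=> q1; rewrite normrM ler_pM// ger0_norm ?expR_ge0// ler_expR.
  by rewrite mulNr -mulrN -[leRHS]mulr1 ler_wpM2l ?(ltW l0)// lerNl.
have [B1 _] := @E_exchange _ _ _ P (fun q w => expR (- l * q) * ob (resid l f) q w)
   (-1) t (expR l * K2) mr ccr (fun q w H => bnd q w (proj1 (andP H))).
split.
  apply: measurable_funD; last by case: B1.
  by apply: measurable_funM => //; exact: ob_measurable.
exists (K1 + expR l * K2 * (t + 1)) => s w /andP[s0 st].
rewrite (le_trans (ler_normD _ _))// lerD//.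
  rewrite normrM -[leRHS]mul1r ler_pM// ger0_norm ?expR_ge0//.
  by rewrite -expR0 ler_expR mulNr oppr_le0 mulr_ge0// ltW.
have I c : continuous c -> mu.-integrable `[-1, s] (EFin \o c).
  by move=> cc; apply: continuous_compact_integrable;
    [exact: segment_compact|exact: continuous_subspaceT].
rewrite (le_trans (le_normr_Rintegral _ (I _ (ccr w))))//.
have In : mu.-integrable `[-1, s] (EFin \o (fun q => `|expR (- l * q) * ob (resid l f) q w|)).
  by have := integrable_norm (I _ (ccr w)).
have Ic : mu.-integrable `[-1, s] (EFin \o (fun=> expR l * K2)).
  by apply: I => x; exact: cvg_cst.
apply: (@le_trans _ _ (\int[mu]_(q in `[-1, s]) (expR l * K2))).
  by apply: le_Rintegral => // q /=; rewrite in_itv/= => /andP[q1 _]; exact: bnd.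
have K20 : 0 <= K2 by apply: le_trans (rK 0 w).
have -> : \int[mu]_(_ in `[-1, s]) (expR l * K2) = expR l * K2 * fine (mu `[-1, s]%classic).
  exact: Rintegral_cst.
rewrite lebesgue_measure_itv/= lte_fin (lt_le_trans _ s0) ?ltrN10//=.
by rewrite opprK ler_wpM2l ?mulr_ge0 ?expR_ge0// lerD2r.
Qed.

Lemma Zp_martingale l f s t A : spider_dom f -> 0 < l -> 0 <= s -> s <= t -> Ft X s A ->
  \int[P]_w (\1_A w * (Zp l f t w - Zp l f s w)) = 0.
Proof.
move=> Df l0 s0; rewrite le_eqVlt => /predU1P[->|st] FA.
  by rewrite (eqE _ (g := fun=> 0)) ?E_cst// => w; rewrite subrr mulr0.
have [cf cg f0 g0] := spider_dom_continuous Df.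
have [mX _ _ _ _] := hX.
have [K1 fK] := ob_bounded cf; have [K2 gK] := ob_bounded cg.
rewrite -[RHS](@resolvent _ _ _ P (ob f) (ob (spider_gen f)) A (Num.max K1 K2) l s t l0 _ _ _ _ _ _ _ st).
- apply: eqE => w; rewrite Zp_diff ?(ltW st)//; congr (_ * _).
  rewrite -[in RHS](mulN1r (\int[mu]_(q in _) _)) -RintegralZl//; last first.
    apply: continuous_compact_integrable; first exact: segment_compact.
    apply: continuous_subspaceT => q; apply: cvgM; first exact: expRl_continuous.
    by apply: cvgB; [exact: ob_continuous|apply: cvgM; [exact: cvg_cst|exact: ob_continuous]].
  by congr (_ + _); apply: eq_Rintegral => q _; rewrite ob_resid; ring.
- by move=> r; exact: ob_measurable.
- by move=> r; exact: ob_measurable.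
- by move=> w; exact: ob_continuous.
- by move=> w; exact: ob_continuous.
- by move=> r w; rewrite le_max fK.
- by move=> r w; rewrite le_max gK orbT.
- exact: (Ft_measurable mX FA).
- by move=> r /andP[sr rt]; exact: spider_martingale.
Qed.
End SpiderMartingale.

(** * Stopping times and optional sampling *)

Section Stopping.
Context {R : realType} {d : measure_display} {T : measurableType d}.
Variable P : probability T R.
Variables (N : nat) (i0 : 'I_N) (X : 'I_N -> R -> T -> R).
Hypothesis hX : spider_BM P X.
Local Notation F := (Ft X).
Local Notation mu := (@lebesgue_measure R).

Let mX i t : measurable_fun setT (X i t). Proof. by case: hX. Qed.

Lemma FtT t : F t setT.
Proof. exact: (@measurableT _ (g_sigma_algebraType (cyl X t))). Qed.

Lemma Ft0 t : F t set0.
Proof. exact: (@measurable0 _ (g_sigma_algebraType (cyl X t))). Qed.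

Lemma FtI t A B : F t A -> F t B -> F t (A `&` B).
Proof. exact: (@measurableI _ (g_sigma_algebraType (cyl X t))). Qed.

Lemma FtC t A : F t A -> F t (~` A).
Proof. exact: (@measurableC _ (g_sigma_algebraType (cyl X t))). Qed.

Lemma Ft_bigcup t (A : nat -> set T) : (forall n, F t (A n)) -> F t (\bigcup_n A n).
Proof. exact: (@bigcupT_measurable _ (g_sigma_algebraType (cyl X t))). Qed.

Lemma Ft_bigcap t (A : nat -> set T) : (forall n, F t (A n)) -> F t (\bigcap_n A n).
Proof. exact: (@bigcapT_measurable _ (g_sigma_algebraType (cyl X t))). Qed.

Lemma Ft_bigcup_rat t (A : rat -> set T) : (forall n, F t (A n)) -> F t (\bigcup_n A n).
Proof. exact: (@bigcupT_measurable_rat _ (g_sigma_algebraType (cyl X t))). Qed.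

(** The strict inequality defines optional times. It suits first entrances into open sets, which can
    be detected at rational times without completing the natural filtration. *)
Definition stopping (a : T -> \bar R) := (forall w, (0 <= a w)%E) /\
  forall t, F t [set w | (a w < t%:E)%E].

(** The sigma-field just after [a]. Measurability of [A] is required separately because the second
    clause does not constrain [A] where [a] is infinite. *)
Definition past (a : T -> \bar R) (A : set T) := measurable A /\
  forall t, F t (A `&` [set w | (a w < t%:E)%E]).

Lemma past_mono a b A : (forall w, (a w <= b w)%E) -> stopping b -> past a A -> past b A.
Proof.
move=> ab [_ sb] [mA pA]; split=> // t.
rewrite (_ : A `&` _ = (A `&` [set w | (a w < t%:E)%E]) `&` [set w | (b w < t%:E)%E]).
  by apply: FtI; [exact: pA|exact: sb].
apply/seteqP; split => w /= [].
  by move=> Aw bt; split => //; split => //; exact: le_lt_trans bt.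
by move=> [].
Qed.

Lemma pastI a A B : past a A -> past a B -> past a (A `&` B).
Proof.
move=> [mA pA] [mB pB]; split; first exact: measurableI.
move=> t; rewrite (_ : _ `&` _ = (A `&` [set w | (a w < t%:E)%E]) `&` (B `&` [set w | (a w < t%:E)%E])).
  exact: FtI.
by apply/seteqP; split => w /=; tauto.
Qed.

Lemma pastC a A : stopping a -> past a A -> past a (~` A).
Proof.
move=> [_ sa] [mA pA]; split; first exact: measurableC.
move=> t; rewrite (_ : _ `&` _ = ~` (A `&` [set w | (a w < t%:E)%E]) `&` [set w | (a w < t%:E)%E]).
  by apply: FtI => //; exact: FtC.
by apply/seteqP; split => w /=; tauto.
Qed.

Lemma pastT a : stopping a -> past a setT.
Proof. by move=> [_ sa]; split => // t; rewrite setTI. Qed.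

Lemma past_bigcup a (A : nat -> set T) : (forall n, past a (A n)) -> past a (\bigcup_n A n).
Proof.
move=> pA; split; first by apply: bigcupT_measurable => n; case: (pA n).
move=> t; rewrite setI_bigcupl; apply: Ft_bigcup => n; by case: (pA n).
Qed.

Lemma past_lt a (c : R) : stopping a -> past a [set w | (a w < c%:E)%E].
Proof.
move=> [_ sa]; split; first exact: Ft_measurable (sa c).
move=> t; rewrite (_ : _ `&` _ = [set w | (a w < (Num.min c t)%:E)%E]).
  by apply: Ft_mono (sa _); rewrite ge_min lexx orbT.
apply/seteqP; split => w /=; rewrite EFin_min lt_min.
  by move=> [-> ->].
by move=> /andP[].
Qed.

Lemma past_fin a : stopping a -> past a [set w | (a w < +oo)%E].
Proof.
move=> sa; rewrite (_ : [set _ | _] = \bigcup_n [set w | (a w < n%:R%:E)%E]).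
  by apply: past_bigcup => n; exact: past_lt.
apply/seteqP; split => w /= => [|[n _]]; last by move=> /lt_le_trans; apply; exact: leey.
case E : (a w) (sa.1 w) => [r| |]// r0 _.
exists (Num.truncn r).+1 => //=; rewrite E lte_fin.
by rewrite lee_fin in r0; have /andP[] := truncn_itv r0.
Qed.

Lemma past_slice a A (x y : R) : stopping a -> past a A ->
  past a (A `&` [set w | (x%:E <= a w)%E && (a w < y%:E)%E]).
Proof.
move=> sa pA; apply: pastI => //.
rewrite (_ : [set _ | _] = ~` [set w | (a w < x%:E)%E] `&` [set w | (a w < y%:E)%E]).
  by apply: pastI; [apply: pastC => //|]; exact: past_lt.
apply/seteqP; split => w /=.
  by move=> /andP[h1 h2]; split => //; apply/negP; rewrite -leNgt.
by move=> [/negP]; rewrite -leNgt => h1 h2; apply/andP.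
Qed.

(** On the slice [a] lies before [y], so the event is decided by time [y]; this is why [sampling]
    rounds a stopping time up. *)
Lemma past_Ft a A (x y : R) : stopping a -> past a A ->
  F y (A `&` [set w | (x%:E <= a w)%E && (a w < y%:E)%E]).
Proof.
move=> sa pA; have [xy|yx] := leP x y; last first.
  rewrite (_ : _ `&` _ = set0); first exact: Ft0.
  apply/seteqP; split => // w /= [_ /andP[h1 h2]].
  by have := le_lt_trans h1 h2; rewrite lte_fin ltNge ltW.
rewrite (_ : _ `&` _ = (A `&` [set w | (a w < y%:E)%E]) `&` ~` [set w | (a w < x%:E)%E]).
  by apply: FtI; [exact: pA.2|apply: FtC; apply: (Ft_mono xy); exact: sa.2].
apply/seteqP; split => w /=.
  by move=> [Aw /andP[h1 h2]]; split => //; apply/negP; rewrite -leNgt.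
by move=> [[Aw h2] /negP]; rewrite -leNgt => h1; split => //; apply/andP.
Qed.

(** The [m * q] slices of length [1 / q] partition [[0, m[], so at most one summand survives, the
    one whose index is the integer part of [b * q]. *)
Lemma slice_sum (b : \bar R) (c : nat -> R) (m q : nat) : (0 <= b)%E -> (0 < q)%N ->
  \sum_(j < m * q) ((j%:R / q%:R)%:E <= b < (j.+1%:R / q%:R)%:E)%E%:R * c j =
  if (b < m%:R%:E)%E then c (Num.truncn (fine b * q%:R)) else 0.
Proof.
move=> b0 q0; have q0' : 0 < q%:R :> R by rewrite ltr0n.
case: ifPn => bm.
  case: b b0 bm => //= r; rewrite lee_fin lte_fin => r0 rm.
  have rq0 : 0 <= r * q%:R by rewrite mulr_ge0// ltW.
  have /andP[t1 t2] := truncn_itv rq0.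
  have tm : (Num.truncn (r * q%:R) < m * q)%N.
    by rewrite -(ltr_nat R) natrM (le_lt_trans t1)// ltr_pM2r.
  rewrite (bigD1 (Ordinal tm))//= big1 ?addr0.
    by rewrite !lee_fin !lte_fin ler_pdivrMr// t1 ltr_pdivlMr// t2 mul1r.
  move=> j jt; rewrite lee_fin lte_fin ler_pdivrMr// ltr_pdivlMr//.
  have [/andP[h1 h2]|_] := boolP (j%:R <= r * q%:R < j.+1%:R); last by rewrite mul0r.
  have := truncn_def (introT andP (conj h1 h2)) => E.
  by case/negP: jt; apply/eqP/val_inj; rewrite /= E.
rewrite big1// => j _; case: (boolP (_ && _)) => [/andP[_ h2]|_]; last by rewrite mul0r.
case/negP: bm; apply: (lt_le_trans h2); rewrite lee_fin ler_pdivrMr//.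
by rewrite -natrM ler_nat.
Qed.

Lemma truncn_div_cvg (t : R) : 0 <= t ->
  (fun n : nat => (Num.truncn (t * n.+1%:R))%:R / n.+1%:R) @ \oo --> t.
Proof.
move=> t0; have := @floor_div_cvg R t; apply: cvg_trans.
apply: near_eq_cvg; apply: nearW => n.
have tn0 : 0 <= t * n.+1%:R by rewrite mulr_ge0.
by rewrite /= truncn_floor tn0 natr_absz ger0_norm ?floor_ge0.
Qed.

Lemma truncnS_div_cvg (t : R) : 0 <= t ->
  (fun n : nat => (Num.truncn (t * n.+1%:R)).+1%:R / n.+1%:R) @ \oo --> t.
Proof.
move=> t0; rewrite -[X in _ --> X]addr0.
rewrite (_ : (fun n => _) = (fun n : nat => (Num.truncn (t * n.+1%:R))%:R / n.+1%:R + n.+1%:R^-1)).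
  by apply: cvgD; [exact: truncn_div_cvg|exact: cvg_harmonic].
by apply/funext => n; rewrite -addn1 natrD mulrDl mul1r.
Qed.

Lemma sum_slice_ind (a : T -> \bar R) A (m q : nat) w (c : nat -> R) : (0 <= a w)%E -> (0 < q)%N ->
  \sum_(j < m * q) \1_(A `&` [set w | ((j%:R / q%:R)%:E <= a w)%E && (a w < (j.+1%:R / q%:R)%:E)%E]) w * c j =
  \1_A w * (if (a w < m%:R%:E)%E then c (Num.truncn (fine (a w) * q%:R)) else 0).
Proof.
move=> a0 q0; rewrite -(slice_sum c m a0 q0) mulr_sumr; apply: eq_bigr => j _.
rewrite mulrA; congr (_ * _); rewrite indicI; congr (_ * _).
rewrite indicE; case: (boolP (_ && _)) => h; first by rewrite mem_set.
by rewrite memNset//; exact/negP.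
Qed.

(** A factor depending on the earlier time [a] may be inserted: [h (a)] is the limit of combinations
    of indicators of slices of [a], and these belong to the past of [c]. The cut-off at [m] is there
    for the growing weight [exp (l * x)], bounded on compact intervals only. *)
Lemma cond_weight a c (Z : T -> R) (h : R -> R) (m : nat) (K : R) A :
  stopping a -> stopping c -> (forall w, (a w <= c w)%E) -> igr P Z -> continuous h -> (forall x, 0 <= x <= m%:R -> `|h x| <= K) ->
  (forall B, past c B -> \int[P]_w (\1_B w * Z w) = 0) -> past c A ->
  igr P (fun w => \1_A w * ((if (a w < m%:R%:E)%E then h (fine (a w)) else 0) * Z w)) /\
  \int[P]_w (\1_A w * ((if (a w < m%:R%:E)%E then h (fine (a w)) else 0) * Z w)) = 0.
Proof.
move=> sa sc ac IZ ch hK HZ pA.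
pose S (n j : nat) := A `&` [set w | ((j%:R / n.+1%:R)%:E <= a w)%E && (a w < (j.+1%:R / n.+1%:R)%:E)%E].
have pS n j : past c (S n j).
  apply: pastI => //; apply: (past_mono ac sc).
  have := past_slice (j%:R / n.+1%:R) (j.+1%:R / n.+1%:R) sa (pastT sa).
  by rewrite setTI.
pose f n w := \sum_(j < m * n.+1) (\1_(S n j) w * h (j%:R / n.+1%:R)) * Z w.
have fE n w : f n w = \1_A w * ((if (a w < m%:R%:E)%E then
     h ((Num.truncn (fine (a w) * n.+1%:R))%:R / n.+1%:R) else 0) * Z w).
  by rewrite /f -mulr_suml (sum_slice_ind A m (fun j => h (j%:R / n.+1%:R)))// ?mulrA//; exact: sa.1.
have Ij n j : igr P (fun w => (\1_(S n j) w * h (j%:R / n.+1%:R)) * Z w).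
  apply: igrM => //; apply: bmfM; last exact: bmf_cst.
  by apply: bmf_ind; case: (pS n j).
have If n : igr P (f n) by exact: igr_sum.
have Ef n : \int[P]_w f n w = 0.
  rewrite /f E_sum// big1// => j _.
  rewrite (eqE _ (g := fun w => h (j%:R / n.+1%:R) * (\1_(S n j) w * Z w))).
    by rewrite EZ ?HZ ?mulr0//; apply: igrM => //; apply: bmf_ind; case: (pS n j).
  by move=> w; ring.
have K0 : 0 <= K by apply: le_trans (hK 0 _) => //; rewrite lexx/=.
have := @E_dct _ _ _ P f (fun w => \1_A w * ((if (a w < m%:R%:E)%E then h (fine (a w)) else 0) * Z w))
  (fun w => K * `|Z w|).
case.
- by move=> n; exact: igr_meas (If n).
- apply: igrZ; rewrite /igr (_ : _ \o _ = abse \o (EFin \o Z)); last by apply/funext.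
  exact: integrable_abse.
- move=> n w; rewrite fE !normrM mulrA ler_wpM2r// -[leRHS]mul1r ler_pM//.
    by rewrite indicE; case: (_ \in _); rewrite ?normr1 ?normr0.
  case: ifPn => am; last by rewrite normr0.
  apply: hK; rewrite divr_ge0//= ler_pdivrMr//.
  have := sa.1 w; case: (a w) am => // r; rewrite lte_fin lee_fin /= => rm r0.
  have rq0 : 0 <= r * n.+1%:R by rewrite mulr_ge0.
  have /andP[t1 _] := truncn_itv rq0.
  by rewrite (le_trans t1)// ler_pM2r// ltW.
- move=> w; rewrite (eq_cvg _ _ (fE ^~ w)); apply: cvgM; first exact: cvg_cst.
  apply: cvgM; last exact: cvg_cst.
  case: ifPn => am; last exact: cvg_cst.
  have r0 : 0 <= fine (a w) by apply: fine_ge0; exact: sa.1.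
  apply: (cvg_comp _ h (truncn_div_cvg r0)); exact: ch.
move=> IE; rewrite (eq_cvg _ _ Ef) => /(cvg_lim (@Rhausdorff R)) H; split => //.
by rewrite -H lim_cst.
Qed.

(** Replace [b] by the right end of its slice: each slice is known at that time, so the martingale
    property applies term by term up to the horizon [m]. Continuity of [Z] and the bound [K] then
    allow the mesh to tend to 0. *)
Lemma sampling (Z : R -> T -> R) (b : T -> \bar R) (m : nat) (K : R) A :
  stopping b -> (forall t, 0 <= t -> measurable_fun setT (Z t)) ->
  (forall w t, 0 <= t -> {for t, continuous (Z ^~ w)}) ->
  (forall t w, 0 <= t <= m%:R -> `|Z t w| <= K) ->
  (forall s t B, 0 <= s -> s <= t -> F s B -> \int[P]_w (\1_B w * (Z t w - Z s w)) = 0) ->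
  past b A ->
  igr P (fun w => \1_A w * (if (b w < m%:R%:E)%E then Z m%:R w - Z (fine (b w)) w else 0)) /\
  \int[P]_w (\1_A w * (if (b w < m%:R%:E)%E then Z m%:R w - Z (fine (b w)) w else 0)) = 0.
Proof.
move=> sb mZ cZ ZK HZ pA.
pose S (n j : nat) := A `&` [set w | ((j%:R / n.+1%:R)%:E <= b w)%E && (b w < (j.+1%:R / n.+1%:R)%:E)%E].
have FS n j : F (j.+1%:R / n.+1%:R) (S n j) by exact: past_Ft.
have mS n j : measurable (S n j) by apply: Ft_measurable (FS n j).
pose f n w := \sum_(j < m * n.+1) \1_(S n j) w * (Z m%:R w - Z (j.+1%:R / n.+1%:R) w).
have fE n w : f n w = \1_A w * (if (b w < m%:R%:E)%E then
     Z m%:R w - Z ((Num.truncn (fine (b w) * n.+1%:R)).+1%:R / n.+1%:R) w else 0).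
  by rewrite /f (sum_slice_ind A m (fun j => Z m%:R w - Z (j.+1%:R / n.+1%:R) w))//; exact: sb.1.
have jm n (j : 'I_(m * n.+1)) : 0 <= (j.+1%:R / n.+1%:R : R) <= m%:R.
  by rewrite divr_ge0//= ler_pdivrMr// -natrM ler_nat.
have bd n (j : 'I_(m * n.+1)) : bmf (fun w => Z m%:R w - Z (j.+1%:R / n.+1%:R) w).
  apply: bmfB; (split; first by [apply: mZ|apply: mZ; case/andP: (jm n j)]).
    by exists K => w; apply: ZK; rewrite lexx ler0n.
  by exists K => w; exact: ZK.
have If n : igr P (f n).
  by apply: igr_sum => j; apply/bmf_igr/bmfM => //; exact: bmf_ind.
have Ef n : \int[P]_w f n w = 0.
  rewrite /f E_sum; last by move=> j; apply/bmf_igr/bmfM => //; exact: bmf_ind.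
  by rewrite big1// => j _; apply: HZ => //; case/andP: (jm n j).
have := @E_bct _ _ _ P f (fun w => \1_A w * (if (b w < m%:R%:E)%E then Z m%:R w - Z (fine (b w)) w else 0)) (K + K).
have K0 (w : T) : 0 <= K.
  by have := ZK 0 w; rewrite lexx ler0n => /(_ isT); exact: le_trans.
case.
- by move=> n; exact: igr_meas (If n).
- move=> n w; rewrite fE normrM -[leRHS]mul1r ler_pM//.
    by rewrite indicE; case: (_ \in _); rewrite ?normr1 ?normr0.
  case: ifPn => am; last by rewrite normr0 addr_ge0// (K0 w).
  rewrite (le_trans (ler_normB _ _))// lerD//; apply: ZK; rewrite ?lexx ?ler0n//.
  rewrite divr_ge0//= ler_pdivrMr//.
  have := sb.1 w; case: (b w) am => // r; rewrite lte_fin lee_fin /= => rm r0.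
  have rq0 : 0 <= r * n.+1%:R by rewrite mulr_ge0.
  have /andP[t1 _] := truncn_itv rq0.
  by rewrite -natrM ler_nat -(ltr_nat R) (le_lt_trans t1)// natrM ltr_pM2r.
- move=> w; rewrite (eq_cvg _ _ (fE ^~ w)); apply: cvgM; first exact: cvg_cst.
  case: ifPn => am; last exact: cvg_cst.
  have r0 : 0 <= fine (b w) by apply: fine_ge0; exact: sb.1.
  apply: cvgB; first exact: cvg_cst.
  exact: (cvg_comp _ (Z ^~ w) (truncnS_div_cvg r0) (cZ w _ r0)).
move=> IE; rewrite (eq_cvg _ _ Ef) => /(cvg_lim (@Rhausdorff R)) H; split => //.
by rewrite -H lim_cst.
Qed.

(** The value 0 at an infinite [y] is the limit of the exponential for [l > 0], so events on which a
    target is never reached need no separate treatment. *)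
Definition disc (l : R) (x y : \bar R) : R :=
  if (y < +oo)%E then expR (- l * (fine y - fine x)) else 0.

Lemma disc_ge0 l x y : 0 <= disc l x y.
Proof. by rewrite /disc; case: ifP => // _; exact: expR_ge0. Qed.

Lemma disc_le1 l x y : 0 <= l -> (0 <= x)%E -> (x <= y)%E -> disc l x y <= 1.
Proof.
rewrite /disc => l0 x0 xy; case: ifPn => // yoo.
rewrite -expR0 ler_expR mulNr oppr_le0 mulr_ge0// subr_ge0 fine_le//.
  by rewrite ge0_fin_numE//; exact: le_lt_trans xy yoo.
by rewrite ge0_fin_numE//; exact: le_trans xy.
Qed.

Lemma expR_nat_cvg0 (l c : R) : 0 < l -> (fun m : nat => expR (- l * (m%:R - c))) @ \oo --> (0 : R).
Proof.
move=> l0; rewrite (_ : (fun m => _) = fun m : nat => expR (l * c) * expR (- l) ^+ m).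
  rewrite -[X in _ --> X](mulr0 (expR (l * c))); apply: cvgM; first exact: cvg_cst.
  apply: cvg_expr; rewrite ger0_norm ?expR_ge0//.
  by rewrite -expR0 ltr_expR oppr_lt0.
apply/funext => m; rewrite -expRM_natl -expRD; congr expR; ring.
Qed.

Lemma expR_shift (l z x y u v : R) :
  expR (l * z) * (expR (- l * y) * u - expR (- l * x) * v) =
  expR (- l * (y - z)) * u - expR (- l * (x - z)) * v.
Proof.
rewrite [LHS]mulrBr !mulrA -!expRD.
by congr (expR _ * _ - expR _ * _); ring.
Qed.

(** Sample [Zp] at [a] and at [b] up to a common horizon [m] and subtract. The weight [exp (l * a0)]
    makes the discount start at [a0], and the integral part drops out because the residual vanishes
    between [a] and [b]. *)
Lemma stopped_diff f l a0 a b A : spider_dom f -> 0 < l ->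
  stopping a0 -> stopping a -> stopping b ->
  (forall w, (a0 w <= a w)%E) -> (forall w, (a w <= b w)%E) -> past a A ->
  (forall w q, (a w <= q%:E)%E -> (q%:E < b w)%E -> ob i0 X (resid l f) q w = 0) ->
  igr P (fun w => \1_A w * (disc l (a0 w) (b w) * ob i0 X f (fine (b w)) w -
     disc l (a0 w) (a w) * ob i0 X f (fine (a w)) w)) /\
  \int[P]_w (\1_A w * (disc l (a0 w) (b w) * ob i0 X f (fine (b w)) w -
     disc l (a0 w) (a w) * ob i0 X f (fine (a w)) w)) = 0.
Proof.
move=> Df l0 sa0 sa sb a0a ab pA res.
have [cf cg f0 g0] := spider_dom_continuous Df.
have [K fK] := ob_bounded i0 hX cf.
pose Z := Zp i0 X l f.
have mZ t : 0 <= t -> measurable_fun setT (Z t).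
  by move=> t0; have [] := Zp_bmf i0 hX Df l0 t0.
have cZ (w : T) (t : R) : 0 <= t -> {for t, continuous (Z ^~ w)}.
  by move=> t0; exact: (Zp_continuous hX Df t0).
have HZ s t B : 0 <= s -> s <= t -> F s B -> \int[P]_w (\1_B w * (Z t w - Z s w)) = 0.
  by move=> s0 st FB; exact: Zp_martingale.
have S (c : T -> \bar R) (m : nat) B : stopping c -> past c B ->
  igr P (fun w => \1_B w * (if (c w < m%:R%:E)%E then Z m%:R w - Z (fine (c w)) w else 0)) /\
  \int[P]_w (\1_B w * (if (c w < m%:R%:E)%E then Z m%:R w - Z (fine (c w)) w else 0)) = 0.
  move=> sc pB; have [_ [L HL]] := Zp_bmf i0 hX Df l0 (ler0n R m).
  by apply: (@sampling Z c m L).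
pose W (c : T -> \bar R) (m : nat) w := if (c w < m%:R%:E)%E then Z m%:R w - Z (fine (c w)) w else 0.
have WE c m w : \1_(setT : set T) w * W c m w = W c m w by rewrite indicE in_setT mul1r.
have ce : continuous (fun x => expR (l * x)).
  by move=> x; apply: continuous_comp; [exact: mulrl_continuous|exact: continuous_expR].
have be (m : nat) x : 0 <= x <= m%:R -> `|expR (l * x)| <= expR (l * m%:R).
  by move=> /andP[x0 xm]; rewrite ger0_norm ?expR_ge0// ler_expR ler_wpM2l// ltW.
have S2 (c : T -> \bar R) (m : nat) : stopping c -> (forall w, (a w <= c w)%E) ->
  igr P (fun w => \1_A w * ((if (a0 w < m%:R%:E)%E then expR (l * fine (a0 w)) else 0) * W c m w)) /\
  \int[P]_w (\1_A w * ((if (a0 w < m%:R%:E)%E then expR (l * fine (a0 w)) else 0) * W c m w)) = 0.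
  move=> sc ac; have a0c w : (a0 w <= c w)%E by exact: le_trans (ac w).
  apply: (@cond_weight a0 c (W c m) _ m _ A sa0 sc a0c _ ce (be m) _ _).
  - have [I _] := S c m setT sc (pastT sc).
    by rewrite /igr (_ : W c m = fun w => \1_(setT : set T) w * W c m w)//; apply/funext => w; rewrite WE.
  - by move=> B pB; exact: (proj2 (S c m B sc pB)).
  - exact: past_mono pA.
(* The integrand at horizon [m]: where [b] has not yet occurred, the path is evaluated at time [m]
   instead. *)
pose G m w := \1_A w * (if (a w < m%:R%:E)%E then
   (if (b w < m%:R%:E)%E then expR (- l * (fine (b w) - fine (a0 w))) * ob i0 X f (fine (b w)) w
    else expR (- l * (m%:R - fine (a0 w))) * ob i0 X f m%:R w) -
    expR (- l * (fine (a w) - fine (a0 w))) * ob i0 X f (fine (a w)) w else 0).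
have GE m w : G m w = \1_A w * ((if (a0 w < m%:R%:E)%E then expR (l * fine (a0 w)) else 0) * W a m w) -
   \1_A w * ((if (a0 w < m%:R%:E)%E then expR (l * fine (a0 w)) else 0) * W b m w).
  rewrite -mulrBr -mulrBr /G; congr (_ * _); case: ifPn => am; last first.
    have bm : (b w < m%:R%:E)%E = false.
      by apply/negbTE; move: am; rewrite -!leNgt => am; exact: le_trans am (ab w).
    by rewrite /W (negbTE am) bm subrr mulr0.
  rewrite (le_lt_trans (a0a w) am).
  have a0' := fine_ge0 (sa.1 w); have b0 := fine_ge0 (sb.1 w).
  have afin : a w \is a fin_num by rewrite ge0_fin_numE ?sa.1// (lt_trans am)// ltry.
  (* The residual is known to vanish on [[a, s[] only; dropping the right end does not change the
     integral. *)
  have Q s : fine (a w) <= s -> (s%:E <= b w)%E -> Z s w - Z (fine (a w)) w =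
     expR (- l * s) * ob i0 X f s w - expR (- l * fine (a w)) * ob i0 X f (fine (a w)) w.
    move=> as_ sb'; rewrite /Z (Zp_diff i0 hX)//.
    rewrite (_ : \int[mu]_(q in _) _ = 0) ?addr0//.
    have cr : continuous (fun q => expR (- l * q) * ob i0 X (resid l f) q w).
      move=> q; apply: cvgM; first exact: expRl_continuous.
      apply: (@ob_continuous _ _ _ P _ i0 _ hX _ w _) => i x; apply: cvgB; last exact: cg.
      by apply: cvgM; [exact: cvg_cst|exact: cf].
    rewrite -Rintegral_itv_bndo_bndc; last first.
      have I2 : mu.-integrable `[fine (a w), s] (EFin \o (fun q => expR (- l * q) * ob i0 X (resid l f) q w)).
        apply: continuous_compact_integrable; first exact: segment_compact.
        exact: continuous_subspaceT.
      by apply: integrableS I2 => //; apply: subset_itvl; rewrite bnd_simp.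
    transitivity (\int[mu]_(q in `[fine (a w), s[) (0 : R)); last first.
      by rewrite Rintegral_cst// mul0r.
    apply: eq_Rintegral => q; rewrite inE/= in_itv/= => /andP[aq qs]; rewrite res ?mulr0//.
      by rewrite -(fineK afin) lee_fin.
    by apply: lt_le_trans sb'; rewrite lte_fin.
  rewrite /W am; case: ifPn => bm.
    have bfin : b w \is a fin_num by rewrite ge0_fin_numE ?sb.1// (lt_trans bm)// ltry.
    have rr (x y z : R) : x - y - (x - z) = z - y by ring.
    rewrite rr.
    rewrite Q; [|exact: fine_le|by rewrite fineK].
    by rewrite expR_shift.
  rewrite subr0 Q.
  - by rewrite expR_shift.
  - by rewrite -lee_fin fineK// ltW.
  - by rewrite leNgt.
have IG m : igr P (G m) /\ \int[P]_w G m w = 0.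
  have [Ia Ea] := S2 a m sa (fun w => lexx _); have [Ib Eb] := S2 b m sb ab.
  have GEf := funext (GE m); rewrite GEf.
  by split; [exact: igrB|rewrite EB// Ea Eb subrr].
have := @E_bct _ _ _ P G (fun w => \1_A w * (disc l (a0 w) (b w) * ob i0 X f (fine (b w)) w -
     disc l (a0 w) (a w) * ob i0 X f (fine (a w)) w)) (K + K).
have K0 (w : T) : 0 <= K by have := fK 0 w; exact: le_trans.
have le1 x y : x <= y -> `|expR (- l * (y - x))| <= 1.
  move=> xy; rewrite ger0_norm ?expR_ge0// -expR0 ler_expR mulNr oppr_le0.
  by rewrite mulr_ge0 ?subr_ge0// ltW.
case.
- by move=> m; exact: igr_meas (IG m).1.
- move=> m w; rewrite /G normrM -[leRHS]mul1r ler_pM//.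
    by rewrite indicE; case: (_ \in _); rewrite ?normr1 ?normr0.
  case: ifPn => am; last by rewrite normr0 addr_ge0// (K0 w).
  have afin : a w \is a fin_num by rewrite ge0_fin_numE ?sa.1// (lt_trans am)// ltry.
  have a0fin : a0 w \is a fin_num.
    by rewrite ge0_fin_numE ?sa0.1// (le_lt_trans (a0a w))// (lt_trans am)// ltry.
  have a0a' : fine (a0 w) <= fine (a w) by exact: fine_le.
  rewrite (le_trans (ler_normB _ _))// lerD// -[leRHS]mul1r.
    case: ifPn => bm; rewrite normrM ler_pM// le1//.
      rewrite (le_trans a0a')// fine_le// ge0_fin_numE ?sb.1// (lt_trans bm)// ltry//.
    by rewrite (le_trans a0a')// -lee_fin fineK// ltW.
  by rewrite normrM ler_pM// le1.
- move=> w; apply: cvgM; first exact: cvg_cst.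
  have [aoo|aoo] := boolP (a w < +oo)%E; last first.
    have boo : (b w < +oo)%E = false.
      by apply/negP => boo; case/negP: aoo; exact: le_lt_trans boo.
    rewrite /disc boo (negbTE aoo) !mul0r subr0; apply: cvg_near_cst; apply: nearW => m.
    by rewrite ifF//; apply/negP => am; case/negP: aoo; rewrite (lt_trans am)// ltry.
  have nearlt x : (x < +oo)%E -> (0 <= x)%E -> \forall m \near \oo, (x < (m%:R : R)%:E)%E.
    case: x => // r _ _; exists (Num.truncn r).+1 => // m /= rm; rewrite lte_fin.
    by rewrite (lt_le_trans (truncnS_gt r))// ler_nat.
  have na := nearlt _ aoo (sa.1 w).
  have [boo|boo] := boolP (b w < +oo)%E.
    have nb := nearlt _ boo (sb.1 w).
    by apply: cvg_near_cst; near=> m; rewrite /disc boo aoo (near na)// (near nb).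
  (* When [b] is infinite and [a] is not, the term at the horizon is bounded by
     [K * exp (- l * (m - a0))] and disappears in the limit. *)
  rewrite /disc (negbTE boo) aoo mul0r.
  have : (fun m : nat => expR (- l * (m%:R - fine (a0 w))) * ob i0 X f m%:R w -
      expR (- l * (fine (a w) - fine (a0 w))) * ob i0 X f (fine (a w)) w) @ \oo -->
     0 - expR (- l * (fine (a w) - fine (a0 w))) * ob i0 X f (fine (a w)) w.
    apply: cvgB; last exact: cvg_cst.
    apply: norm_cvg0; apply: (@squeeze_cvgr _ _ _ _ (fun=> 0) (fun m : nat => expR (- l * (m%:R - fine (a0 w))) * K)).
    + apply: nearW => m; rewrite normr_ge0/= normrM ger0_norm ?expR_ge0//.
      by rewrite ler_wpM2l// expR_ge0.
    + exact: cvg_cst.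
    + rewrite -[X in _ --> X](mul0r K); apply: cvgM; last exact: cvg_cst.
      exact: expR_nat_cvg0.
  apply: cvg_trans; apply: near_eq_cvg; near=> m.
  rewrite (near na m)// ifF//; apply/negP => bm; case/negP: boo.
  by rewrite (lt_trans bm)// ltry.
move=> IE; under eq_cvg do rewrite (IG _).2.
move=> /(cvg_lim (@Rhausdorff R)) H; split => //.
by rewrite -H lim_cst.
Unshelve. all: by end_near. Qed.
End Stopping.

(** * Hitting times *)

Lemma near_lt_for {R : realType} (f : R -> R) (x e : R) : {for x, continuous f} -> f x < e ->
  \forall r \near x, f r < e.
Proof. by move=> cf fe; near=> r; near: r; exact: (cvgr_lt _ cf). Unshelve. all: by end_near. Qed.

Lemma near_gt_for {R : realType} (f : R -> R) (x e : R) : {for x, continuous f} -> e < f x ->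
  \forall r \near x, e < f r.
Proof. by move=> cf fe; near=> r; near: r; exact: (cvgr_gt _ cf). Unshelve. all: by end_near. Qed.

Section Hitting.
Context {R : realType} {d : measure_display} {T : measurableType d}.
Variable P : probability T R.
Variables (N : nat) (i0 : 'I_N) (X : 'I_N -> R -> T -> R).
Hypothesis hX : spider_BM P X.
Local Notation F := (Ft X).

(* [D t w] plays the role of the distance to the target: [1 - |b(t)|] before reaching an
   endpoint, [|b(t)|] on the way back. *)
Variable D : R -> T -> R.
Hypothesis D0 : forall t w, 0 <= t -> 0 <= D t w.
Hypothesis cD : forall w t, 0 <= t -> {for t, continuous (D ^~ w)}.
Hypothesis FD : forall t u c, 0 <= u <= t -> F t [set w | D u w < c].
Variable a : T -> \bar R.
Hypothesis sa : stopping X a.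
Hypothesis Da : forall w, (a w < +oo)%E -> D (fine (a w)) w = 1.

(** Entrance into the open set [D < e] is visibly an optional time. The target time [hit0] concerns
    a closed set and is reached as the increasing limit of these entrances. *)
Definition hit (e : R) (w : T) : \bar R :=
  ereal_inf [set t%:E | t in [set t : R | (a w < t%:E)%E /\ D t w < e]].
Definition hit0 (w : T) : \bar R :=
  ereal_inf [set t%:E | t in [set t : R | (a w < t%:E)%E /\ D t w = 0]].

Lemma hit_ge e w : (a w <= hit e w)%E.
Proof. by apply: le_ereal_inf_tmp => _ [t [/ltW at_ _] <-]. Qed.

Lemma hit0_ge w : (a w <= hit0 w)%E.
Proof. by apply: le_ereal_inf_tmp => _ [t [/ltW at_ _] <-]. Qed.

Lemma hit_le_hit0 e w : 0 < e -> (hit e w <= hit0 w)%E.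
Proof. by move=> e0; apply: ereal_inf_le_tmp => _ [t [at_ Dt] <-]; exists t => //; split => //; rewrite Dt. Qed.

Lemma hit_decr e e' w : e <= e' -> (hit e' w <= hit e w)%E.
Proof.
by move=> ee; apply: ereal_inf_le_tmp => _ [t [at_ Dt] <-]; exists t => //; split => //; apply: lt_le_trans ee.
Qed.

Lemma time_gt0 w (t : R) : (a w <= t%:E)%E -> 0 <= t.
Proof. by move=> /(le_trans (sa.1 w)); rewrite lee_fin. Qed.

Lemma stopping_hit e : stopping X (hit e).
Proof.
split=> [w|t]; first exact: le_trans (sa.1 w) (hit_ge e w).
(* By continuity, [D < e] at some time before [t] persists at a slightly later rational time, so a
   countable union suffices. *)
pose S (q : rat) := if 0 <= (ratr q : R) < t then [set w | (a w < (ratr q)%:E)%E] `&` [set w | D (ratr q) w < e] else set0.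
rewrite (_ : [set _ | _] = \bigcup_q S q).
  apply: Ft_bigcup_rat => q; rewrite /S; case: ifPn => [/andP[q0 qt]|_]; last exact: Ft0.
  apply: FtI; first by apply: (Ft_mono (ltW qt)); exact: sa.2.
  by apply: FD; rewrite q0 ltW.
apply/seteqP; split => w /=.
  move=> /ereal_inf_lt[_ [s [as_ Ds] <-]]; rewrite lte_fin => st.
  have s0 := time_gt0 (ltW as_).
  have [dl /= dl0 H] : \forall r \near s, D r w < e.
    exact: (near_lt_for (cD s0)).
  have st' : s < Num.min t (s + dl) by rewrite lt_min st ltrDl.
  have [q] := rat_in_itvoo st'.
  rewrite in_itv/= lt_min => /andP[sq /andP[qt qd]].
  exists q => //; rewrite /S ifT; last by rewrite qt (le_trans s0)// ltW.
  split; first by rewrite /= (lt_trans as_)// lte_fin.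
  by apply: H => /=; rewrite ltr0_norm ?subr_lt0// opprB ltrBlDl.
move=> [q _]; rewrite /S; case: ifPn => // /andP[q0 qt] [/= aq Dq].
apply: (@le_lt_trans _ _ (ratr q)%:E); last by rewrite lte_fin.
by apply: ereal_inf_lbound; exists (ratr q).
Qed.

Lemma D_before_hit e w (q : R) : e <= 1 -> (a w <= q%:E)%E -> (q%:E < hit e w)%E -> e <= D q w.
Proof.
move=> e1; rewrite le_eqVlt => /orP[/eqP aq _|aq qh].
  by have := @Da w; rewrite aq ltry => /(_ isT) /= ->.
rewrite leNgt; apply/negP => Dq; move: qh; rewrite ltNge => /negP; apply.
by apply: ereal_inf_lbound; exists q.
Qed.

(** If [D] were below [e] at the hitting time, it would be so slightly earlier as well, still after
    [a], where [D] equals 1. *)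
Lemma D_at_hit_ge e w : e <= 1 -> (hit e w < +oo)%E -> e <= D (fine (hit e w)) w.
Proof.
move=> e1 hoo; have hfin : hit e w \is a fin_num.
  by rewrite ge0_fin_numE// (stopping_hit e).1.
have := hit_ge e w; rewrite le_eqVlt => /orP[/eqP ah|ah].
  by rewrite -ah Da// ah.
have afin : a w \is a fin_num by rewrite ge0_fin_numE ?sa.1// (lt_trans ah).
rewrite leNgt; apply/negP => Dh.
have h0 : 0 <= fine (hit e w) by apply: fine_ge0; exact: (stopping_hit e).1.
have [dl /= dl0 H] : \forall r \near fine (hit e w), D r w < e.
  exact: (near_lt_for (cD h0)).
pose q := Num.max ((fine (a w) + fine (hit e w)) / 2) (fine (hit e w) - dl / 2).
have ahf : fine (a w) < fine (hit e w) by rewrite fine_lt.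
have qh : q < fine (hit e w) by rewrite /q gt_max; apply/andP; split; lra.
have aq : fine (a w) < q by rewrite /q lt_max; apply/orP; left; lra.
have qd : fine (hit e w) - dl / 2 <= q by rewrite /q le_max lexx orbT.
have := @D_before_hit e w q e1.
rewrite -(fineK afin) -(fineK hfin) lee_fin lte_fin (ltW aq) qh => /(_ isT isT).
rewrite leNgt => /negP; apply; apply: H => /=.
by rewrite ger0_norm; lra.
Qed.

Lemma D_at_hit_le e w : (hit e w < +oo)%E -> D (fine (hit e w)) w <= e.
Proof.
move=> hoo; have hfin : hit e w \is a fin_num.
  by rewrite ge0_fin_numE// (stopping_hit e).1.
rewrite leNgt; apply/negP => Dh.
have h0 : 0 <= fine (hit e w) by apply: fine_ge0; exact: (stopping_hit e).1.
have [dl /= dl0 H] : \forall r \near fine (hit e w), e < D r w.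
  exact: (near_gt_for (cD h0)).
have : (hit e w < (fine (hit e w) + dl)%:E)%E by rewrite -{1}(fineK hfin) lte_fin ltrDl.
move=> /ereal_inf_lt[_ [s [as_ Ds] <-]]; rewrite lte_fin => sd.
have hs : (hit e w <= s%:E)%E by apply: ereal_inf_lbound; exists s.
have : e < D s w; last by rewrite ltNge (ltW Ds).
apply: H => /=.
move: hs; rewrite -{1}(fineK hfin) lee_fin => hs.
by rewrite ler0_norm ?subr_le0// opprB ltrBlDl.
Qed.

(** The shift by 2 puts every level inside []0, 1[], the range in which the corrected test functions
    belong to the domain. *)
Local Notation hn := (fun n : nat => hit (n.+2%:R^-1)).

(** If the limit [L] of these increasing times is finite, then [D = 0] at [L] by continuity. As
    [D = 1] at [a], the time [L] lies strictly after [a] and competes in the infimum defining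
    [hit0]. *)
Lemma hn_cvg w : (fun n => hn n w) @ \oo --> hit0 w.
Proof.
have nd : nondecreasing_seq (fun n => hn n w).
  by move=> m n mn; apply: hit_decr; rewrite lef_pV2 ?posrE// ler_nat !ltnS.
have := ereal_nondecreasing_cvgn nd; set L := ereal_sup _ => cL.
suff -> : hit0 w = L by [].
have hL n : (hn n w <= L)%E by apply: ereal_sup_ubound; exists n.
apply/eqP; rewrite eq_le; apply/andP; split; last first.
  by apply: ub_ereal_sup => _ [n _ <-]; exact: hit_le_hit0.
have [Loo|] := boolP (L < +oo)%E; last by rewrite -leNgt leye_eq => /eqP ->; exact: leey.
have aL : (a w <= L)%E by exact: le_trans (hit_ge _ _) (hL 0).
have L0 : (0 <= L)%E by exact: le_trans (sa.1 w) aL.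
have Lfin : L \is a fin_num by rewrite ge0_fin_numE.
have L0' : 0 <= fine L by exact: fine_ge0.
have cf : (fun n => fine (hn n w)) @ \oo --> fine L.
  by apply: fine_cvg; rewrite fineK.
have cDn : (fun n => D (fine (hn n w)) w) @ \oo --> D (fine L) w.
  exact: (cvg_comp _ (D ^~ w) cf (cD L0')).
have DL : D (fine L) w = 0.
  apply/eqP; rewrite eq_le D0// andbT.
  have cz : (fun n : nat => n.+2%:R^-1 : R) @ \oo --> (0 : R).
    by have := @cvg_harmonic R; rewrite -(cvg_shiftn 1); under eq_fun do rewrite addn1.
  rewrite -(cvg_lim (@Rhausdorff R) cDn) -(cvg_lim (@Rhausdorff R) cz).
  apply: ler_lim; [exact: cvgP cDn|exact: cvgP cz|].
  by apply: nearW => n; apply: D_at_hit_le; exact: le_lt_trans (hL n) Loo.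
apply: ereal_inf_lbound; exists (fine L); last by rewrite fineK.
split=> //; rewrite fineK// lt_neqAle aL andbT; apply/eqP => aE.
by move: DL; rewrite -aE Da ?aE// => /eqP; rewrite oner_eq0.
Qed.

(** A countable description of [hit0 < c] through entrance times alone; the optional-time property
    of [hit0] follows from it. *)
Lemma hit0_gt w (c : R) : (hit0 w < c%:E)%E <-> exists q : rat, ratr q < c /\
  forall n, (hn n w < (ratr q)%:E)%E.
Proof.
split.
  move=> hc; have hfin : hit0 w \is a fin_num.
    by rewrite ge0_fin_numE ?(le_trans (sa.1 w) (hit0_ge w))// (lt_trans hc)// ltry.
  move: hc; rewrite -{1}(fineK hfin) lte_fin => hc.
  have [q] := rat_in_itvoo hc; rewrite in_itv/= => /andP[hq qc].
  exists q; split => // n; apply: (le_lt_trans (hit_le_hit0 w _)) => //.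
  by rewrite -(fineK hfin) lte_fin.
move=> [q [qc H]]; apply: (@le_lt_trans _ _ (ratr q)%:E); last by rewrite lte_fin.
rewrite -(cvg_lim (@ereal_hausdorff R) (@hn_cvg w)); apply: lime_le; first exact: cvgP (@hn_cvg w).
by apply: nearW => n; apply: ltW; exact: H.
Qed.

Lemma stopping_hit0 : stopping X hit0.
Proof.
split=> [w|t]; first exact: le_trans (sa.1 w) (hit0_ge w).
pose S (q : rat) := if (ratr q : R) < t then \bigcap_n [set w | (hn n w < (ratr q)%:E)%E] else set0.
rewrite (_ : [set _ | _] = \bigcup_q S q).
  apply: Ft_bigcup_rat => q; rewrite /S; case: ifPn => [qt|_]; last exact: Ft0.
  apply: Ft_bigcap => n; apply: (Ft_mono (ltW qt)); exact: (stopping_hit _).2.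
apply/seteqP; split => w /=.
  by move=> /(hit0_gt w t).1[q [qt H]]; exists q => //; rewrite /S qt => n _; exact: H.
move=> [q _]; rewrite /S; case: ifPn => // qt H; apply: (hit0_gt w t).2; exists q; split => // n.
exact: H.
Qed.

Lemma D_at_hit0 w : (hit0 w < +oo)%E -> D (fine (hit0 w)) w = 0.
Proof.
move=> hoo; have h0 : (0 <= hit0 w)%E by exact: le_trans (sa.1 w) (hit0_ge w).
have hfin : hit0 w \is a fin_num by rewrite ge0_fin_numE.
have cf : (fun n => fine (hn n w)) @ \oo --> fine (hit0 w).
  by apply: fine_cvg; rewrite fineK//; exact: hn_cvg.
have cDn := cvg_comp _ (D ^~ w) cf (cD (fine_ge0 h0)).
apply/eqP; rewrite eq_le D0 ?fine_ge0// andbT.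
have cz : (fun n : nat => n.+2%:R^-1 : R) @ \oo --> (0 : R).
  by have := @cvg_harmonic R; rewrite -(cvg_shiftn 1); under eq_fun do rewrite addn1.
rewrite -(cvg_lim (@Rhausdorff R) cDn) -(cvg_lim (@Rhausdorff R) cz).
apply: ler_lim; [exact: cvgP cDn|exact: cvgP cz|].
apply: nearW => n; apply: D_at_hit_le; apply: le_lt_trans hoo; exact: hit_le_hit0.
Qed.

(** Where [hit0] is infinite, the entrance times are infinite or tend to infinity, and the discount
    beats the bounded factor [c]; convergence of [c] is needed only in the finite case. *)
Lemma hn_disc_cvg l w (x : \bar R) (c : nat -> R) (c0 K : R) : 0 < l -> (forall n, `|c n| <= K) ->
  ((hit0 w < +oo)%E -> c @ \oo --> c0) ->
  (fun n => disc l x (hn n w) * c n) @ \oo --> disc l x (hit0 w) * c0.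
Proof.
move=> l0 cK cc.
have h0 : (0 <= hit0 w)%E by exact: le_trans (sa.1 w) (hit0_ge w).
have ce : continuous (fun y => expR (- l * y)).
  by move=> y; apply: continuous_comp; [exact: mulrl_continuous|exact: continuous_expR].
have [hoo|hoo] := boolP (hit0 w < +oo)%E.
  have hfin : hit0 w \is a fin_num by rewrite ge0_fin_numE.
  apply: cvgM; last exact: cc.
  have cf : (fun n => fine (hn n w)) @ \oo --> fine (hit0 w).
    by apply: fine_cvg; rewrite fineK//; exact: hn_cvg.
  rewrite {2}/disc hoo (_ : (fun n => _) = fun n => expR (- l * (fine (hn n w) - fine x))); last first.
    apply/funext => n; rewrite /disc ifT//.
    by apply: le_lt_trans hoo; exact: hit_le_hit0.
  apply: (cvg_comp (fun n => fine (hn n w) - fine x) (fun y => expR (- l * y)) _ (ce _)).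
  by apply: cvgB => //; exact: cvg_cst.
rewrite {2}/disc (negbTE hoo) mul0r.
have hoo' : hit0 w = +oo%E by apply/eqP; rewrite -leye_eq leNgt.
have := @hn_cvg w; rewrite hoo' => /cvgeyPgt cy.
apply: norm_cvg0; apply/cvgrPdist_lt => e e0.
have K0 : 0 <= K by exact: le_trans (normr_ge0 _) (cK 0).
have [M HM] : exists M : R, forall y, M < y -> expR (- l * (y - fine x)) * K < e.
  have := @expR_nat_cvg0 R l (fine x) l0.
  move=> /cvgrPdist_lt /(_ (e / (K + 1))) [|m _ /(_ m (leqnn m))]; first by rewrite divr_gt0// ltr_wpDl.
  rewrite sub0r normrN ger0_norm ?expR_ge0// ltr_pdivlMr ?ltr_wpDl// => Hm.
  exists m%:R => y mx; apply: le_lt_trans Hm.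
  rewrite ler_pM ?expR_ge0// ?lerDl// ler_expR !mulNr lerN2 ler_wpM2l ?(ltW l0)//.
  by rewrite lerD2r ltW.
near=> n; rewrite sub0r normrN normr_id normrM (ger0_norm (disc_ge0 _ _ _)).
rewrite /disc; case: ifPn => hnoo; last by rewrite mul0r.
apply: (@le_lt_trans _ _ (expR (- l * (fine (hn n w) - fine x)) * K)).
  by rewrite ler_wpM2l ?expR_ge0.
apply: HM; have : (M%:E < hn n w)%E by near: n; exact: cy.
rewrite -{1}(@fineK _ (hn n w)) ?lte_fin// ge0_fin_numE//.
exact: (stopping_hit _).1.
Unshelve. all: by end_near. Qed.

(** The wanted function [f] need not be in the domain. Its corrections [f_ n] are, and up to the
    entrance at level [1 / (n + 2)] they agree with [f] and have zero residual. So [stopped_diff]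
    applies up to [hn n], and bounded convergence carries the identity to [hit0]. *)
Lemma phase f (f_ : nat -> 'I_N -> R -> R) l a0 A :
  (forall i, continuous (f i)) -> (forall n, spider_dom (f_ n)) -> 0 < l ->
  stopping X a0 -> (forall w, (a0 w <= a w)%E) -> past X a A ->
  (forall n q w, 0 <= q -> n.+2%:R^-1 <= D q w ->
    ob i0 X (resid l (f_ n)) q w = 0 /\ ob i0 X (f_ n) q w = ob i0 X f q w) ->
  igr P (fun w => \1_A w * (disc l (a0 w) (hit0 w) * ob i0 X f (fine (hit0 w)) w -
     disc l (a0 w) (a w) * ob i0 X f (fine (a w)) w)) /\
  \int[P]_w (\1_A w * (disc l (a0 w) (hit0 w) * ob i0 X f (fine (hit0 w)) w -
     disc l (a0 w) (a w) * ob i0 X f (fine (a w)) w)) = 0.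
Proof.
move=> cf Df l0 sa0 a0a pA HD.
have [K fK] := ob_bounded i0 hX cf.
have e1 n : (n.+2%:R^-1 : R) <= 1 by rewrite invf_le1// ler1n.
have e0 n : 0 < (n.+2%:R^-1 : R) by rewrite invr_gt0.
pose G n w := \1_A w * (disc l (a0 w) (hn n w) * ob i0 X f (fine (hn n w)) w -
     disc l (a0 w) (a w) * ob i0 X f (fine (a w)) w).
have IG n : igr P (G n) /\ \int[P]_w G n w = 0.
  have := @stopped_diff _ _ _ P N i0 X hX (f_ n) l a0 a (hn n) A (Df n) l0 sa0 sa (stopping_hit _) a0a (hit_ge _) pA.
  move=> [].
    move=> w q aq qh; apply: (proj1 (HD n q w (time_gt0 aq) _)).
    exact: D_before_hit qh.
  rewrite (_ : (fun w => \1_A w * _) = G n).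
    by move=> I E; split => //; rewrite -E; apply: eqE => w.
  apply/funext => w; rewrite /G; congr (_ * (_ - _)).
    rewrite /disc; case: ifPn => hoo; last by rewrite !mul0r.
    rewrite (proj2 (HD n _ _ _ _))//; first by apply: fine_ge0; exact: (stopping_hit _).1.
    exact: D_at_hit_ge.
  rewrite /disc; case: ifPn => aoo; last by rewrite !mul0r.
  rewrite (proj2 (HD n _ _ _ _))//; first by apply: fine_ge0; exact: sa.1.
  by rewrite Da.
have a0h w e : (a0 w <= hit e w)%E by exact: le_trans (a0a w) (hit_ge _ _).
have := @E_bct _ _ _ P G (fun w => \1_A w * (disc l (a0 w) (hit0 w) * ob i0 X f (fine (hit0 w)) w -
     disc l (a0 w) (a w) * ob i0 X f (fine (a w)) w)) (K + K).
have K0 (w : T) : 0 <= K by have := fK 0 w; exact: le_trans.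
case.
- by move=> m; exact: igr_meas (IG m).1.
- move=> n w; rewrite /G normrM -[leRHS]mul1r ler_pM//.
    by rewrite indicE; case: (_ \in _); rewrite ?normr1 ?normr0.
  have d1 y : (a0 w <= y)%E -> `|disc l (a0 w) y| <= 1.
    move=> ay; rewrite ger0_norm ?disc_ge0//; apply: disc_le1 => //; first exact: ltW.
    exact: sa0.1.
  by rewrite (le_trans (ler_normB _ _))// lerD// -[leRHS]mul1r normrM ler_pM// d1.
- move=> w; apply: cvgM; first exact: cvg_cst.
  apply: cvgB; last exact: cvg_cst.
  apply: (@hn_disc_cvg l w (a0 w) _ _ K) => // hoo.
  have h0 : (0 <= hit0 w)%E by exact: le_trans (sa.1 w) (hit0_ge w).
  have hfin : hit0 w \is a fin_num by rewrite ge0_fin_numE.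
  have cf' : (fun n => fine (hn n w)) @ \oo --> fine (hit0 w).
    by apply: fine_cvg; rewrite fineK//; exact: hn_cvg.
  apply: (cvg_comp _ (fun t => ob i0 X f t w) cf').
  exact: (@ob_continuous _ _ _ P _ i0 _ hX _ w cf).
move=> IE; under eq_cvg do rewrite (IG _).2.
move=> /(cvg_lim (@Rhausdorff R)) H; split => //.
by rewrite -H lim_cst.
Qed.
End Hitting.

(** * Hyperbolic test functions *)

Section DeriveRules.
Context {R : realType}.
Implicit Types (f g : R -> R) (x a b c : R).

Lemma dD f g x a b : is_derive x (1 : R) f a -> is_derive x (1 : R) g b ->
  is_derive x (1 : R) (fun y => f y + g y) (a + b).
Proof. exact: is_deriveD. Qed.

Lemma dZ c f x a : is_derive x (1 : R) f a -> is_derive x (1 : R) (fun y => c * f y) (c * a).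
Proof. exact: is_deriveZ. Qed.

Lemma dM f g x a b : is_derive x (1 : R) f a -> is_derive x (1 : R) g b ->
  is_derive x (1 : R) (fun y => f y * g y) (f x * b + g x * a).
Proof. exact: is_deriveM. Qed.

Lemma dcst c x : is_derive x (1 : R) (fun=> c) 0.
Proof. exact: is_derive_cst. Qed.

Lemma did x : is_derive x (1 : R) (fun y => y) 1.
Proof. exact: is_derive_id. Qed.

Lemma daff c b x : is_derive x (1 : R) (fun y => c * y + b) c.
Proof. by apply: is_derive_eq (dD (dZ c (did x)) (dcst b x)) _; rewrite mulr1 addr0. Qed.

Lemma dcomp f g x a b : is_derive (g x) (1 : R) f a -> is_derive x (1 : R) g b ->
  is_derive x (1 : R) (fun y => f (g y)) (a * b).
Proof. exact: is_derive1_comp. Qed.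

Lemma dX n x : is_derive x (1 : R) (fun y => y ^+ n) (n%:R * x ^+ n.-1).
Proof.
elim: n => [|n IH]; first by rewrite mul0r; exact: is_derive_cst.
have := dM (did x) IH; under eq_fun do rewrite -exprS.
move=> H; apply: is_derive_eq H _; rewrite mulrCA mulr1 -natr1 mulrDl mul1r.
by case: n {IH} => [|n] /=; rewrite ?mul0r// -exprS.
Qed.

Lemma dexp c b x : is_derive x (1 : R) (fun y => expR (c * y + b)) (c * expR (c * x + b)).
Proof. by apply: is_derive_eq (dcomp (is_derive_expR _) (daff c b x)) _; rewrite mulrC. Qed.

Lemma d_continuous f (f' : R -> R) : (forall x, is_derive x (1 : R) f (f' x)) -> continuous f.
Proof. by move=> df x; apply: differentiable_continuous; apply/derivable1_diffP; have [] := df x. Qed.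
End DeriveRules.

Section TestFunctions.
Context {R : realType}.

(** The truncated cube is of class C^2 and vanishes on a half-line, so it can adjust a slope at one
    end of a leg without disturbing the other end. *)
Definition ppow (n : nat) (x : R) : R := Num.max x 0 ^+ n.

Lemma is_derive_ppow n (x : R) : is_derive x 1 (ppow n.+2) (n.+2%:R * ppow n.+1 x).
Proof.
have [x0|x0|->] := ltgtP x 0.
- rewrite /ppow (max_r (ltW x0)) expr0n mulr0.
  have H : is_derive x (1 : R) (cst (0 : R)) 0 by exact: is_derive_cst.
  apply: near_eq_is_derive H.
  by near=> y; rewrite /ppow max_r ?expr0n//; apply: ltW; near: y; exact: lt_nbhsl.
- rewrite /ppow (max_l (ltW x0)).
  apply: (@near_eq_is_derive R R R (fun y => y ^+ n.+2)).
    by near=> y; rewrite /ppow max_l//; apply: ltW; near: y; exact: lt_nbhsr.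
  exact: dX.
- rewrite /ppow max_l// expr0n mulr0.
  suff H : h^-1 *: ((ppow n.+2 \o shift 0) (h *: 1) - ppow n.+2 0) @[h --> (0 : R)^'] --> (0 : R).
    by apply: DeriveDef; [exact: cvgP H|exact: cvg_lim H].
  apply: norm_cvg0; apply: (@squeeze_cvgr _ _ _ _ (fun=> 0) (fun h : R => `|h| ^+ n.+1)).
  + near=> h; rewrite normr_ge0/=.
    have h0 : h != 0 by near: h; exact: nbhs_dnbhs_neq.
    rewrite {2}/ppow maxxx expr0n subr0 /= addr0 /GRing.scale/= mulr1 normrM normfV.
    rewrite ler_pdivrMl ?normr_gt0// -exprS /ppow normrX lerXn2r ?nnegrE//.
    by have [h1|h1] := leP h 0; rewrite ?normr0.
  + exact: cvg_cst.
  + rewrite -[X in _ --> X](expr0n R n.+1); apply: (@cvg_comp _ _ _ (@Num.norm R R) (fun x => x ^+ n.+1)); last exact: exprn_continuous.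
    have : `|x| @[x --> (0 : R)] --> `|0 : R| by exact: norm_continuous.
    rewrite normr0; exact: cvg_within_filter.
Unshelve. all: by end_near. Qed.

Lemma ppow_continuous n : continuous (ppow n).
Proof.
move=> x; apply: (cvg_comp (fun x : R => Num.max x 0) (fun y : R => y ^+ n)).
  exact: max0_continuous.
exact: exprn_continuous.
Qed.

Lemma spider_domI N (f f1 f2 : 'I_N -> R -> R) :
  (forall i (x : R), is_derive x 1 (f i) (f1 i x)) ->
  (forall i (x : R), is_derive x 1 (f1 i) (f2 i x)) ->
  (forall i, continuous (f2 i)) ->
  (forall i j, f i 0 = f j 0) -> (forall i j, f2 i 0 = f2 j 0) ->
  \sum_(i < N) f1 i 0 = 0 -> (forall i, f1 i 1 = 0) ->
  spider_dom f /\ forall i x, spider_gen f i x = 2^-1 * f2 i x.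
Proof.
move=> d1 d2 c2 f00 f20 K Nm.
have E1 i : (f i)^`()%classic = f1 i by apply/funext => x; rewrite derive1E; exact: derive_val.
have E2 i : (f1 i)^`()%classic = f2 i by apply/funext => x; rewrite derive1E; exact: derive_val.
split; last by move=> i x; rewrite /spider_gen E1 E2.
split.
- move=> i; rewrite E1 E2; split=> [x|]; first by have [] := d1 i x.
  by split=> [x|]; [have [] := d2 i x|exact: c2].
- exact: f00.
- by move=> i j; rewrite !E1 !E2.
- by under eq_bigr do rewrite E1.
- by move=> i; rewrite E1.
Qed.

Definition ch (x : R) : R := (expR x + expR (- x)) / 2.
Definition sh (x : R) : R := (expR x - expR (- x)) / 2.

Lemma is_derive_ch (k c x : R) : is_derive x 1 (fun x : R => ch (k * x + c)) (k * sh (k * x + c)).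
Proof.
rewrite /ch /sh; apply: is_derive_eq.
by rewrite /GRing.scale /=; field.
Qed.

Lemma is_derive_sh (k c x : R) : is_derive x 1 (fun x : R => sh (k * x + c)) (k * ch (k * x + c)).
Proof.
rewrite /ch /sh; apply: is_derive_eq.
by rewrite /GRing.scale /=; field.
Qed.

Lemma ch0 : ch 0 = 1. Proof. by rewrite /ch oppr0 expR0; field. Qed.
Lemma sh0 : sh 0 = 0. Proof. by rewrite /sh oppr0 expR0; field. Qed.
Lemma ch_gt0 x : 0 < ch x. Proof. by rewrite divr_gt0// addr_gt0// expR_gt0. Qed.
Lemma sh_gt0 x : 0 < x -> 0 < sh x.
Proof. by move=> x0; rewrite divr_gt0// subr_gt0 ltr_expR; lra. Qed.

Lemma ch_continuous k c : continuous (fun x : R => ch (k * x + c)).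
Proof. by move=> x; apply: differentiable_continuous; apply/derivable1_diffP; have [] := is_derive_ch k c x. Qed.
Lemma sh_continuous k c : continuous (fun x : R => sh (k * x + c)).
Proof. by move=> x; apply: differentiable_continuous; apply/derivable1_diffP; have [] := is_derive_sh k c x. Qed.

Section Up.
Variables (N : nat) (i0 : 'I_N) (k : R).
Hypothesis k0 : 0 < k.

(** Off leg [i] the coefficient makes [upf] vanish at the endpoint, and on leg [i] it is forced by
    Kirchhoff's condition [sum_upc]. The resulting function detects arrival at endpoint [i]
    alone. *)
Definition upc (i j : 'I_N) : R := if j == i then (N%:R - 1) * (ch k / sh k) else - (ch k / sh k).

Definition upf (i j : 'I_N) (x : R) : R := ch (k * x) + upc i j * sh (k * x).

Lemma upf0 i j : upf i j 0 = 1.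
Proof. by rewrite /upf mulr0 ch0 sh0 mulr0 addr0. Qed.

Lemma upf1 i j : upf i j 1 = if j == i then N%:R * ch k else 0.
Proof.
have s0 : sh k != 0 by rewrite gt_eqF// sh_gt0.
by rewrite /upf /upc mulr1; case: ifP => _; field.
Qed.

Lemma sum_upc i : \sum_(j < N) upc i j = 0.
Proof.
rewrite (bigD1 i)//= /upc eqxx (eq_bigr (fun=> - (ch k / sh k))) => [|j /negbTE->//].
rewrite sumr_const cardC1 card_ord -mulr_natl.
have -> : N%:R = N.-1%:R + 1 :> R.
  by rewrite -[in LHS](prednK (leq_trans _ (ltn_ord i)))// -addn1 natrD.
ring.
Qed.

Lemma upf_continuous i j : continuous (upf i j).
Proof.
move=> x; rewrite /upf; apply: cvgD.
  by have := @ch_continuous k 0; under eq_fun do rewrite addr0; exact.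
apply: cvgM; first exact: cvg_cst.
by have := @sh_continuous k 0; under eq_fun do rewrite addr0; exact.
Qed.

(* The cubic correction, supported in ]1 - e, +oo[, restores the Neumann condition. *)
Definition upg (e : R) (i j : 'I_N) (x : R) : R :=
  upf i j x - k * (sh k + upc i j * ch k) / (3 * e ^+ 2) * ppow 3 (x - (1 - e)).


Lemma d_upf i j x : is_derive x (1 : R) (upf i j) (k * (sh (k * x) + upc i j * ch (k * x))).
Proof.
have H1 := is_derive_ch k 0 x; have H2 := is_derive_sh k 0 x.
have := dD H1 (dZ (upc i j) H2); rewrite !addr0.
under eq_fun do rewrite !addr0.
by move=> H; apply: is_derive_eq H _; ring.
Qed.

Lemma d_upf' i j x : is_derive x (1 : R) (fun y => k * (sh (k * y) + upc i j * ch (k * y)))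
  (k ^+ 2 * upf i j x).
Proof.
have H1 := is_derive_ch k 0 x; have H2 := is_derive_sh k 0 x.
have := dZ k (dD H2 (dZ (upc i j) H1)); rewrite !addr0.
under eq_fun do rewrite !addr0.
by move=> H; apply: is_derive_eq H _; rewrite /upf; ring.
Qed.

Lemma d_ppow_shift n (c b x : R) : is_derive x (1 : R) (fun y => ppow n.+2 (c * y + b))
  (n.+2%:R * ppow n.+1 (c * x + b) * c).
Proof. exact: dcomp (is_derive_ppow n _) (daff c b x). Qed.

(** The coefficient of the cube is the slope of [upf] at 1 divided by the slope [3 * e ^+ 2] of the
    cube there. As [e < 1], the cube vanishes at 0 together with its first two derivatives, and the
    conditions there are those of [upf]. *)
Lemma upg_dom e i : 0 < e < 1 -> spider_dom (upg e i) /\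
  forall j x, spider_gen (upg e i) j x = 2^-1 * (k ^+ 2 * upf i j x -
    k * (sh k + upc i j * ch k) / (3 * e ^+ 2) * (6 * ppow 1 (x - (1 - e)))).
Proof.
move=> /andP[e0 e1].
pose c j := k * (sh k + upc i j * ch k) / (3 * e ^+ 2).
have p0 n : ppow n.+1 (0 - (1 - e)) = 0 by rewrite /ppow max_r ?expr0n//; lra.
apply: (@spider_domI N (upg e i)
  (fun j x => k * (sh (k * x) + upc i j * ch (k * x)) - c j * (3 * ppow 2 (x - (1 - e))))
  (fun j x => k ^+ 2 * upf i j x - c j * (6 * ppow 1 (x - (1 - e))))).
- move=> j x; have := dD (d_upf i j x) (dZ (- c j) (d_ppow_shift 1 1 (- (1 - e)) x)).
  under eq_fun do rewrite mul1r mulNr.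
  by rewrite mul1r => H; apply: is_derive_eq H _; ring.
- move=> j x; have := dD (d_upf' i j x) (dZ (- c j) (dZ 3 (d_ppow_shift 0 1 (- (1 - e)) x))).
  under eq_fun do rewrite mul1r mulNr.
  by rewrite mul1r => H; apply: is_derive_eq H _; ring.
- move=> j x; apply: cvgB; first by apply: cvgM; [exact: cvg_cst|exact: upf_continuous].
  apply: cvgM; first exact: cvg_cst.
  apply: cvgM; first exact: cvg_cst.
  apply: (cvg_comp (fun y : R => y - (1 - e)) (ppow 1)); last exact: ppow_continuous.
  by apply: cvgB; [exact: cvg_id|exact: cvg_cst].
- by move=> j j'; rewrite /upg !p0 !upf0 !mulr0.
- by move=> j j'; rewrite !p0 !upf0 !mulr0.
- rewrite (eq_bigr (fun j => k * upc i j)) => [|j _]; first by rewrite -mulr_sumr sum_upc mulr0.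
  by rewrite p0 !mulr0 sh0 ch0; ring.
- move=> j; rewrite /c !mulr1 opprB addrCA subrr addr0 /ppow max_l ?(ltW e0)//.
  by field; rewrite gt_eqF.
Qed.

Lemma upg_eq e i j x : x <= 1 - e -> upg e i j x = upf i j x.
Proof. by move=> xe; rewrite /upg /ppow max_r ?expr0n ?mulr0 ?subr0// subr_le0. Qed.

Lemma upg_resid e i j l x : 0 < e < 1 -> k ^+ 2 = 2 * l -> x <= 1 - e ->
  resid l (upg e i) j x = 0.
Proof.
move=> e01 kl xe; rewrite /resid (upg_dom i e01).2 upg_eq//.
by rewrite /ppow max_r ?subr_le0// expr0n !mulr0 subr0 kl; field.
Qed.

Lemma upg_at0 e i j j' : 0 < e < 1 -> upg e i j 0 = upg e i j' 0.
Proof. by move=> /andP[e0 e1]; rewrite !upg_eq ?upf0//; lra. Qed.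
End Up.

Section Down.
Variables (N : nat) (k : R).
Hypothesis k0 : 0 < k.

(** The function [ch (k * (1 - x))] satisfies the Neumann condition and takes the value 1 at the
    endpoints and [ch k] at the origin. *)
Definition dnf (j : 'I_N) (x : R) : R := ch (- k * x + k).

(* The cubic correction, supported in ]-oo, e[, restores the Kirchhoff condition. *)
Definition dng (e : R) (j : 'I_N) (x : R) : R :=
  dnf j x - k * sh k / (3 * e ^+ 2) * ppow 3 (- 1 * x + e).

(** Each leg of [dnf] has slope [- k * sh k] at 0. The cubic term cancels it leg by leg, so every
    summand of Kirchhoff's condition is 0, and it vanishes near 1. *)
Lemma dng_dom e : 0 < e < 1 -> spider_dom (dng e) /\
  forall j x, spider_gen (dng e) j x = 2^-1 * (k ^+ 2 * dnf j x -
    k * sh k / (3 * e ^+ 2) * (6 * ppow 1 (- 1 * x + e))).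
Proof.
move=> /andP[e0 e1].
pose c := k * sh k / (3 * e ^+ 2).
have p1 n : ppow n.+1 (- 1 * 1 + e) = 0 by rewrite /ppow max_r ?expr0n//; lra.
apply: (@spider_domI N (dng e)
  (fun j x => - k * sh (- k * x + k) - c * (- 3 * ppow 2 (- 1 * x + e)))
  (fun j x => k ^+ 2 * dnf j x - c * (6 * ppow 1 (- 1 * x + e)))).
- move=> j x; have := dD (is_derive_ch (- k) k x) (dZ (- c) (d_ppow_shift 1 (- 1) e x)).
  under eq_fun do rewrite !(mulNr c).
  by move=> H; apply: is_derive_eq H _; ring.
- move=> j x; have := dD (dZ (- k) (is_derive_sh (- k) k x)) (dZ (- c) (dZ (- 3) (d_ppow_shift 0 (- 1) e x))).
  under eq_fun do rewrite !(mulNr c).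
  by move=> H; apply: is_derive_eq H _; rewrite /dnf; ring.
- move=> j x; apply: cvgB; first by apply: cvgM; [exact: cvg_cst|exact: ch_continuous].
  apply: cvgM; first exact: cvg_cst.
  apply: cvgM; first exact: cvg_cst.
  apply: (cvg_comp (fun y : R => - 1 * y + e) (ppow 1)); last exact: ppow_continuous.
  by apply: cvgD; [apply: cvgM; [exact: cvg_cst|exact: cvg_id]|exact: cvg_cst].
- by move=> j j'.
- by move=> j j'.
- rewrite big1// => j _; rewrite /c mulr0 !add0r mulr0 add0r /ppow max_l ?(ltW e0)//.
  by field; rewrite gt_eqF.
- by move=> j; rewrite p1 !mulr0 subr0 mulr1 addNr sh0 mulr0.
Qed.

Lemma dng_eq e j x : e <= x -> dng e j x = dnf j x.
Proof. by move=> xe; rewrite /dng /ppow max_r ?expr0n ?mulr0 ?subr0//; lra. Qed.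

Lemma dng_resid e j l x : 0 < e < 1 -> k ^+ 2 = 2 * l -> e <= x ->
  resid l (dng e) j x = 0.
Proof.
move=> e01 kl xe; rewrite /resid (dng_dom e01).2 dng_eq//.
rewrite /ppow max_r; last by lra.
by rewrite expr0n !mulr0 subr0 kl; field.
Qed.
End Down.
End TestFunctions.

(** * One covering cycle *)

Lemma obs_leg {R : realType} N (i0 : 'I_N) (x : 'I_N -> R) : spider_point x ->
  exists2 j, x j = spider_abs x & forall f, (forall i i', f i 0 = f i' 0) -> obs i0 f x = f j (x j).
Proof.
move=> px; have [j xj|x0] := pickP (fun i => x i != 0).
  exists j; first by rewrite (spider_point_abs px xj).
  move=> f f0; rewrite /obs (bigD1 j)//= big1 ?addr0 => [|i ij].
    by rewrite (f0 i0 j) addrCA subrr addr0.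
  case: (eqVneq (x i) 0) => [->|xi]; first by rewrite subrr.
  by case: px => _ /(_ i j xi xj) ij'; rewrite ij' eqxx in ij.
have z i : x i = 0 by have := x0 i => /negbFE/eqP.
exists i0; first by rewrite z /spider_abs big1.
by move=> f f0; rewrite /obs big1 ?addr0 ?z// => i _; rewrite z subrr.
Qed.

Section Cycle.
Context {R : realType} {d : measure_display} {T : measurableType d}.
Variable P : probability T R.
Variables (N : nat) (i0 : 'I_N) (X : 'I_N -> R -> T -> R).
Hypothesis hX : spider_BM P X.

Let px t w : 0 <= t -> spider_point (fun i => X i t w). Proof. by case: hX => _ + _ _ _; exact. Qed.

Definition rho_of (a : T -> \bar R) (w : T) := next_rho (fun i t => X i t w) (a w).
Definition sig_of (a : T -> \bar R) (w : T) := next_sigma (fun i t => X i t w) (a w).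

Definition Dup (t : R) (w : T) := 1 - spider_abs (fun i => X i (Num.max t 0) w).
(** Distance to one prescribed endpoint; timing its disappearance shows, in [EL_past], that the
    visited leg is known at the arrival. *)
Definition Dleg (i : 'I_N) (t : R) (w : T) := 1 - X i (Num.max t 0) w.
Definition Ddn (t : R) (w : T) := spider_abs (fun i => X i (Num.max t 0) w).

Lemma max0_ge0 (t : R) : 0 <= Num.max t 0. Proof. by rewrite le_max lexx orbT. Qed.

Lemma Dup_ge0 t w : 0 <= t -> 0 <= Dup t w.
Proof. by move=> _; rewrite subr_ge0; case/andP: (spider_abs_le1 (px w (max0_ge0 t))). Qed.
Lemma Dleg_ge0 i t w : 0 <= t -> 0 <= Dleg i t w.
Proof. by move=> _; rewrite subr_ge0; case: (px w (max0_ge0 t)) => /(_ i)/andP[]. Qed.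
Lemma Ddn_ge0 t w : 0 <= t -> 0 <= Ddn t w.
Proof. by move=> _; case/andP: (spider_abs_le1 (px w (max0_ge0 t))). Qed.

Lemma Ddn_cont w t : 0 <= t -> {for t, continuous (Ddn ^~ w)}.
Proof.
by move=> _; apply: continuous_sum => i; exact: (path_continuous hX).
Qed.
Lemma Dup_cont w t : 0 <= t -> {for t, continuous (Dup ^~ w)}.
Proof. by move=> t0; apply: cvgB; [exact: cvg_cst|exact: Ddn_cont]. Qed.
Lemma Dleg_cont i w t : 0 <= t -> {for t, continuous (Dleg i ^~ w)}.
Proof. by move=> t0; apply: cvgB; [exact: cvg_cst|exact: (path_continuous hX)]. Qed.

Lemma Ft_Ddn t u c : 0 <= u <= t -> Ft X t [set w | Ddn u w < c].
Proof.
move=> /[dup] ut /andP[u0 _]; rewrite /Ddn max_l//.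
have := @Ft_abs _ _ _ _ X t u `]-oo, c[%classic ut; move=> /(_ (measurable_itv _)).
by congr (Ft X t _); apply/seteqP; split => w /=; rewrite in_itv.
Qed.
Lemma Ft_Dup t u c : 0 <= u <= t -> Ft X t [set w | Dup u w < c].
Proof.
move=> /[dup] ut /andP[u0 _]; rewrite /Dup max_l//.
have := @Ft_abs _ _ _ _ X t u `]1 - c, +oo[%classic ut; move=> /(_ (measurable_itv _)).
by congr (Ft X t _); apply/seteqP; split => w /=; rewrite in_itv/= andbT; lra.
Qed.
Lemma Ft_Dleg i t u c : 0 <= u <= t -> Ft X t [set w | Dleg i u w < c].
Proof.
move=> /[dup] ut /andP[u0 _]; rewrite /Dleg max_l//.
have := @Ft_X _ _ _ _ X t i u `]1 - c, +oo[%classic ut; move=> /(_ (measurable_itv _)).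
by congr (Ft X t _); apply/seteqP; split => w /=; rewrite in_itv/= andbT; lra.
Qed.

Definition at0 (a : T -> \bar R) := forall w, (a w < +oo)%E -> forall i, X i (fine (a w)) w = 0.

(** When [a < b] and [a < t], a rational [q < t] can be found with [a < q <= b]; each such event is
    decided by time [q]. *)
Lemma past_lt_stopping a b : stopping X a -> stopping X b -> past X a [set w | (a w < b w)%E].
Proof.
move=> sa sb.
have E (t : \bar R) : [set w | (a w < b w)%E] `&` [set w | (a w < t)%E] =
   \bigcup_(q : rat) (if ((ratr q)%:E < t)%E then
     [set w | (a w < (ratr q)%:E)%E] `&` ~` [set w | (b w < (ratr q)%:E)%E] else set0).
  apply/seteqP; split => w /=.
    move=> [ab at_].
    have afin : a w \is a fin_num by rewrite ge0_fin_numE ?sa.1// (lt_le_trans ab)// leey.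
    have [c [ac cb ct]] : exists c : R, [/\ fine (a w) < c, (c%:E <= b w)%E & (c%:E <= t)%E].
      have amin : (a w < mine (b w) t)%E by rewrite lt_min ab.
      case E : (mine (b w) t) amin => [c| |] amin.
      - exists c; rewrite -E !ge_min !lexx orbT; split=> //.
        by rewrite -lte_fin fineK.
      - exists (fine (a w) + 1); rewrite ltrDl; split=> //.
          by apply: le_trans (_ : (+oo <= _)%E); rewrite ?leey// -E ge_min lexx.
        by apply: le_trans (_ : (+oo <= _)%E); rewrite ?leey// -E ge_min lexx orbT.
      - by rewrite ltNge leNye in amin.
    have [q] := rat_in_itvoo ac; rewrite in_itv/= => /andP[aq qc]; exists q => //.
    rewrite ifT; last by apply: lt_le_trans ct; rewrite lte_fin.
    split; first by rewrite /= -(fineK afin) lte_fin.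
    by apply/negP; rewrite -leNgt; apply: le_trans cb; rewrite lee_fin ltW.
  move=> [q _]; case: ifPn => // qt [/= aq /negP]; rewrite -leNgt => qb.
  by split; [exact: lt_le_trans qb|exact: lt_trans qt].
split.
  rewrite (_ : [set _ | _] = [set w | (a w < b w)%E] `&` [set w | (a w < +oo)%E]); last first.
    by apply/seteqP; split => w /= => [ab|[]//]; split => //; rewrite (lt_le_trans ab)// leey.
  have mX i t : measurable_fun setT (X i t) by case: hX.
  rewrite E; apply: bigcupT_measurable_rat => q; case: ifPn => // _.
  apply: measurableI; first exact: (Ft_measurable mX (sa.2 _)).
  by apply: measurableC; exact: (Ft_measurable mX (sb.2 _)).
move=> t; rewrite E; apply: Ft_bigcup_rat => q; case: ifPn => [qt|_]; last exact: Ft0.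
apply: (Ft_mono (ltW (_ : ratr q < t))); first by rewrite -lte_fin.
by apply: FtI; [exact: sa.2|apply: FtC; exact: sb.2].
Qed.

Section OneCycle.
Variable a : T -> \bar R.
Hypothesis sa : stopping X a.
Hypothesis a0 : at0 a.

Lemma rho_ofE : rho_of a = hit0 Dup a.
Proof.
apply/funext => w; rewrite /rho_of /next_rho /hit0; congr (ereal_inf (EFin @` _)).
apply/seteqP; split => t /= [at_ Xt]; (split; first by []);
  have t0 : 0 <= t by rewrite -lee_fin (le_trans (sa.1 w))// ltW.
  by rewrite /Dup max_l// Xt subrr.
by apply/esym/eqP; move: Xt => /eqP; rewrite /Dup max_l// subr_eq0.
Qed.

Lemma Dup_at w : (a w < +oo)%E -> Dup (fine (a w)) w = 1.
Proof.
move=> aoo; rewrite /Dup max_l ?fine_ge0 ?sa.1//.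
by rewrite /spider_abs big1 ?subr0// => i _; exact: a0.
Qed.

Lemma Dleg_at i w : (a w < +oo)%E -> Dleg i (fine (a w)) w = 1.
Proof. by move=> aoo; rewrite /Dleg max_l ?fine_ge0 ?sa.1// a0// subr0. Qed.

Lemma stopping_rho : stopping X (rho_of a).
Proof. by rewrite rho_ofE; exact: (stopping_hit0 Dup_ge0 Dup_cont Ft_Dup sa Dup_at). Qed.

Lemma rho_ge w : (a w <= rho_of a w)%E.
Proof. by rewrite rho_ofE; exact: hit0_ge. Qed.

Lemma rho_abs w : (rho_of a w < +oo)%E -> spider_abs (fun i => X i (fine (rho_of a w)) w) = 1.
Proof.
move=> roo; have := @D_at_hit0 _ _ _ N X Dup Dup_ge0 Dup_cont Ft_Dup a sa Dup_at w.
rewrite -rho_ofE => /(_ roo); rewrite /Dup max_l ?fine_ge0 ?stopping_rho.1//.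
by move=> /eqP; rewrite subr_eq0 => /eqP.
Qed.

Lemma sig_ofE : sig_of (rho_of a) = hit0 Ddn (rho_of a).
Proof.
apply/funext => w; rewrite /sig_of /next_sigma /hit0; congr (ereal_inf (EFin @` _)).
apply/seteqP; split => t /= [at_ Xt]; (split; first by []);
  have t0 : 0 <= t by rewrite -lee_fin (le_trans (stopping_rho.1 w))// ltW.
  by rewrite /Ddn max_l//; apply/spider_abs_eq0 => //; exact: px.
by move: Xt; rewrite /Ddn max_l// => /spider_abs_eq0; apply; exact: px.
Qed.

Lemma Ddn_at w : (rho_of a w < +oo)%E -> Ddn (fine (rho_of a w)) w = 1.
Proof. by move=> roo; rewrite /Ddn max_l ?fine_ge0 ?stopping_rho.1// rho_abs. Qed.

Lemma stopping_sig : stopping X (sig_of (rho_of a)).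
Proof. by rewrite sig_ofE; exact: (stopping_hit0 Ddn_ge0 Ddn_cont Ft_Ddn stopping_rho Ddn_at). Qed.

Lemma sig_ge w : (rho_of a w <= sig_of (rho_of a) w)%E.
Proof. by rewrite sig_ofE; exact: hit0_ge. Qed.

Lemma sig_at0 : at0 (sig_of (rho_of a)).
Proof.
move=> w soo; apply/spider_abs_eq0; first by apply: px; rewrite fine_ge0 ?stopping_sig.1.
have := @D_at_hit0 _ _ _ N X Ddn Ddn_ge0 Ddn_cont Ft_Ddn _ stopping_rho Ddn_at w.
by rewrite -sig_ofE => /(_ soo); rewrite /Ddn max_l// fine_ge0 ?stopping_sig.1.
Qed.

Definition EL (i : 'I_N) : set T :=
  [set w | (rho_of a w < +oo)%E /\ X i (fine (rho_of a w)) w = 1].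

(** The position at a random time is avoided by comparing two optional times: with [r] the first
    arrival at endpoint [i], one always has [rho <= r], and the leg is [i] exactly when [rho < r]
    fails. *)
Lemma EL_past i : past X (rho_of a) (EL i).
Proof.
pose r := hit0 (Dleg i) a.
have sr : stopping X r by exact: (stopping_hit0 (Dleg_ge0 i) (@Dleg_cont i) (@Ft_Dleg i) sa (Dleg_at i)).
rewrite (_ : EL i = [set w | (rho_of a w < +oo)%E] `&` ~` [set w | (rho_of a w < r w)%E]).
  apply: pastI; first exact: (past_fin hX stopping_rho).
  by apply: pastC; [exact: stopping_rho|exact: (past_lt_stopping stopping_rho sr)].
apply/seteqP; split => w /= [roo].
  move=> Xi; split => //; apply/negP; rewrite -leNgt.
  have rfin : rho_of a w \is a fin_num by rewrite ge0_fin_numE// stopping_rho.1.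
  apply: ereal_inf_lbound; exists (fine (rho_of a w)); last by rewrite fineK.
  split; last by rewrite /Dleg max_l ?Xi ?subrr// fine_ge0 ?stopping_rho.1.
  rewrite fineK// lt_neqAle rho_ge andbT; apply/eqP => ar.
  by move: Xi; rewrite -ar a0 ?ar// => /esym/eqP; rewrite oner_eq0.
move=> /negP; rewrite -leNgt => rr; split => //.
suff rE : r w = rho_of a w.
  have := @D_at_hit0 _ _ _ N X (Dleg i) (Dleg_ge0 i) (@Dleg_cont i) (@Ft_Dleg i) a sa (Dleg_at i) w.
  rewrite -/(r w) rE => /(_ roo); rewrite /Dleg max_l ?fine_ge0 ?stopping_rho.1//.
  by move=> /eqP; rewrite subr_eq0 => /eqP.
apply/eqP; rewrite eq_le rr/= rho_ofE; apply: ereal_inf_le_tmp => _ [t [at_ Dt] <-].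
exists t => //; split => //.
have t0 : 0 <= t by rewrite -lee_fin (le_trans (sa.1 w))// ltW.
move: Dt; rewrite /Dup /Dleg max_l// => /eqP; rewrite subr_eq0 => /eqP X1.
apply/eqP; rewrite subr_eq0 eq_le; apply/andP; split.
  by rewrite [leLHS]X1; exact: (spider_abs_ge i (px w t0)).
by case/andP: (spider_abs_le1 (px w t0)).
Qed.

Lemma EL_sum w : (rho_of a w < +oo)%E -> exists i, EL i w.
Proof.
move=> roo; have r0 : 0 <= fine (rho_of a w) by rewrite fine_ge0 ?stopping_rho.1.
have [j xj _] := obs_leg i0 (px w r0); exists j; split => //.
by rewrite xj rho_abs.
Qed.

Lemma EL_inj w i j : EL i w -> EL j w -> i = j.
Proof.
move=> [roo Xi] [_ Xj]; have r0 : 0 <= fine (rho_of a w) by rewrite fine_ge0 ?stopping_rho.1.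
by have [_] := px w r0; apply; rewrite ?Xi ?Xj oner_eq0.
Qed.

(** The test function [upf] equals 1 at the origin, [N * ch k] at endpoint [i] and 0 at the other
    endpoints. The answer is the same for all [i], whence the uniform choice of the leg. *)
Lemma up_phase i l A : 0 < l -> past X a A ->
  igr P (fun w => \1_(A `&` EL i) w * disc l (a w) (rho_of a w)) /\
  N%:R * ch (Num.sqrt (2 * l)) * \int[P]_w (\1_(A `&` EL i) w * disc l (a w) (rho_of a w)) =
  fine (P (A `&` [set w | (a w < +oo)%E])).
Proof.
move=> l0 pA; set k := Num.sqrt (2 * l).
have k0 : 0 < k by rewrite sqrtr_gt0 mulr_gt0.
have k2 : k ^+ 2 = 2 * l by rewrite sqr_sqrtr// mulr_ge0// ltW.
have e01 n : 0 < (n.+2%:R^-1 : R) < 1 by rewrite invr_gt0 ltr0n/= invf_lt1// ltr1n.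
have ck := ch_gt0 k; have N0 : 0 < N%:R :> R by rewrite ltr0n (leq_trans _ (ltn_ord i)).
have cfu j : continuous (upf k i j) by exact: upf_continuous.
have Dn n : spider_dom (upg k n.+2%:R^-1 i) by case: (@upg_dom R N k n.+2%:R^-1 i (e01 n)).
have Hc n q w : 0 <= q -> n.+2%:R^-1 <= Dup q w -> ob i0 X (resid l (upg k n.+2%:R^-1 i)) q w = 0 /\
   ob i0 X (upg k n.+2%:R^-1 i) q w = ob i0 X (upf k i) q w.
  move=> q0 De.
  have [j xj H] := obs_leg i0 (px w (max0_ge0 q)).
  have xe : X j (Num.max q 0) w <= 1 - n.+2%:R^-1 by rewrite xj lerBrDl -lerBrDr.
  have h0 : (0 : R) <= 1 - n.+2%:R^-1 by rewrite subr_ge0 ltW//; case/andP: (e01 n).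
  rewrite /ob !H.
  - by rewrite (upg_resid i j (e01 n) k2 xe) upg_eq.
  - by move=> i1 i2; rewrite !upf0.
  - by move=> i1 i2; exact: upg_at0.
  - by move=> i1 i2; rewrite (upg_resid i i1 (e01 n) k2 h0) (upg_resid i i2 (e01 n) k2 h0).
have [I E] := @phase _ _ _ P N i0 X hX Dup Dup_ge0 Dup_cont Ft_Dup a sa Dup_at
  (upf k i) (fun n => upg k n.+2%:R^-1 i) l a A cfu
  Dn l0 sa (fun w => lexx _) pA
  Hc.
have mf : measurable (A `&` [set w | (a w < +oo)%E]).
  by case: (pastI pA (past_fin hX sa)).
have EQ w : \1_A w * (disc l (a w) (rho_of a w) * ob i0 X (upf k i) (fine (rho_of a w)) w -
     disc l (a w) (a w) * ob i0 X (upf k i) (fine (a w)) w) =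
  N%:R * ch k * (\1_(A `&` EL i) w * disc l (a w) (rho_of a w)) - \1_(A `&` [set w | (a w < +oo)%E]) w.
  have h1 : \1_(A `&` EL i) w = \1_A w * \1_(EL i) w :> R by rewrite indicI.
  have h2 : \1_(A `&` [set w | (a w < +oo)%E]) w = \1_A w * \1_[set w | (a w < +oo)%E] w :> R by rewrite indicI.
  rewrite h1 h2.
  have -> : disc l (a w) (a w) * ob i0 X (upf k i) (fine (a w)) w = \1_[set w | (a w < +oo)%E] w.
    rewrite /disc indicE; case: ifPn => aoo; last by rewrite mul0r memNset//; exact/negP.
    rewrite mem_set// subrr mulr0 expR0 mul1r /ob /obs upf0 big1 ?addr0// => j _.
    by rewrite max_l ?fine_ge0 ?sa.1// a0// subrr.
  have -> : disc l (a w) (rho_of a w) * ob i0 X (upf k i) (fine (rho_of a w)) w =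
     N%:R * (ch k * (\1_(EL i) w * disc l (a w) (rho_of a w))).
    have [roo|roo] := boolP (rho_of a w < +oo)%E; last first.
      by rewrite /disc (negbTE roo) !(mul0r, mulr0).
    have r0 : 0 <= fine (rho_of a w) by rewrite fine_ge0 ?stopping_rho.1.
    have [j xj H] := obs_leg i0 (px w r0).
    rewrite /ob max_l// H; last by move=> i1 i2; rewrite !upf0.
    have Xj : X j (fine (rho_of a w)) w = 1 by rewrite xj rho_abs.
    rewrite Xj upf1//; case: eqVneq => [<-|ji].
      by rewrite indicE mem_set// mul1r; ring.
    rewrite indicE memNset ?mul0r ?mulr0// => -[_ Xi].
    by have := @EL_inj w i j (conj roo Xi) (conj roo Xj) => ij; rewrite ij eqxx in ji.
  by ring.
have Im := bmf_igr P (bmf_ind mf).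
move: I E; rewrite rho_ofE in EQ *; under eq_fun do rewrite EQ.
move=> I.
have I1 : igr P (fun w => N%:R * ch k * (\1_(A `&` EL i) w * disc l (a w) (hit0 Dup a w))).
  have := igrD I Im; congr igr; apply/funext => w; ring.
rewrite EB// E_ind// => /eqP; rewrite subr_eq0 => /eqP <-.
have I2 : igr P (fun w => \1_(A `&` EL i) w * disc l (a w) (hit0 Dup a w)).
  have := igrZ (N%:R * ch k)^-1 I1; congr igr; apply/funext => w; rewrite mulKf//.
  by rewrite mulf_neq0// gt_eqF.
by split=> //; rewrite EZ.
Qed.

(** Here [dnf] passes from 1 at the endpoint to [ch k] at the origin. The discount still starts at
    [a], so that this factor multiplies the one of the outward phase. *)
Lemma down_phase l B : 0 < l -> past X (rho_of a) B ->
  igr P (fun w => \1_B w * disc l (a w) (rho_of a w)) ->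
  igr P (fun w => \1_B w * disc l (a w) (sig_of (rho_of a) w)) /\
  ch (Num.sqrt (2 * l)) * \int[P]_w (\1_B w * disc l (a w) (sig_of (rho_of a) w)) =
  \int[P]_w (\1_B w * disc l (a w) (rho_of a w)).
Proof.
move=> l0 pB Ir; set k := Num.sqrt (2 * l).
have k0 : 0 < k by rewrite sqrtr_gt0 mulr_gt0.
have k2 : k ^+ 2 = 2 * l by rewrite sqr_sqrtr// mulr_ge0// ltW.
have e01 n : 0 < (n.+2%:R^-1 : R) < 1 by rewrite invr_gt0 ltr0n/= invf_lt1// ltr1n.
have ck := ch_gt0 k.
have cfd (j : 'I_N) : continuous (dnf k j) by exact: ch_continuous.
have Dn n : spider_dom (@dng R N k n.+2%:R^-1) by case: (@dng_dom R N k n.+2%:R^-1 (e01 n)).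
have Hc n q w : 0 <= q -> n.+2%:R^-1 <= Ddn q w -> ob i0 X (resid l (@dng R N k n.+2%:R^-1)) q w = 0 /\
   ob i0 X (dng k n.+2%:R^-1) q w = ob i0 X (dnf k) q w.
  move=> q0 De.
  have [j xj H] := obs_leg i0 (px w (max0_ge0 q)).
  have xe : n.+2%:R^-1 <= X j (Num.max q 0) w by move: De; rewrite /Ddn -xj.
  rewrite /ob !H.
  - by rewrite (dng_resid j (e01 n) k2 xe) dng_eq.
  - by [].
  - by [].
  - by [].
have [I E] := @phase _ _ _ P N i0 X hX Ddn Ddn_ge0 Ddn_cont Ft_Ddn (rho_of a) stopping_rho Ddn_at
  (dnf k) (fun n => dng k n.+2%:R^-1) l a B cfd
  Dn l0 sa rho_ge pB
  Hc.
have EQ w : \1_B w * (disc l (a w) (sig_of (rho_of a) w) * ob i0 X (dnf k) (fine (sig_of (rho_of a) w)) w -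
     disc l (a w) (rho_of a w) * ob i0 X (dnf k) (fine (rho_of a w)) w) =
  ch k * (\1_B w * disc l (a w) (sig_of (rho_of a) w)) - \1_B w * disc l (a w) (rho_of a w).
  have -> : disc l (a w) (sig_of (rho_of a) w) * ob i0 X (dnf k) (fine (sig_of (rho_of a) w)) w =
     ch k * disc l (a w) (sig_of (rho_of a) w).
    rewrite /disc; case: ifPn => soo; last by rewrite mul0r mulr0.
    rewrite /ob /obs big1 ?addr0; last first.
      by move=> j _; rewrite max_l ?fine_ge0 ?stopping_sig.1// sig_at0// subrr.
    by rewrite /dnf mulr0 add0r mulrC.
  have -> : disc l (a w) (rho_of a w) * ob i0 X (dnf k) (fine (rho_of a w)) w = disc l (a w) (rho_of a w).
    rewrite /disc; case: ifPn => roo; last by rewrite mul0r.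
    have r0 : 0 <= fine (rho_of a w) by rewrite fine_ge0 ?stopping_rho.1.
    have [j xj H] := obs_leg i0 (px w r0).
    rewrite /ob max_l// H//.
    have -> : X j (fine (rho_of a w)) w = 1 by rewrite xj rho_abs.
    by rewrite /dnf mulr1 addNr ch0 mulr1.
  by ring.
move: I E; rewrite sig_ofE in EQ *; under eq_fun do rewrite EQ.
move=> I.
have I1 : igr P (fun w => ch k * (\1_B w * disc l (a w) (hit0 Ddn (rho_of a) w))).
  have := igrD I Ir; congr igr; apply/funext => w; ring.
rewrite EB// => /eqP; rewrite subr_eq0 => /eqP <-.
have I2 : igr P (fun w => \1_B w * disc l (a w) (hit0 Ddn (rho_of a) w)).
  have := igrZ (ch k)^-1 I1; congr igr; apply/funext => w; rewrite mulKf//.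
  by rewrite gt_eqF.
by split=> //; rewrite EZ.
Qed.

Lemma cycle_law i l A : 0 < l -> past X a A ->
  igr P (fun w => \1_(A `&` EL i) w * disc l (a w) (sig_of (rho_of a) w)) /\
  \int[P]_w (\1_(A `&` EL i) w * disc l (a w) (sig_of (rho_of a) w)) =
  fine (P (A `&` [set w | (a w < +oo)%E])) / N%:R / ch (Num.sqrt (2 * l)) ^+ 2.
Proof.
move=> l0 pA.
have pB : past X (rho_of a) (A `&` EL i).
  by apply: pastI; [exact: (past_mono rho_ge stopping_rho)|exact: EL_past].
have [I1 E1] := up_phase i l0 pA; have [I2 E2] := down_phase l0 pB I1.
split; first exact: I2.
have c0 : ch (Num.sqrt (2 * l)) != 0 by rewrite gt_eqF// ch_gt0.
have N0 : N%:R != 0 :> R by rewrite pnatr_eq0 -lt0n (leq_trans _ (ltn_ord i)).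
have key (x y z n c : R) : n != 0 -> c != 0 -> n * c * x = z -> c * y = x -> y = z / n / c ^+ 2.
  by move=> n0 c0' <- <-; field; rewrite n0 c0'.
exact: key E1 E2.
Qed.
End OneCycle.
End Cycle.

(** * Moments from Laplace transforms *)

Section Laplace.
Context {R : realType}.

(** Integrates an inequality once; the Taylor bounds below are obtained by iterating it from the
    highest derivative down. *)
Lemma mono0 (f f' : R -> R) (b : R) : (forall x, is_derive x (1 : R) f (f' x)) -> f 0 = 0 ->
  (forall x, 0 <= x <= b -> 0 <= f' x) -> forall x, 0 <= x <= b -> 0 <= f x.
Proof.
move=> df f0 f'0 x /andP[]; rewrite le_eqVlt => /predU1P[<- _|x0 xb]; first by rewrite f0.
have cf : continuous f by exact: d_continuous df.
have [c] := @MVT R f f' 0 x x0 (fun y _ => df y) (continuous_subspaceT cf).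
rewrite in_itv/= f0 !subr0 => /andP[c0 cx] ->; apply: mulr_ge0; last exact: ltW.
by apply: f'0; rewrite (ltW c0)/= (le_trans (ltW cx)).
Qed.

Lemma dpoly (a b c e x : R) : is_derive x (1 : R) (fun y => a * y + b * y ^+ 2 + c * y ^+ 3 + e * y ^+ 4)
  (a + 2 * b * x + 3 * c * x ^+ 2 + 4 * e * x ^+ 3).
Proof.
have := dD (dD (dD (dZ a (did x)) (dZ b (dX 2 x))) (dZ c (dX 3 x))) (dZ e (dX 4 x)).
by move=> H; apply: is_derive_eq H _; rewrite /= !expr1; ring.
Qed.

Lemma dexpN (x : R) : is_derive x (1 : R) (fun y => expR (- y)) (- expR (- x)).
Proof.
have := dexp (- 1) 0 x; under eq_fun do rewrite addr0 mulN1r.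
by rewrite addr0 !mulN1r.
Qed.

Lemma expN_bounds (x : R) : 0 <= x ->
  [/\ 0 <= 1 - expR (- x) <= x, x - x ^+ 2 / 2 <= 1 - expR (- x),
   0 <= expR (- x) - 1 + x & [/\ expR (- x) - 1 + x <= x ^+ 2 / 2,
   x ^+ 2 / 2 - x ^+ 3 / 6 <= expR (- x) - 1 + x,
   0 <= 1 - x + x ^+ 2 / 2 - expR (- x),
   1 - x + x ^+ 2 / 2 - expR (- x) <= x ^+ 3 / 6 &
   x ^+ 3 / 6 - x ^+ 4 / 24 <= 1 - x + x ^+ 2 / 2 - expR (- x)]].
Proof.
move=> x0.
have g0 (y : R) : 0 <= y <= x -> 0 <= 1 - expR (- y).
  by move=> /andP[y0 _]; rewrite subr_ge0 -expR0 ler_expR oppr_le0.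
have e0 : expR (- 0) = 1 :> R by rewrite oppr0 expR0.
have g1 (y : R) : 0 <= y <= x -> 0 <= expR (- y) + (1 * y + 0 * y ^+ 2 + 0 * y ^+ 3 + 0 * y ^+ 4) + (- 1).
  apply: (@mono0 (fun y => expR (- y) + (1 * y + 0 * y ^+ 2 + 0 * y ^+ 3 + 0 * y ^+ 4) + (- 1)) (fun y => 1 - expR (- y)) x) => // [z|]; last by rewrite e0; ring.
  by apply: is_derive_eq (dD (dD (dexpN z) (dpoly _ _ _ _ z)) (dcst (- 1) z)) _; ring.
have g2 (y : R) : 0 <= y <= x -> 0 <= (- 1) * expR (- y) + ((- 1) * y + 2^-1 * y ^+ 2 + 0 * y ^+ 3 + 0 * y ^+ 4) + 1.
  apply: (@mono0 (fun y => (- 1) * expR (- y) + ((- 1) * y + 2^-1 * y ^+ 2 + 0 * y ^+ 3 + 0 * y ^+ 4) + 1) (fun y => expR (- y) + (1 * y + 0 * y ^+ 2 + 0 * y ^+ 3 + 0 * y ^+ 4) + (- 1)) x) => // [z|]; last by rewrite e0; ring.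
  by apply: is_derive_eq (dD (dD (dZ (- 1) (dexpN z)) (dpoly _ _ _ _ z)) (dcst 1 z)) _; field.
have g3 (y : R) : 0 <= y <= x -> 0 <= expR (- y) + (1 * y + (- 2^-1) * y ^+ 2 + 6^-1 * y ^+ 3 + 0 * y ^+ 4) + (- 1).
  apply: (@mono0 (fun y => expR (- y) + (1 * y + (- 2^-1) * y ^+ 2 + 6^-1 * y ^+ 3 + 0 * y ^+ 4) + (- 1)) (fun y => (- 1) * expR (- y) + ((- 1) * y + 2^-1 * y ^+ 2 + 0 * y ^+ 3 + 0 * y ^+ 4) + 1) x) => // [z|]; last by rewrite e0; ring.
  by apply: is_derive_eq (dD (dD (dexpN z) (dpoly _ _ _ _ z)) (dcst (- 1) z)) _; field.
have g4 (y : R) : 0 <= y <= x -> 0 <= (- 1) * expR (- y) + ((- 1) * y + 2^-1 * y ^+ 2 + (- 6^-1) * y ^+ 3 + 24^-1 * y ^+ 4) + 1.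
  apply: (@mono0 (fun y => (- 1) * expR (- y) + ((- 1) * y + 2^-1 * y ^+ 2 + (- 6^-1) * y ^+ 3 + 24^-1 * y ^+ 4) + 1) (fun y => expR (- y) + (1 * y + (- 2^-1) * y ^+ 2 + 6^-1 * y ^+ 3 + 0 * y ^+ 4) + (- 1)) x) => // [z|]; last by rewrite e0; ring.
  by apply: is_derive_eq (dD (dD (dZ (- 1) (dexpN z)) (dpoly _ _ _ _ z)) (dcst 1 z)) _; field.
have xx : 0 <= x <= x by rewrite x0 lexx.
have := g0 x xx; have := g1 x xx; have := g2 x xx; have := g3 x xx; have := g4 x xx.
move: (expR (- x)) (x ^+ 2) (x ^+ 3) (x ^+ 4) => E x2 x3 x4 h4 h3 h2 h1 h0.
by do ?[split]; try (apply/andP; split); lra.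
Qed.

Lemma d_ch0 (x : R) : is_derive x (1 : R) ch (sh x).
Proof.
have := is_derive_ch 1 0 x; rewrite addr0 !mul1r.
by under eq_fun do rewrite addr0 mul1r.
Qed.

Lemma d_sh0 (x : R) : is_derive x (1 : R) sh (ch x).
Proof.
have := is_derive_sh 1 0 x; rewrite addr0 !mul1r.
by under eq_fun do rewrite addr0 mul1r.
Qed.

Lemma sh_ge0 (x : R) : 0 <= x -> 0 <= sh x.
Proof. by rewrite le_eqVlt => /predU1P[<-|/sh_gt0/ltW//]; rewrite sh0. Qed.

Lemma dmon (c : R) n x : is_derive x (1 : R) (fun y => c * y ^+ n) (c * (n%:R * x ^+ n.-1)).
Proof. exact: dZ (dX n x). Qed.

(** The sixth derivative of [ch] is [ch] itself, lying between 1 and [M] on [[0, 1]]; six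
    integrations give the upper bound, and the lower one uses only [ch >= 1]. *)
Lemma ch_bounds (M : R) (z : R) : M = ch 1 -> 0 <= z <= 1 ->
  1 + z ^+ 2 / 2 + z ^+ 4 / 24 <= ch z <= 1 + z ^+ 2 / 2 + z ^+ 4 / 24 + M / 720 * z ^+ 6.
Proof.
move=> ME z01.
have D1 := dmon; have D0 (x : R) := dcst 0 x.
have c0 (y : R) : 0 <= y <= 1 -> 0 <= ch y - 1.
  apply: (@mono0 (fun y => ch y - 1) (fun y => sh y + 0) 1) => [x||x /andP[x0 _]]; last by rewrite addr0 sh_ge0.
    exact: dD (d_ch0 x) (dcst _ x).
  by rewrite ch0 subrr.
have s1 (y : R) : 0 <= y <= 1 -> 0 <= sh y + (- 1) * y ^+ 1.
  apply: (@mono0 (fun y => sh y + (- 1) * y ^+ 1) (fun y => ch y - 1) 1) => [x||//]; last by rewrite sh0; ring.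
  by apply: is_derive_eq (dD (d_sh0 x) (dmon (- 1) 1 x)) _; rewrite /= expr0; ring.
have c2 (y : R) : 0 <= y <= 1 -> 0 <= ch y - 1 + (- 2^-1) * y ^+ 2.
  apply: (@mono0 (fun y => ch y - 1 + (- 2^-1) * y ^+ 2) (fun y => sh y + (- 1) * y ^+ 1) 1) => [x||//]; last by rewrite ch0; ring.
  by apply: is_derive_eq (dD (dD (d_ch0 x) (dcst (- 1) x)) (dmon _ 2 x)) _; rewrite /=; field.
have s3 (y : R) : 0 <= y <= 1 -> 0 <= sh y + (- 1) * y ^+ 1 + (- 6^-1) * y ^+ 3.
  apply: (@mono0 (fun y => sh y + (- 1) * y ^+ 1 + (- 6^-1) * y ^+ 3) (fun y => ch y - 1 + (- 2^-1) * y ^+ 2) 1) => [x||//]; last by rewrite sh0; ring.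
  by apply: is_derive_eq (dD (dD (d_sh0 x) (dmon (- 1) 1 x)) (dmon _ 3 x)) _; rewrite /= expr0; field.
have c4 (y : R) : 0 <= y <= 1 -> 0 <= ch y - 1 + (- 2^-1) * y ^+ 2 + (- 24^-1) * y ^+ 4.
  apply: (@mono0 (fun y => ch y - 1 + (- 2^-1) * y ^+ 2 + (- 24^-1) * y ^+ 4) (fun y => sh y + (- 1) * y ^+ 1 + (- 6^-1) * y ^+ 3) 1) => [x||//]; last by rewrite ch0; ring.
  by apply: is_derive_eq (dD (dD (dD (d_ch0 x) (dcst (- 1) x)) (dmon _ 2 x)) (dmon _ 4 x)) _; rewrite /=; field.
have C0 (y : R) : 0 <= y <= 1 -> 0 <= M - ch y.
  move=> /andP[y0 y1]; have := @mono0 (fun x => ch (y + x) - ch y) (fun x => sh (y + x)) (1 - y).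
  move=> /(_ _ _ _ (1 - y)); rewrite subrKC ME; apply.
  - move=> x; have H := @dcomp _ ch (fun t => 1 * t + y) x _ _ (d_ch0 _) (daff 1 y x).
    have := dD H (dcst (- ch y) x); rewrite mulr1 addr0 mul1r [x + y]addrC.
    by under eq_fun do rewrite mul1r [_ + y]addrC.
  - by rewrite addr0 subrr.
  - by move=> x /andP[x0 _]; apply: sh_ge0; rewrite addr_ge0.
  - by rewrite lexx andbT subr_ge0.
have S1 (y : R) : 0 <= y <= 1 -> 0 <= M * y ^+ 1 + (- 1) * sh y.
  apply: (@mono0 (fun y => M * y ^+ 1 + (- 1) * sh y) (fun y => M - ch y) 1) => [x||//]; last by rewrite sh0; ring.
  by apply: is_derive_eq (dD (dmon _ 1 x) (dZ (- 1) (d_sh0 x))) _; rewrite /= expr0; ring.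
have C2 (y : R) : 0 <= y <= 1 -> 0 <= M / 2 * y ^+ 2 + (- 1) * ch y + 1.
  apply: (@mono0 (fun y => M / 2 * y ^+ 2 + (- 1) * ch y + 1) (fun y => M * y ^+ 1 + (- 1) * sh y) 1) => [x||//]; last by rewrite ch0; ring.
  by apply: is_derive_eq (dD (dD (dmon _ 2 x) (dZ (- 1) (d_ch0 x))) (dcst 1 x)) _; rewrite /=; field.
have S3 (y : R) : 0 <= y <= 1 -> 0 <= M / 6 * y ^+ 3 + (- 1) * sh y + 1 * y ^+ 1.
  apply: (@mono0 (fun y => M / 6 * y ^+ 3 + (- 1) * sh y + 1 * y ^+ 1) (fun y => M / 2 * y ^+ 2 + (- 1) * ch y + 1) 1) => [x||//]; last by rewrite sh0; ring.
  by apply: is_derive_eq (dD (dD (dmon _ 3 x) (dZ (- 1) (d_sh0 x))) (dmon 1 1 x)) _; rewrite /= expr0; field.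
have C4 (y : R) : 0 <= y <= 1 -> 0 <= M / 24 * y ^+ 4 + (- 1) * ch y + 2^-1 * y ^+ 2 + 1.
  apply: (@mono0 (fun y => M / 24 * y ^+ 4 + (- 1) * ch y + 2^-1 * y ^+ 2 + 1) (fun y => M / 6 * y ^+ 3 + (- 1) * sh y + 1 * y ^+ 1) 1) => [x||//]; last by rewrite ch0; ring.
  by apply: is_derive_eq (dD (dD (dD (dmon _ 4 x) (dZ (- 1) (d_ch0 x))) (dmon _ 2 x)) (dcst 1 x)) _; rewrite /=; field.
have S5 (y : R) : 0 <= y <= 1 -> 0 <= M / 120 * y ^+ 5 + (- 1) * sh y + 6^-1 * y ^+ 3 + 1 * y ^+ 1.
  apply: (@mono0 (fun y => M / 120 * y ^+ 5 + (- 1) * sh y + 6^-1 * y ^+ 3 + 1 * y ^+ 1) (fun y => M / 24 * y ^+ 4 + (- 1) * ch y + 2^-1 * y ^+ 2 + 1) 1) => [x||//]; last by rewrite sh0; ring.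
  by apply: is_derive_eq (dD (dD (dD (dmon _ 5 x) (dZ (- 1) (d_sh0 x))) (dmon _ 3 x)) (dmon 1 1 x)) _; rewrite /= expr0; field.
have C6 (y : R) : 0 <= y <= 1 -> 0 <= M / 720 * y ^+ 6 + (- 1) * ch y + 24^-1 * y ^+ 4 + 2^-1 * y ^+ 2 + 1.
  apply: (@mono0 (fun y => M / 720 * y ^+ 6 + (- 1) * ch y + 24^-1 * y ^+ 4 + 2^-1 * y ^+ 2 + 1) (fun y => M / 120 * y ^+ 5 + (- 1) * sh y + 6^-1 * y ^+ 3 + 1 * y ^+ 1) 1) => [x||//]; last by rewrite ch0; ring.
  by apply: is_derive_eq (dD (dD (dD (dD (dmon _ 6 x) (dZ (- 1) (d_ch0 x))) (dmon _ 4 x)) (dmon _ 2 x)) (dcst 1 x)) _; rewrite /=; field.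
have := c4 z z01; have := C6 z z01.
move: (ch z) (z ^+ 2) (z ^+ 4) (z ^+ 6) => c y2 y4 y6 h1 h2.
move: (M / 720 * y6) h1 => Y h1.
by apply/andP; split; lra.
Qed.

Definition lap (l : R) : R := (ch (Num.sqrt (2 * l)) ^+ 2)^-1.

Lemma ch_sqr (k : R) : ch k ^+ 2 = (1 + ch (2 * k)) / 2.
Proof.
rewrite /ch -mulrN !mulr_natl !mulr2n !expRD expRN.
have := expR_gt0 k; move: (expR k) => E E0; field.
by rewrite gt_eqF.
Qed.

(** With [z = 2 * sqrt (2 * l)] one has [ch ^+ 2 = (1 + ch z) / 2] and [z ^+ 2 = 8 * l], and
    [l <= 1 / 8] keeps [z] in [[0, 1]]. The coefficients encode mean 2 and second moment 16/3, hence
    variance 4/3. *)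
Lemma lap_bounds : exists2 C, 0 <= C & forall l, 0 < l <= 8^-1 ->
  `|lap l - (1 - 2 * l + 8 / 3 * l ^+ 2)| <= C * l ^+ 3.
Proof.
pose M := ch (1 : R); have M0 : 0 <= M by exact/ltW/ch_gt0.
exists (8 / 3 + 32 / 9 + M * 4) => [|l /andP[l0 l8]]; first by rewrite !addr_ge0// mulr_ge0.
have k2 : Num.sqrt (2 * l) ^+ 2 = 2 * l by rewrite sqr_sqrtr// mulr_ge0// ltW.
rewrite /lap ch_sqr; set z := 2 * Num.sqrt (2 * l).
have z2 : z ^+ 2 = 8 * l by rewrite /z exprMn k2; ring.
have z01 : 0 <= z <= 1.
  rewrite mulr_ge0 ?sqrtr_ge0//= -(@expr_le1 _ 2)// ?mulr_ge0 ?sqrtr_ge0// z2; lra.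
have := ch_bounds (erefl M) z01.
have -> : z ^+ 4 = 64 * l ^+ 2 by rewrite -[4%N]/(2 * 2)%N exprM z2; ring.
have -> : z ^+ 6 = 512 * l ^+ 3 by rewrite -[6%N]/(2 * 3)%N exprM z2; ring.
rewrite z2 => /andP[h1 h2].
pose r := (1 + ch z) / 2 - (1 + 2 * l + 4 / 3 * l ^+ 2).
have r0 : 0 <= r by rewrite /r; lra.
have rM : r <= M * l ^+ 3 by rewrite /r; have : 0 <= M * l ^+ 3 := mulr_ge0 M0 (exprn_ge0 3 (ltW l0)); lra.
have -> : (1 + ch z) / 2 = 1 + 2 * l + 4 / 3 * l ^+ 2 + r by rewrite /r; ring.
have D1 : 1 <= 1 + 2 * l + 4 / 3 * l ^+ 2 + r by have := sqr_ge0 l; lra.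
set D := _ + r in D1 *; have D0 : 0 < D by exact: lt_le_trans D1.
(* The product of [1 + 2 l + 4/3 l^2] and [1 - 2 l + 8/3 l^2] is [1 + 8/3 l^3 + 32/9 l^4]. *)
have -> : D^-1 - (1 - 2 * l + 8 / 3 * l ^+ 2) =
  - (8 / 3 * l ^+ 3 + 32 / 9 * l ^+ 4 + r * (1 - 2 * l + 8 / 3 * l ^+ 2)) / D.
  by apply: (mulIf (lt0r_neq0 D0)); rewrite mulrBl mulfVK ?lt0r_neq0// mulVf ?lt0r_neq0// /D; field.
have l3 : 0 <= l ^+ 3 by rewrite exprn_ge0// ltW.
have l4 : 0 <= l ^+ 4 <= l ^+ 3.
  by rewrite exprn_ge0 ?(ltW l0)//= exprS ler_piMl// (le_trans l8)// invf_le1 ?ler1n.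
have p1 : 0 <= 1 - 2 * l + 8 / 3 * l ^+ 2 <= 4 by apply/andP; split; nra.
move/andP: p1 => [p0 p1]; move/andP: l4 => [l40 l43].
rewrite normrM normrN normfV (gtr0_norm D0) ler_pdivrMr//.
rewrite ger0_norm; last first.
  by apply: addr_ge0; [apply: addr_ge0|]; apply: mulr_ge0 => //; rewrite divr_ge0.
apply: (@le_trans _ _ ((8 / 3 + 32 / 9 + M * 4) * l ^+ 3)); last first.
  by rewrite -[leLHS]mulr1 ler_wpM2l// mulr_ge0// !addr_ge0// mulr_ge0.
have h : r * (1 - 2 * l + 8 / 3 * l ^+ 2) <= M * l ^+ 3 * 4 by rewrite ler_pM.
rewrite [leRHS]mulrDl [M * 4 * _]mulrAC [leRHS]addrC.
have key (x y u v : R) : x <= y -> v <= u -> 8 / 3 * u + 32 / 9 * v + x <= y + (8 / 3 + 32 / 9) * u by lra.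
exact: key h l43.
Qed.
End Laplace.

(** * Moments of a duration from its Laplace transform near 0 *)

Section Moments.
Context {R : realType} {d : measure_display} {T : measurableType d}.
Variable P : probability T R.

Definition rate_seq (n : nat) : R := n.+1%:R^-1 / 8.

Lemma rate_seq_gt0 n : 0 < rate_seq n. Proof. by rewrite divr_gt0// invr_gt0. Qed.
Lemma rate_seq_le n : rate_seq n <= 8^-1.
Proof. by rewrite /rate_seq ler_pdivrMr// mulVf// invf_le1// ler1n. Qed.
Lemma rate_seq_cvg : rate_seq @ \oo --> (0 : R).
Proof.
rewrite -[X in _ --> X](mul0r (8^-1 : R)); apply: cvgM; last exact: cvg_cst.
exact: cvg_harmonic.
Qed.

Lemma cvg_rate (f : nat -> R) (v C : R) : (forall n, `|f n - v| <= C * rate_seq n) -> f @ \oo --> v.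
Proof.
move=> H; have H2 : (fun n => `|f n - v|) @ \oo --> (0 : R).
  apply: (@squeeze_cvgr _ _ _ _ (fun=> 0) (fun n => C * rate_seq n)).
  - by apply: nearW => n; rewrite normr_ge0/=.
  - exact: cvg_cst.
  - by rewrite -[X in _ --> X](mulr0 C); apply: cvgM; [exact: cvg_cst|exact: rate_seq_cvg].
by apply/subr_cvg0; apply: norm_cvg0; exact: H2.
Qed.

(** A bound for the third moment per unit of mass. The third-order difference quotient carries the
    factor [3! = 6], which 12 covers. It depends on [R] only, so the replacement error is uniform in
    [N], the leg and the past. *)
Definition moment_const : R := 12 * (xget 0 [set C : R | 0 <= C /\ forall l, 0 < l <= 8^-1 ->
  `|lap l - (1 - 2 * l + 8 / 3 * l ^+ 2)| <= C * l ^+ 3]).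

Lemma moment_constP : 0 <= moment_const /\ forall l : R, 0 < l <= 8^-1 ->
  `|lap l - (1 - 2 * l + 8 / 3 * l ^+ 2)| <= moment_const / 12 * l ^+ 3.
Proof.
rewrite /moment_const; case: xgetP => [C -> [C0 H]|H]; last first.
  by have [C C0 HC] := @lap_bounds R; case: (H C).
split; first by rewrite mulr_ge0.
by move=> l l0; rewrite [12 * _]mulrC mulfK//; exact: H.
Qed.

(** In the application [h] is the indicator of a past event together with a visited leg, [u] the
    duration of the cycle and [c] the probability of that joint event. *)
Variables (h u : T -> R) (c : R).
Hypothesis h01 : forall w, 0 <= h w <= 1.
Hypothesis u0 : forall w, 0 <= u w.
Hypothesis Ih : forall l, 0 < l -> igr P (fun w => h w * expR (- l * u w)).
Hypothesis Eh : forall l, 0 < l -> \int[P]_w (h w * expR (- l * u w)) = c * lap l.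

Let C := moment_const / 12.

Let lapn n : `|lap (rate_seq n) - (1 - 2 * rate_seq n + 8 / 3 * rate_seq n ^+ 2)| <= C * rate_seq n ^+ 3.
Proof. by apply: moment_constP.2; rewrite rate_seq_gt0 rate_seq_le. Qed.

Let C0 : 0 <= C. Proof. by rewrite divr_ge0// moment_constP.1. Qed.

Let expb n w : 0 <= rate_seq n * u w. Proof. by rewrite mulr_ge0// ltW// rate_seq_gt0. Qed.

Let ln2 n : 0 <= rate_seq n ^+ 2 <= rate_seq n.
Proof.
rewrite exprn_ge0 ?(ltW (rate_seq_gt0 n))//= expr2 ler_piMr ?(ltW (rate_seq_gt0 n))//.
by rewrite (le_trans (rate_seq_le n))// invf_le1// ler1n.
Qed.

Lemma moment0 : igr P h /\ \int[P]_w h w = c.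
Proof.
have cv w : h w * expR (- rate_seq n * u w) @[n --> \oo] --> h w.
  rewrite -[X in _ --> X](mulr1 (h w)); apply: cvgM; first exact: cvg_cst.
  apply: (@cvg_rate _ _ (u w)) => n; have [/andP[h1 h2] _ _ _] := expN_bounds (expb n w).
  by rewrite distrC mulNr ger0_norm// [u w * _]mulrC.
have b1 n w : `|h w * expR (- rate_seq n * u w)| <= 1.
  have [/andP[h1 h2] _ _ _] := expN_bounds (expb n w).
  have /andP[hw0 hw1] := h01 w.
  by rewrite normrM !ger0_norm ?expR_ge0// mulr_ile1 ?expR_ge0// mulNr; move: h1; rewrite subr_ge0.
have [I E] := @E_bct _ _ _ P (fun n w => h w * expR (- rate_seq n * u w)) h 1
   (fun n => igr_meas (Ih (rate_seq_gt0 n))) b1 cv.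
split => //; rewrite -(cvg_lim (@Rhausdorff R) E); apply: cvg_lim => //.
suff Q : c * lap (rate_seq n) @[n --> \oo] --> c by under eq_cvg do rewrite Eh ?rate_seq_gt0//.
rewrite -[X in _ --> X](mulr1 c); apply: cvgM; first exact: cvg_cst.
apply: (@cvg_rate _ _ (C + 2 + 8 / 3)) => n.
have := lapn n; have := ln2 n; have := rate_seq_gt0 n; have := rate_seq_le n.
move: (lap (rate_seq n)) (rate_seq n) C0 => q l K0 l8 l0 /andP[l2 l2'].
have l3 : l ^+ 3 <= l by rewrite exprS ler_piMr ?(ltW l0)// (le_trans l2')// (le_trans l8)// invf_le1// ler1n.
have Kl : C * l ^+ 3 <= C * l by rewrite ler_wpM2l.
by rewrite !mulrDl !ler_norml => /andP[a1 a2]; apply/andP; split; lra.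
Qed.

(** The quotients [h * (1 - exp (- l * u)) / l] lie between 0 and [h * u] and have bounded
    expectations. Fatou gives integrability of [h * u], which then dominates the same quotients and
    yields the value; [moment2] repeats this one order higher. *)
Lemma moment1 : igr P (fun w => h w * u w) /\ \int[P]_w (h w * u w) = 2 * c.
Proof.
have [I0 E0] := moment0.
have c0 : 0 <= c by rewrite -E0; apply: Rintegral_ge0 => w _; case/andP: (h01 w).
pose f n w := (rate_seq n)^-1 * (h w - h w * expR (- rate_seq n * u w)).
have If n : igr P (f n) by apply/igrZ/igrB => //; exact/Ih/rate_seq_gt0.
have fE n w : f n w = h w * ((rate_seq n)^-1 * (1 - expR (- (rate_seq n * u w)))) by rewrite /f mulNr; ring.
have f01 n w : 0 <= f n w <= h w * u w.
  have [/andP[h1 h2] _ _ _] := expN_bounds (expb n w).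
  have /andP[hw0 hw1] := h01 w; have l0 := rate_seq_gt0 n.
  rewrite fE; apply/andP; split; first by rewrite !mulr_ge0// invr_ge0 ltW.
  by rewrite ler_wpM2l// ler_pdivrMl.
have cf w : f n w @[n --> \oo] --> h w * u w.
  under eq_cvg do rewrite fE.
  apply: cvgM; first exact: cvg_cst.
  apply: (@cvg_rate _ _ (u w ^+ 2 / 2)) => n; have l0 := rate_seq_gt0 n.
  have [/andP[h1 h2] h3 _ _] := expN_bounds (expb n w).
  rewrite distrC ger0_norm; last by rewrite subr_ge0 ler_pdivrMl.
  rewrite lerBlDr -lerBlDl ler_pdivlMl//; apply: le_trans h3.
  by rewrite le_eqVlt; apply/orP; left; apply/eqP; field.
have Ef n : \int[P]_w f n w = c * ((1 - lap (rate_seq n)) / rate_seq n).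
  rewrite /f EZ; last by apply: igrB => //; exact/Ih/rate_seq_gt0.
  rewrite EB//; last exact/Ih/rate_seq_gt0.
  by rewrite E0 Eh ?rate_seq_gt0//; ring.
have lapc n : `|(1 - lap (rate_seq n)) / rate_seq n - 2| <= (8 / 3 + C) * rate_seq n.
  have l0 := rate_seq_gt0 n.
  rewrite -(ler_pM2r l0) -[X in _ * X](gtr0_norm l0) -normrM mulrBl divfK ?gt_eqF//.
  have := lapn n; have := ln2 n; have := rate_seq_le n.
  move: (lap (rate_seq n)) (rate_seq n) l0 C0 => q l l0 K0 l8 /andP[l2 l2'].
  have Kl : C * l ^+ 3 <= C * l ^+ 2.
    by rewrite ler_wpM2l// exprSr ler_piMr// (le_trans l8)// invf_le1// ler1n.
  rewrite (_ : (8 / 3 + C) * l * l = 8 / 3 * l ^+ 2 + C * l ^+ 2); last by ring.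
  rewrite !(ler_norml).
  move=> /andP[a1 a2].
  have key (p A B L : R) : 0 <= L -> A <= B -> - A <= p - (1 - 2 * l + 8 / 3 * L) ->
    p - (1 - 2 * l + 8 / 3 * L) <= A -> - (8 / 3 * L + B) <= 1 - p - 2 * l <= 8 / 3 * L + B.
    by move=> *; apply/andP; split; lra.
  exact: key l2 Kl a1 a2.
have Efb n : \int[P]_w f n w <= c * (2 + (8 / 3 + C)).
  rewrite Ef ler_wpM2l//; have := lapc n; rewrite ler_norml => /andP[_].
  rewrite lerBlDl => /le_trans; apply; rewrite lerD2l ler_piMr ?addr_ge0//.
  by rewrite (le_trans (rate_seq_le n))// invf_le1// ler1n.
have [I1 _] := @E_fatou _ _ _ P f _ (c * (2 + (8 / 3 + C))) If (fun n w => proj1 (andP (f01 n w))) cf Efb.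
split=> //.
have f01' n w : `|f n w| <= h w * u w.
  by have /andP[f1 f2] := f01 n w; rewrite ger0_norm.
have [_ E1] := @E_dct _ _ _ P f _ _ (fun n => igr_meas (If n)) I1 f01' cf.
rewrite -(cvg_lim (@Rhausdorff R) E1); apply: cvg_lim => //.
under eq_cvg do rewrite Ef; rewrite [2 * c]mulrC.
by apply: cvgM; [exact: cvg_cst|exact: cvg_rate lapc].
Qed.

Lemma moment2 : igr P (fun w => h w * u w ^+ 2) /\ \int[P]_w (h w * u w ^+ 2) = 16 / 3 * c.
Proof.
have [I0 E0] := moment0; have [I1 E1] := moment1.
have c0 : 0 <= c by rewrite -E0; apply: Rintegral_ge0 => w _; case/andP: (h01 w).
pose f n w := 2 * (rate_seq n)^-2 * (h w * expR (- rate_seq n * u w) - h w + rate_seq n * (h w * u w)).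
have If n : igr P (f n) by apply/igrZ/igrD; [apply: igrB => //; exact/Ih/rate_seq_gt0|exact: igrZ].
have fE n w : f n w = h w * (2 * (rate_seq n)^-2 * (expR (- (rate_seq n * u w)) - 1 + rate_seq n * u w)) by rewrite /f mulNr; ring.
have f01 n w : 0 <= f n w <= h w * u w ^+ 2.
  have [_ _ h1 [h2 _ _ _ _]] := expN_bounds (expb n w).
  have /andP[hw0 hw1] := h01 w; have l0 := rate_seq_gt0 n.
  have l20 : 0 < rate_seq n ^+ 2 by rewrite exprn_gt0.
  rewrite fE; apply/andP; split; first by rewrite !mulr_ge0// invr_ge0 ltW.
  rewrite ler_wpM2l// -mulrA mulrCA ler_pdivrMl// (le_trans (ler_wpM2l _ h2))//.
  by rewrite exprMn mulrCA divff// mulr1.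
have cf w : f n w @[n --> \oo] --> h w * u w ^+ 2.
  under eq_cvg do rewrite fE.
  apply: cvgM; first exact: cvg_cst.
  apply: (@cvg_rate _ _ (u w ^+ 3 / 3)) => n; have l0 := rate_seq_gt0 n.
  have l20 : 0 < rate_seq n ^+ 2 by rewrite exprn_gt0.
  have [_ _ h1 [h2 h3 _ _ _]] := expN_bounds (expb n w).
  rewrite -mulrA mulrCA distrC ger0_norm; last first.
    by rewrite subr_ge0 ler_pdivrMl// (le_trans (ler_wpM2l _ h2))// exprMn mulrCA divff// mulr1.
  rewrite lerBlDr -lerBlDl ler_pdivlMl//; apply: le_trans (ler_wpM2l _ h3); last by [].
  by rewrite le_eqVlt; apply/orP; left; apply/eqP; field.
have Ef n : \int[P]_w f n w = c * (2 * (lap (rate_seq n) - 1 + 2 * rate_seq n) / rate_seq n ^+ 2).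
  rewrite /f EZ; last by apply: igrD; [apply: igrB => //; exact/Ih/rate_seq_gt0|exact: igrZ].
  rewrite ED; [|by apply: igrB => //; exact/Ih/rate_seq_gt0|exact: igrZ].
  rewrite EB//; last exact/Ih/rate_seq_gt0.
  by rewrite EZ// E0 E1 Eh ?rate_seq_gt0//; ring.
have lapc n : `|2 * (lap (rate_seq n) - 1 + 2 * rate_seq n) / rate_seq n ^+ 2 - 16 / 3| <= (2 * C) * rate_seq n.
  have l0 : 0 < rate_seq n ^+ 2 by rewrite exprn_gt0// rate_seq_gt0.
  rewrite -(ler_pM2r l0) -[X in _ * X](gtr0_norm l0) -normrM mulrBl divfK ?gt_eqF//.
  have := lapn n.
  rewrite (_ : 2 * C * rate_seq n * rate_seq n ^+ 2 = 2 * (C * rate_seq n ^+ 3)); last by ring.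
  rewrite !(ler_norml).
  move: (lap (rate_seq n)) (rate_seq n) => q l; move: (C * _) (l ^+ 2) => A L /andP[a1 a2].
  by apply/andP; split; lra.
have Efb n : \int[P]_w f n w <= c * (16 / 3 + 2 * C).
  rewrite Ef ler_wpM2l//; have := lapc n; rewrite ler_norml => /andP[_].
  rewrite lerBlDl => /le_trans; apply; rewrite lerD2l; apply: ler_piMr; first by apply: mulr_ge0; [|exact: C0].
  by rewrite (le_trans (rate_seq_le n))// invf_le1// ler1n.
have [I2 _] := @E_fatou _ _ _ P f _ (c * (16 / 3 + 2 * C)) If (fun n w => proj1 (andP (f01 n w))) cf Efb.
split=> //.
have f01' n w : `|f n w| <= h w * u w ^+ 2.
  by have /andP[f1 f2] := f01 n w; rewrite ger0_norm.
have [_ E2] := @E_dct _ _ _ P f _ _ (fun n => igr_meas (If n)) I2 f01' cf.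
rewrite -(cvg_lim (@Rhausdorff R) E2); apply: cvg_lim => //.
under eq_cvg do rewrite Ef; rewrite [16 / 3 * c]mulrC.
by apply: cvgM; [exact: cvg_cst|exact: cvg_rate lapc].
Qed.

(** The known moments of order 0, 1 and 2 cancel the Taylor polynomial of [lap], leaving its cubic
    remainder; as only a bound is wanted, Fatou suffices. *)
Lemma moment3 : igr P (fun w => h w * u w ^+ 3) /\ \int[P]_w (h w * u w ^+ 3) <= moment_const * c.
Proof.
have [I0 E0] := moment0; have [I1 E1] := moment1; have [I2 E2] := moment2.
have c0 : 0 <= c by rewrite -E0; apply: Rintegral_ge0 => w _; case/andP: (h01 w).
pose f n w := 6 * (rate_seq n)^-3 * (h w - rate_seq n * (h w * u w) + rate_seq n ^+ 2 / 2 * (h w * u w ^+ 2) - h w * expR (- rate_seq n * u w)).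
have Ig n : igr P (fun w => h w - rate_seq n * (h w * u w) + rate_seq n ^+ 2 / 2 * (h w * u w ^+ 2)).
  by apply: igrD; [apply: igrB => //|]; exact: igrZ.
have If n : igr P (f n) by apply/igrZ/igrB => //; exact/Ih/rate_seq_gt0.
have fE n w : f n w = h w * (6 * (rate_seq n)^-3 * (1 - rate_seq n * u w + (rate_seq n * u w) ^+ 2 / 2 - expR (- (rate_seq n * u w)))).
  by rewrite /f mulNr; ring.
have l30 n : 0 < rate_seq n ^+ 3 by rewrite exprn_gt0// rate_seq_gt0.
have f0 n w : 0 <= f n w.
  have [_ _ _ [_ _ h1 _ _]] := expN_bounds (expb n w).
  have /andP[hw0 hw1] := h01 w.
  by rewrite fE !mulr_ge0// invr_ge0 ltW.
have cf w : f n w @[n --> \oo] --> h w * u w ^+ 3.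
  under eq_cvg do rewrite fE.
  apply: cvgM; first exact: cvg_cst.
  apply: (@cvg_rate _ _ (u w ^+ 4 / 4)) => n; have l0 := rate_seq_gt0 n.
  have [_ _ _ [_ _ _ h1 h2]] := expN_bounds (expb n w).
  rewrite -mulrA mulrCA distrC ger0_norm; last first.
    rewrite subr_ge0 ler_pdivrMl// (le_trans (ler_wpM2l _ h1))//.
    by rewrite exprMn mulrCA divff// mulr1.
  rewrite lerBlDr -lerBlDl ler_pdivlMl//; apply: le_trans (ler_wpM2l _ h2); last by [].
  by rewrite le_eqVlt; apply/orP; left; apply/eqP; field.
apply: (@E_fatou _ _ _ P f _ (moment_const * c) If f0 cf) => n.
rewrite /f EZ; last by apply: igrB => //; exact/Ih/rate_seq_gt0.
rewrite EB//; last exact/Ih/rate_seq_gt0.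
rewrite ED ?EB ?EZ//; [|exact: igrZ|by apply: igrB => //; exact: igrZ|exact: igrZ].
rewrite E0 E1 E2 Eh ?rate_seq_gt0//.
have -> : 6 * (rate_seq n)^-3 * (c - rate_seq n * (2 * c) + rate_seq n ^+ 2 / 2 * (16 / 3 * c) - c * lap (rate_seq n)) =
  (6 * ((1 - 2 * rate_seq n + 8 / 3 * rate_seq n ^+ 2) - lap (rate_seq n))) / rate_seq n ^+ 3 * c by field; rewrite gt_eqF// rate_seq_gt0.
rewrite ler_wpM2r// ler_pdivrMr//.
have := lapn n; rewrite ler_norml => /andP[a1 a2].
have -> : moment_const * rate_seq n ^+ 3 = 12 * (C * rate_seq n ^+ 3) by rewrite /C; field.
have : 0 <= C * rate_seq n ^+ 3 by rewrite mulr_ge0// ltW.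
have key (q S A : R) : - A <= q - S -> 0 <= A -> 6 * (S - q) <= 12 * A by lra.
exact: key a1.
Qed.
End Moments.

(** * The Gaussian heat flow *)

Section Taylor.
Context {R : realType}.

(** Derivatives are asked on [[0, b]] only, since in the variance variable the heat flow involves a
    square root. *)
Lemma mono_itv (f f' : R -> R) (b : R) : (forall x, 0 <= x <= b -> is_derive x (1 : R) f (f' x)) ->
  f 0 = 0 -> (forall x, 0 <= x <= b -> 0 <= f' x) -> forall x, 0 <= x <= b -> 0 <= f x.
Proof.
move=> df f0 f'0 x /andP[]; rewrite le_eqVlt => /predU1P[<- _|x0 xb]; first by rewrite f0.
have I y : 0 <= y <= x -> 0 <= y <= b by move=> /andP[-> yx]; exact: le_trans xb.
have cf : {within `[0, x], continuous f}.
  apply: derivable_within_continuous => y; rewrite in_itv/= => yx.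
  by have [] := df y (I y yx).
have [|c] := @MVT R f f' 0 x x0 _ cf.
  by move=> y; rewrite in_itv/= => /andP[y0 yx]; apply: df; apply: I; rewrite !ltW.
rewrite in_itv/= f0 !subr0 => /andP[c0 cx] ->; apply: mulr_ge0; last exact: ltW.
by apply: f'0; apply: I; rewrite !ltW.
Qed.

Lemma taylor2_half (f f1 f2 : R -> R) (b K : R) :
  (forall x, 0 <= x <= b -> is_derive x (1 : R) f (f1 x)) ->
  (forall x, 0 <= x <= b -> is_derive x (1 : R) f1 (f2 x)) ->
  (forall x, 0 <= x <= b -> f2 x <= K) -> forall x, 0 <= x <= b ->
  f x - f 0 - f1 0 * x <= K / 2 * x ^+ 2.
Proof.
move=> d1 d2 fK.
have g1 (y : R) : 0 <= y <= b -> 0 <= K * y ^+ 1 + (- 1) * f1 y + f1 0.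
  apply: (@mono_itv (fun y => K * y ^+ 1 + (- 1) * f1 y + f1 0) (fun y => K - f2 y)).
  - move=> x xb; apply: is_derive_eq (dD (dD (dmon K 1 x) (dZ (- 1) (d2 x xb))) (dcst (f1 0) x)) _.
    by rewrite /= expr0; ring.
  - by ring.
  - by move=> x /fK; rewrite subr_ge0.
have g2 (y : R) : 0 <= y <= b -> 0 <= K / 2 * y ^+ 2 + (- 1) * f y + f1 0 * y ^+ 1 + f 0.
  apply: (@mono_itv (fun y => K / 2 * y ^+ 2 + (- 1) * f y + f1 0 * y ^+ 1 + f 0) (fun y => K * y ^+ 1 + (- 1) * f1 y + f1 0)).
  - move=> x xb; apply: is_derive_eq (dD (dD (dD (dmon _ 2 x) (dZ (- 1) (d1 x xb))) (dmon _ 1 x)) (dcst (f 0) x)) _.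
    by rewrite /= expr0; field.
  - by ring.
  - exact: g1.
by move=> x /g2; rewrite expr1; lra.
Qed.

Lemma taylor2 (f f1 f2 : R -> R) (b K : R) :
  (forall x, 0 <= x <= b -> is_derive x (1 : R) f (f1 x)) ->
  (forall x, 0 <= x <= b -> is_derive x (1 : R) f1 (f2 x)) ->
  (forall x, 0 <= x <= b -> `|f2 x| <= K) -> forall x, 0 <= x <= b ->
  `|f x - f 0 - f1 0 * x| <= K / 2 * x ^+ 2.
Proof.
move=> d1 d2 fK x xb.
have h1 := taylor2_half d1 d2 (fun y yb => le_trans (ler_norm _) (fK y yb)) xb.
have fK' y : 0 <= y <= b -> -1 * f2 y <= K.
  by move=> yb; rewrite mulN1r (le_trans (ler_norm _))// normrN; exact: fK.
have h2 := @taylor2_half (fun y => (- 1) * f y) (fun y => (- 1) * f1 y) (fun y => (- 1) * f2 y) b K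
  (fun y yb => dZ (- 1) (d1 y yb)) (fun y yb => dZ (- 1) (d2 y yb)) fK' x xb.
by rewrite ler_norml; apply/andP; split; lra.
Qed.

Lemma taylor3_half (f f1 f2 f3 : R -> R) (K : R) :
  (forall x, is_derive x (1 : R) f (f1 x)) -> (forall x, is_derive x (1 : R) f1 (f2 x)) ->
  (forall x, is_derive x (1 : R) f2 (f3 x)) ->
  (forall x, f3 x <= K) -> forall x, 0 <= x ->
  f x - f 0 - f1 0 * x - f2 0 / 2 * x ^+ 2 <= K / 6 * x ^+ 3.
Proof.
move=> d1 d2 d3 fK.
have g1 (b y : R) : 0 <= y <= b -> 0 <= K * y ^+ 1 + (- 1) * f2 y + f2 0.
  apply: (@mono_itv (fun y => K * y ^+ 1 + (- 1) * f2 y + f2 0) (fun y => K - f3 y)).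
  - move=> x xb; apply: is_derive_eq (dD (dD (dmon K 1 x) (dZ (- 1) (d3 x))) (dcst (f2 0) x)) _.
    by rewrite /= expr0; ring.
  - by ring.
  - by move=> x _; rewrite subr_ge0.
have g2 (b y : R) : 0 <= y <= b -> 0 <= K / 2 * y ^+ 2 + (- 1) * f1 y + f2 0 * y ^+ 1 + f1 0.
  apply: (@mono_itv (fun y => K / 2 * y ^+ 2 + (- 1) * f1 y + f2 0 * y ^+ 1 + f1 0) (fun y => K * y ^+ 1 + (- 1) * f2 y + f2 0)) => //.
  - move=> x xb; apply: is_derive_eq (dD (dD (dD (dmon _ 2 x) (dZ (- 1) (d2 x))) (dmon _ 1 x)) (dcst (f1 0) x)) _.
    by rewrite /= expr0; field.
  - by ring.
  - exact: g1.
have g3 (b y : R) : 0 <= y <= b -> 0 <= K / 6 * y ^+ 3 + (- 1) * f y + f2 0 / 2 * y ^+ 2 + f1 0 * y ^+ 1 + f 0.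
  apply: (@mono_itv (fun y => K / 6 * y ^+ 3 + (- 1) * f y + f2 0 / 2 * y ^+ 2 + f1 0 * y ^+ 1 + f 0) (fun y => K / 2 * y ^+ 2 + (- 1) * f1 y + f2 0 * y ^+ 1 + f1 0)) => //.
  - move=> x xb; apply: is_derive_eq (dD (dD (dD (dD (dmon _ 3 x) (dZ (- 1) (d1 x))) (dmon _ 2 x)) (dmon _ 1 x)) (dcst (f 0) x)) _.
    by rewrite /= expr0; field.
  - by ring.
  - exact: g2.
move=> x x0; have := g3 x x; rewrite x0 lexx => /(_ isT); rewrite expr1.
by lra.
Qed.

Lemma taylor3 (f f1 f2 f3 : R -> R) (K : R) :
  (forall x, is_derive x (1 : R) f (f1 x)) -> (forall x, is_derive x (1 : R) f1 (f2 x)) ->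
  (forall x, is_derive x (1 : R) f2 (f3 x)) ->
  (forall x, `|f3 x| <= K) -> forall x,
  `|f x - f 0 - f1 0 * x - f2 0 / 2 * x ^+ 2| <= K / 6 * `|x| ^+ 3.
Proof.
have pos (g g1 g2 g3 : R -> R) : 
  (forall x, is_derive x (1 : R) g (g1 x)) -> (forall x, is_derive x (1 : R) g1 (g2 x)) ->
  (forall x, is_derive x (1 : R) g2 (g3 x)) ->
  (forall x, `|g3 x| <= K) -> forall x, 0 <= x ->
  `|g x - g 0 - g1 0 * x - g2 0 / 2 * x ^+ 2| <= K / 6 * x ^+ 3.
  move=> d1 d2 d3 fK x x0.
  have h1 := taylor3_half d1 d2 d3 (fun y => le_trans (ler_norm _) (fK y)) x0.
  have fK' y : -1 * g3 y <= K by rewrite mulN1r (le_trans (ler_norm _))// normrN; exact: fK.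
  have h2 := taylor3_half (fun y => dZ (- 1) (d1 y)) (fun y => dZ (- 1) (d2 y)) (fun y => dZ (- 1) (d3 y)) fK' x0.
  by rewrite ler_norml; apply/andP; split; lra.
move=> d1 d2 d3 fK x; have [x0|x0] := leP 0 x.
  by rewrite (ger0_norm x0); exact: (pos f f1 f2 f3).
(* Negative arguments are reduced to positive ones by reflection, with alternating signs of the
   derivatives. *)
have dN (g g' : R -> R) (c : R) : (forall x, is_derive x (1 : R) g (g' x)) ->
    forall x, is_derive x (1 : R) (fun y => c * g (- y)) (- c * g' (- x)).
  move=> dg y; have := dZ c (@dcomp _ g (fun z => (- 1) * z + 0) y _ _ (dg _) (daff (- 1) 0 y)).
  under eq_fun do rewrite addr0 mulN1r.
  by rewrite addr0 mulN1r => H; apply: is_derive_eq H _; ring.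
have := pos _ _ _ _ (dN f f1 1 d1) (dN f1 f2 (- 1) d2) _ _ (- x).
rewrite !opprK !oppr0 (ltr0_norm x0) => /(_ (fun x => (- 1) * f3 (- x))) H.
have b3 y : `|-1 * f3 (- y)| <= K by rewrite mulN1r normrN.
have x0' : 0 <= - x by rewrite oppr_ge0 ltW.
have := H (dN f2 f3 1 d3) b3 x0'; rewrite !mul1r sqrrN.
by rewrite (_ : f x - f 0 - -1 * f1 0 * - x = f x - f 0 - f1 0 * x)//; ring.
Qed.
End Taylor.

Section Gauss.
Context {R : realType}.
Local Notation mu := (@lebesgue_measure R).
Local Notation Q := (@normal_prob R 0 1).

Definition phi (z : R) : R := normal_pdf 0 1 z.
Definition Phi (z : R) : R := fine (Q `]-oo, z]%classic).

Lemma phiE (z : R) : phi z = normal_peak 1 * expR (- (z ^+ 2 / 2)).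
Proof.
by rewrite /phi normal_pdfE ?oner_eq0//= /normal_fun subr0 expr1n mulNr.
Qed.

Lemma phi_ge0 z : 0 <= phi z. Proof. exact: normal_pdf_ge0. Qed.

Lemma peak_le1 : 0 <= @normal_peak R 1 <= 1.
Proof.
rewrite normal_peak_ge0/= /normal_peak invf_le1//.
  rewrite -[leLHS]sqrtr1 ler_sqrt// expr1n mul1r -mulr_natl.
    by have := @pi_ge2 R; lra.
  by rewrite mulr_ge0// pi_ge0.
by rewrite sqrtr_gt0 expr1n mul1r mulrn_wgt0// pi_gt0.
Qed.

Lemma phi_le1 z : phi z <= 1.
Proof.
have /andP[p0 p1] := peak_le1.
by rewrite phiE mulr_ile1 ?expR_ge0// -expR0 ler_expR oppr_le0 divr_ge0// sqr_ge0.
Qed.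

(** Squaring [1 + z^2 / 4 <= exp (z^2 / 4)] gives a quartic decay, enough for the polynomial factors
    in [phi_poly]. *)
Lemma phi_bound z : phi z * (1 + z ^+ 2 / 4) ^+ 2 <= 1.
Proof.
have /andP[p0 p1] := peak_le1.
have e0 := expR_gt0 (z ^+ 2 / 2).
have h : (1 + z ^+ 2 / 4) ^+ 2 <= expR (z ^+ 2 / 2).
  rewrite (_ : z ^+ 2 / 2 = z ^+ 2 / 4 + z ^+ 2 / 4); last by field.
  rewrite expRD expr2 ler_pM// ?expR_ge1Dx//; have := sqr_ge0 z; lra.
rewrite phiE expRN -mulrA mulr_ile1//; last by rewrite ler_pdivrMl ?mulr1.
by rewrite mulr_ge0 ?invr_ge0 ?sqr_ge0// ltW.
Qed.

(** Up to sign and powers of the variance, these are the second and third space derivatives and the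
    second time derivative of the heat flow. *)
Lemma phi_poly z : [/\ `|z * phi z| <= 8, `|(z ^+ 2 - 1) * phi z| <= 8 & `|(3 * z - z ^+ 3) * phi z| <= 32].
Proof.
have p := phi_bound z; have p0 := phi_ge0 z; have p1 := phi_le1 z.
have zz := sqr_ge0 z.
rewrite !normrM (ger0_norm p0).
have nz : `|z| ^+ 2 = z ^+ 2 by rewrite -normrX ger0_norm.
have n3 : `|3 * z - z ^+ 3| <= 3 * `|z| + `|z| ^+ 3.
  by rewrite (le_trans (ler_normB _ _))// normrM normrX (@ger0_norm _ 3).
have n2 : `|z ^+ 2 - 1| <= z ^+ 2 + 1 by rewrite (le_trans (ler_normB _ _))// normr1 ger0_norm.
move: n3 (normr_ge0 z) nz; move: (`|z|) => y n3 y0 yz.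
have b k : k <= 8 * (1 + z ^+ 2 / 4) ^+ 2 -> k * phi z <= 8.
  move=> h; apply: le_trans (ler_wpM2r p0 h) _; rewrite mulrAC -mulrA; lra.
have b4 k : k <= 32 * (1 + z ^+ 2 / 4) ^+ 2 -> k * phi z <= 32.
  move=> h; apply: le_trans (ler_wpM2r p0 h) _; rewrite mulrAC -mulrA; lra.
rewrite -yz in b b4 n2 *; split.
- by apply: b; nra.
- by apply: b; apply: le_trans n2 _; nra.
- apply: b4; apply: le_trans n3 _.
  have hy : y <= (1 + y ^+ 2) / 2.
    have := sqr_ge0 (y - 1); rewrite (_ : (y - 1) ^+ 2 = y ^+ 2 - 2 * y + 1); last by ring.
    lra.
  have h3 : y * y ^+ 2 <= (1 + y ^+ 2) / 2 * y ^+ 2 by rewrite ler_wpM2r// sqr_ge0.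
  rewrite (_ : 32 * (1 + y ^+ 2 / 4) ^+ 2 = 32 + 16 * y ^+ 2 + 2 * (y ^+ 2 * y ^+ 2)); last by field.
  rewrite exprS; have := sqr_ge0 y; move: (y ^+ 2) hy h3 => u hy h3 u0.
  have := mulr_ge0 u0 u0; rewrite (_ : (1 + u) / 2 * u = u / 2 + u * u / 2) in h3; last by field.
  move: (u * u) (y * u) h3 => U V; lra.
Qed.

Lemma Phi01 z : 0 <= Phi z <= 1.
Proof.
rewrite fine_ge0//= -lee_fin fineK ?fin_num_measure//.
exact: probability_le1.
Qed.

Lemma Phi_mono x y : x <= y -> Phi x <= Phi y.
Proof.
move=> xy; apply: fine_le; rewrite ?fin_num_measure//.
by apply: le_measure; rewrite ?inE//; apply: subset_itvl; rewrite bnd_simp.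
Qed.

Lemma d_Phi z : is_derive z (1 : R) Phi (phi z).
Proof.
have cphi : continuous (@phi) by apply: continuous_normal_pdf; rewrite oner_eq0.
have zz : z < z + 1 by rewrite ltrDl.
have Iz : mu.-integrable [set` Interval -oo%O (BRight (z + 1))] (EFin \o phi).
  by apply: integrableS (integrable_normal_pdf 0 1).
have [D1 D2] := @continuous_FTC1 R phi -oo%O z (z + 1) zz Iz (ltNyr z) (cphi z).
have H : is_derive z (1 : R) (fun x0 : R => \int[mu]_(t in [set` Interval -oo%O (BRight x0)]) phi t) (phi z).
  by apply: DeriveDef; [exact: D1|rewrite -derive1E; exact: D2].
exact: H.
Qed.

Lemma Phi_continuous : continuous Phi.
Proof. exact: d_continuous d_Phi. Qed.

Let PQ : probability _ R := Q.

Lemma Phi_top e : 0 < e -> exists n : nat, 1 - e <= Phi n%:R.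
Proof.
move=> e0.
have mf (n : nat) : measurable_fun setT (\1_(`]-oo, n%:R]%classic) : measurableTypeR R -> R).
  exact: measurable_indic.
have b1 (n : nat) (w : R) : `|\1_(`]-oo, n%:R]%classic) w : R| <= 1.
  by rewrite indicE; case: (_ \in _); rewrite ?normr1 ?normr0.
have cv (w : R) : (fun n : nat => \1_(`]-oo, n%:R]%classic) w : R) @ \oo --> (1 : R).
  apply: cvg_near_cst; exists (Num.truncn w).+1 => // n /= wn.
  rewrite indicE mem_set//= in_itv/= ltW// (lt_le_trans (truncnS_gt w))// ler_nat//.
have [_] := @E_bct _ _ _ PQ (fun n => \1_(`]-oo, n%:R]%classic)) (fun=> 1) 1 mf b1 cv.
rewrite E_cst => /cvgrPdist_le /(_ e e0) [n _ /(_ n (leqnn n))] /=.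
rewrite E_ind// -/(Phi n%:R) ler_norml => /andP[_ h]; exists n; lra.
Qed.

Lemma Phi_bot e : 0 < e -> exists n : nat, Phi (- n%:R) <= e.
Proof.
move=> e0.
have mf (n : nat) : measurable_fun setT (\1_(`]-oo, - n%:R]%classic) : measurableTypeR R -> R).
  exact: measurable_indic.
have b1 (n : nat) (w : R) : `|\1_(`]-oo, - n%:R]%classic) w : R| <= 1.
  by rewrite indicE; case: (_ \in _); rewrite ?normr1 ?normr0.
have cv (w : R) : (fun n : nat => \1_(`]-oo, - n%:R]%classic) w : R) @ \oo --> (0 : R).
  apply: cvg_near_cst; exists (Num.truncn (- w)).+1 => // n /= wn.
  rewrite indicE memNset//= in_itv/=; apply/negP; rewrite -ltNge ltrNl.
  by rewrite (lt_le_trans (truncnS_gt _))// ler_nat.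
have [_] := @E_bct _ _ _ PQ (fun n => \1_(`]-oo, - n%:R]%classic)) (fun=> 0) 1 mf b1 cv.
rewrite E_cst => /cvgrPdist_le /(_ e e0) [n _ /(_ n (leqnn n))] /=.
rewrite E_ind// -/(Phi _) ler_norml => /andP[h _]; exists n; lra.
Qed.

Definition heat (b v y : R) : R := Phi ((b - y) / Num.sqrt v).
(** [heat1] and [heat2] are the first two derivatives of [heat] in [y]; the derivative in [v] is
    [heat2 / 2], the heat equation. *)
Definition heat1 (b v y : R) : R := - (phi ((b - y) / Num.sqrt v) / Num.sqrt v).
Definition heat2 (b v y : R) : R :=
  - ((b - y) / Num.sqrt v * phi ((b - y) / Num.sqrt v) / v).

Lemma d_phi z : is_derive z (1 : R) phi (- (z * phi z)).
Proof.
have := dZ (normal_peak 1) (@dcomp _ expR (fun z => (- 2^-1) * z ^+ 2) z _ _ (is_derive_expR _) (dmon _ 2 z)).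
rewrite (_ : (fun y => _) = phi); last first.
  by apply/funext => y; rewrite phiE; congr (_ * expR _); field.
move=> H; apply: is_derive_eq H _; rewrite phiE /=.
by rewrite (_ : - 2^-1 * z ^+ 2 = - (z ^+ 2 / 2)); [move: (expR _) (normal_peak _) => E p; field|field].
Qed.

Section HeatY.
Variables (b v y : R).
Hypothesis v0 : 0 < v.
Let s := Num.sqrt v.
Let s0 : 0 < s. Proof. by rewrite sqrtr_gt0. Qed.
Let sv : s ^+ 2 = v. Proof. by rewrite sqr_sqrtr// ltW. Qed.

(** The third derivative is at most [8 / s ^+ 3], and [8 / 6 <= 2]. *)
Lemma heat_space x : `|heat b v (y + x) - heat b v y - heat1 b v y * x - heat2 b v y / 2 * x ^+ 2|
  <= 2 * `|x| ^+ 3 / s ^+ 3.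
Proof.
pose z x := - s^-1 * x + (b - y) / s.
have zE x' : (b - (y + x')) / s = z x' by rewrite /z; field; rewrite gt_eqF.
have dz x' : is_derive x' (1 : R) z (- s^-1) by exact: daff.
have z0 : (b - y) / s = z 0 by rewrite /z mulr0 add0r.
pose f x := Phi (z x); pose f1 x := - s^-1 * phi (z x).
pose f2 x := - s^-2 * (z x * phi (z x)); pose f3 x := s^-3 * ((1 - z x ^+ 2) * phi (z x)).
have d1 x' : is_derive x' (1 : R) f (f1 x').
  by apply: is_derive_eq (@dcomp _ Phi z x' _ _ (d_Phi _) (dz x')) _; rewrite mulrC.
have dp x' : is_derive x' (1 : R) (fun x => phi (z x)) (s^-1 * (z x' * phi (z x'))).
  by apply: is_derive_eq (@dcomp _ phi z x' _ _ (d_phi _) (dz x')) _; rewrite mulrNN mulrC.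
have d2 x' : is_derive x' (1 : R) f1 (f2 x').
  by apply: is_derive_eq (dZ (- s^-1) (dp x')) _; rewrite /f2; field; rewrite gt_eqF.
have d3 x' : is_derive x' (1 : R) f2 (f3 x').
  by apply: is_derive_eq (dZ (- s^-2) (dM (dz x') (dp x'))) _; rewrite /f3; field; rewrite gt_eqF.
have s3 : 0 < s ^- 3 by rewrite invr_gt0 exprn_gt0.
have b3 x' : `|f3 x'| <= 8 * s ^- 3.
  rewrite /f3 normrM (gtr0_norm s3) mulrC ler_pM2r//.
  by have [_ h _] := phi_poly (z x'); rewrite -opprB mulNr normrN.
have := taylor3 d1 d2 d3 b3 x.
have -> : f x = heat b v (y + x) by rewrite /heat -/s zE.
have -> : f 0 = heat b v y by rewrite /heat -/s z0.
have -> : f1 0 = heat1 b v y by rewrite /heat1 -/s z0 /f1; ring.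
have -> : f2 0 = heat2 b v y by rewrite /heat2 -/s z0 /f2 -sv; field; rewrite gt_eqF.
move=> /le_trans; apply.
rewrite [leRHS]mulrAC ler_wpM2r ?exprn_ge0//.
by rewrite mulrAC ler_wpM2r ?(ltW s3)//; lra.
Qed.

Lemma heat01 : 0 <= heat b v y <= 1. Proof. exact: Phi01. Qed.

Lemma heat1_bound : `|heat1 b v y| <= s^-1.
Proof.
rewrite normrN normrM normfV (gtr0_norm s0) ger0_norm ?phi_ge0//.
by rewrite ler_pdivrMr// mulVf ?gt_eqF// phi_le1.
Qed.

Lemma heat2_bound : `|heat2 b v y| <= 8 / v.
Proof.
rewrite normrN normrM normfV (gtr0_norm v0) ler_wpM2r ?invr_ge0 ?(ltW v0)//.
by have [] := phi_poly ((b - y) / s).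
Qed.

(** Taylor's formula of order two in the variance: the second derivative is
    [(3 z - z^3) phi z / (4 (v + x)^2)], at most [8 / v^2] by [phi_poly]. *)
Lemma heat_time t : 0 <= t ->
  `|heat b (v + t) y - heat b v y - t / 2 * heat2 b v y| <= 4 * t ^+ 2 / v ^+ 2.
Proof.
move=> t0; pose c := b - y.
pose sq x := Num.sqrt (v + x); pose z x := c / sq x.
have sq0 x : 0 <= x -> 0 < sq x by move=> x0; rewrite sqrtr_gt0 ltr_wpDr.
have sqE x : 0 <= x -> sq x ^+ 2 = v + x by move=> x0; rewrite sqr_sqrtr// addr_ge0// ltW.
have dsq (x : R) : 0 <= x -> is_derive x (1 : R) sq (2 * sq x)^-1.
  move=> x0; have vx : 0 < 1 * x + v by rewrite mul1r ltr_wpDl.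
  have := @dcomp _ (@Num.sqrt R) (fun x => 1 * x + v) x _ _ (is_derive1_sqrt vx) (daff 1 v x).
  rewrite (_ : (fun y => _) = sq); last by apply/funext => y'; rewrite /sq mul1r addrC.
  by rewrite mul1r addrC mulr1.
have dz (x : R) : 0 <= x -> is_derive x (1 : R) z (- z x / (2 * (v + x))).
  move=> x0; have := @is_deriveV _ sq x _ (1 : R) (lt0r_neq0 (sq0 x x0)) (dsq x x0).
  move=> H; apply: is_derive_eq (dZ c H) _; rewrite /GRing.scale/= /z -(sqE x x0).
  by field; rewrite gt_eqF ?sq0.
pose f x := Phi (z x); pose f1 x := - (z x * phi (z x)) / (2 * (v + x)).
pose f2 x := (3 * z x - z x ^+ 3) * phi (z x) / (4 * (v + x) ^+ 2).
have d1 (x : R) : 0 <= x <= t -> is_derive x (1 : R) f (f1 x).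
  move=> /andP[x0 _]; apply: is_derive_eq (@dcomp _ Phi z x _ _ (d_Phi _) (dz x x0)) _.
  by rewrite /f1 !mulNr mulrN mulrA [phi _ * _]mulrC.
have vx0 x : 0 <= x -> v + x != 0 by move=> x0; rewrite gt_eqF// ltr_wpDr.
have d2 (x : R) : 0 <= x <= t -> is_derive x (1 : R) f1 (f2 x).
  move=> /andP[x0 _].
  have h1 := @dcomp _ phi z x _ _ (d_phi _) (dz x x0).
  have h2 := @is_deriveV _ (fun x => 2 * x + 2 * v) x _ (1 : R) _ (daff 2 (2 * v) x).
  have nz : 2 * x + 2 * v != 0 by rewrite -mulrDr mulf_neq0// addrC vx0.
  have := dM (dZ (- 1) (dM (dz x x0) h1)) (h2 nz).
  rewrite (_ : (fun y => _) = f1); last first.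
    by apply/funext => y'; rewrite /f1 mulN1r -mulrDr [v + y']addrC.
  move=> H; apply: is_derive_eq H _; rewrite /GRing.scale/= /f2.
  have := vx0 x x0; move: (phi (z x)) (z x) nz => p q nz vx.
  by field; rewrite nz vx.
have b2 x : 0 <= x <= t -> `|f2 x| <= 8 / v ^+ 2.
  move=> /andP[x0 _]; have [_ _ h] := phi_poly (z x).
  have v2 : 0 < v ^+ 2 by rewrite exprn_gt0.
  have vx2 : v ^+ 2 <= (v + x) ^+ 2.
    by rewrite lerXn2r ?nnegrE ?lerDl// ?addr_ge0// ltW.
  have vx4 : 0 < 4 * (v + x) ^+ 2 by rewrite mulr_gt0// (lt_le_trans v2).
  rewrite /f2 normrM normfV (gtr0_norm vx4) ler_pdivrMr// (le_trans h)//.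
  rewrite mulrACA -mulrA; have -> : 32 = 8 * 4 * 1 :> R by ring.
  by rewrite -!mulrA ler_wpM2l// ler_wpM2l// mulrC ler_pdivlMr// mul1r.
have := taylor2 d1 d2 b2 (x := t); rewrite t0 lexx => /(_ isT).
have -> : f t = heat b (v + t) y by [].
have -> : f 0 = heat b v y by rewrite /f /z /sq addr0.
have -> : f1 0 * t = t / 2 * heat2 b v y.
  rewrite /f1 /z /sq addr0 /heat2 -/c -/s; move: (_ * phi _) => q.
  by field; rewrite gt_eqF.
move=> /le_trans; apply; rewrite (_ : 8 / v ^+ 2 / 2 * t ^+ 2 = 4 * t ^+ 2 / v ^+ 2)//.
by field; rewrite gt_eqF.
Qed.
End HeatY.

Lemma heat_continuous b v : continuous (heat b v).
Proof.
move=> y; apply: (cvg_comp (fun y => (b - y) / Num.sqrt v) Phi); last exact: Phi_continuous.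
by apply: cvgM; [apply: cvgB; [exact: cvg_cst|exact: cvg_id]|exact: cvg_cst].
Qed.

Lemma phi_continuous : continuous phi.
Proof. by apply: continuous_normal_pdf; rewrite oner_eq0. Qed.

Lemma heat1_continuous b v : continuous (heat1 b v).
Proof.
move=> y; apply: cvgN; apply: cvgM; last exact: cvg_cst.
apply: (cvg_comp (fun y => (b - y) / Num.sqrt v) phi); last exact: phi_continuous.
by apply: cvgM; [apply: cvgB; [exact: cvg_cst|exact: cvg_id]|exact: cvg_cst].
Qed.

Lemma heat2_continuous b v : continuous (heat2 b v).
Proof.
move=> y; apply: cvgN; apply: cvgM; last exact: cvg_cst.
have c1 : (b - y') / Num.sqrt v @[y' --> y] --> (b - y) / Num.sqrt v.
  by apply: cvgM; [apply: cvgB; [exact: cvg_cst|exact: cvg_id]|exact: cvg_cst].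
apply: cvgM => //.
by apply: (cvg_comp (fun y => (b - y) / Num.sqrt v) phi c1); exact: phi_continuous.
Qed.
End Gauss.

(** * The one-cycle replacement estimate *)

Section OneStep.
Context {R : realType} {d : measure_display} {T : measurableType d}.
Variable P : probability T R.
Variables (N : nat) (i0 : 'I_N) (X : 'I_N -> R -> T -> R).
Hypothesis hX : spider_BM P X.

Lemma stopping_measurable a : stopping X a -> measurable_fun setT (fun w => fine (a w)).
Proof.
move=> [_ sa]; apply: (measurableT_comp (fine_measurable _)) => //.
move=> mD; apply: (measurability _ (ErealGenInftyO.measurableE R)) => //.
move=> _ [_ [x ->] <-]; rewrite setTI.
rewrite (_ : _ @^-1` _ = [set w | (a w < x%:E)%E]); last first.
  by apply/funext => w /=; rewrite in_itv.
have mX i t : measurable_fun setT (X i t) by case: hX.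
exact: (Ft_measurable mX (sa x)).
Qed.

(** The weight is now bounded on the whole line, so the cut-off of [cond_weight] is removed by
    dominated convergence. *)
Lemma cond_int a (Z : T -> R) (h : R -> R) (K : R) A :
  stopping X a -> igr P Z -> continuous h -> (forall x, `|h x| <= K) ->
  (forall B, past X a B -> \int[P]_w (\1_B w * Z w) = 0) -> past X a A ->
  igr P (fun w => \1_A w * (\1_[set w | (a w < +oo)%E] w * h (fine (a w)) * Z w)) /\
  \int[P]_w (\1_A w * (\1_[set w | (a w < +oo)%E] w * h (fine (a w)) * Z w)) = 0.
Proof.
move=> sa IZ ch hK HZ pA.
pose G (m : nat) w := \1_A w * ((if (a w < m%:R%:E)%E then h (fine (a w)) else 0) * Z w).
have IG m : igr P (G m) /\ \int[P]_w G m w = 0.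
  by apply: (@cond_weight _ _ _ P N X hX a a Z h m K A).
have K0 : 0 <= K by exact: le_trans (hK 0).
have IK : igr P (fun w => K * `|Z w|) by apply: igrZ; have := integrable_abse IZ.
have b1 m w : `|G m w| <= K * `|Z w|.
  rewrite /G !normrM mulrA ler_wpM2r// -[leRHS]mul1r ler_pM//.
    by rewrite indicE; case: (_ \in _); rewrite ?normr1 ?normr0.
  by case: ifPn => _; rewrite ?normr0.
have cv w : G m w @[m --> \oo] --> \1_A w * (\1_[set w | (a w < +oo)%E] w * h (fine (a w)) * Z w).
  apply: cvgM; first exact: cvg_cst.
  apply: cvgM; last exact: cvg_cst.
  have := sa.1 w; rewrite indicE; case E : (a w) => [r| |]// r0.
    rewrite mem_set/= ?E ?ltry// mul1r.
    apply: cvg_near_cst; exists (Num.truncn r).+1 => // m /= rm; rewrite lte_fin ifT//.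
    by rewrite (lt_le_trans (truncnS_gt r))// ler_nat.
  by rewrite memNset/= ?E// mul0r; exact: cvg_cst.
have [I Ec] := @E_dct _ _ _ P G _ _ (fun m => igr_meas (IG m).1) IK b1 cv.
split=> //; rewrite -(cvg_lim (@Rhausdorff R) Ec).
by under eq_fun do rewrite (IG _).2; rewrite lim_cst.
Qed.

Variable a : T -> \bar R.
Hypothesis sa : stopping X a.
Hypothesis a0 : at0 X a.
Let s := sig_of X (rho_of X a).

Definition Ei (i : 'I_N) : set T := EL X a i `&` [set w | (s w < +oo)%E].
(** The default 0 keeps [dur] nonnegative everywhere; in the moment computations it is accompanied
    by the indicator of [Ei], on which the return time is finite. *)
Definition dur (w : T) : R := if (s w < +oo)%E then fine (s w) - fine (a w) else 0.
Definition mass (B : set T) : R := fine (P (B `&` [set w | (a w < +oo)%E])).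

Let ss : stopping X s. Proof. exact: (stopping_sig hX sa a0). Qed.
Let as_ w : (a w <= s w)%E.
Proof. exact: (le_trans (rho_ge sa w) (sig_ge hX sa a0 w)). Qed.

Lemma dur_ge0 w : 0 <= dur w.
Proof.
rewrite /dur; case: ifPn => // soo; rewrite subr_ge0 fine_le//.
  by rewrite ge0_fin_numE ?sa.1// (le_lt_trans (as_ w)).
by rewrite ge0_fin_numE ?ss.1.
Qed.

Lemma Ei_past i : past X s (Ei i).
Proof.
apply: pastI; last exact: (past_fin hX ss).
by apply: past_mono (EL_past hX sa a0 i) => //; exact: (sig_ge hX sa a0).
Qed.

Lemma dur_law i B l : past X a B -> 0 < l ->
  igr P (fun w => \1_(B `&` Ei i) w * expR (- l * dur w)) /\
  \int[P]_w (\1_(B `&` Ei i) w * expR (- l * dur w)) = mass B / N%:R * lap l.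
Proof.
move=> pB l0; have [I E] := cycle_law i0 hX sa a0 i l0 pB.
have Q w : \1_(B `&` EL X a i) w * disc l (a w) (s w) = \1_(B `&` Ei i) w * expR (- l * dur w).
  rewrite /disc /dur /Ei setIA [in RHS]indicI /=; case: ifPn => soo.
    by rewrite [\1_[set w | _] w]indicE mem_set// mulr1.
  by rewrite [\1_[set w | _] w]indicE memNset ?mulr0 ?mul0r//; exact/negP.
rewrite -/s in I E; split; first by move: I; congr igr; apply/funext => w; exact: Q.
by rewrite -(eqE _ Q) E.
Qed.

Lemma past_meas B : past X a B -> measurable B. Proof. by case. Qed.

Lemma meas_BEi i B : past X a B -> measurable (B `&` Ei i).
Proof. by move=> [mB _]; apply: measurableI => //; case: (Ei_past i). Qed.

Let ind01 (B : set T) w : 0 <= (\1_B w : R) <= 1.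
Proof. by rewrite indicE; case: (_ \in _); rewrite lexx ler01. Qed.

Section Mom.
Variables (i : 'I_N) (B : set T).
Hypothesis pB : past X a B.
Let h01 w := ind01 (B `&` Ei i) w.
Let Ih l (l0 : 0 < l) := (dur_law i pB l0).1.
Let Eh l (l0 : 0 < l) := (dur_law i pB l0).2.

Definition dur_moment0 := moment0 h01 dur_ge0 Ih Eh.
Definition dur_moment1 := moment1 h01 dur_ge0 Ih Eh.
Definition dur_moment2 := moment2 h01 dur_ge0 Ih Eh.
Definition dur_moment3 := moment3 h01 dur_ge0 Ih Eh.
End Mom.

Lemma mass_Ei i B : past X a B -> fine (P (B `&` Ei i)) = mass B / N%:R.
Proof. by move=> pB; rewrite -(dur_moment0 i pB).2 E_ind//; exact: meas_BEi. Qed.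

(** This and the next two lemmas express conditional probability [1 / N], mean 2 and variance 4/3 as
    orthogonality to the past, the form in which [cond_int] multiplies them by functions of the
    starting time. *)
Lemma leg_centred i : igr P (fun w => \1_(Ei i) w - N%:R^-1 * \1_[set w | (a w < +oo)%E] w) /\
  forall B, past X a B -> \int[P]_w (\1_B w * (\1_(Ei i) w - N%:R^-1 * \1_[set w | (a w < +oo)%E] w)) = 0.
Proof.
have mE : measurable (Ei i) by case: (Ei_past i).
have mf : measurable [set w | (a w < +oo)%E] by case: (past_fin hX sa).
split; first by apply: igrB; [|apply: igrZ]; exact/bmf_igr/bmf_ind.
move=> B pB; have mB := past_meas pB.
rewrite (eqE _ (g := fun w => \1_(B `&` Ei i) w - N%:R^-1 * \1_(B `&` [set w | (a w < +oo)%E]) w)).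
  rewrite EB; [|exact/bmf_igr/bmf_ind/meas_BEi|exact/igrZ/bmf_igr/bmf_ind/measurableI].
  rewrite (dur_moment0 i pB).2 EZ; last exact/bmf_igr/bmf_ind/measurableI.
  rewrite E_ind; last exact: measurableI.
  have key (x y : R) : x / y - y^-1 * x = 0 by rewrite mulrC subrr.
  exact: key.
move=> w; have h1 C : \1_(B `&` C) w = \1_B w * \1_C w :> R by rewrite indicI.
by rewrite !h1; ring.
Qed.

Lemma dur_centred i : igr P (fun w => \1_(Ei i) w * (dur w - 2)) /\
  forall B, past X a B -> \int[P]_w (\1_B w * (\1_(Ei i) w * (dur w - 2))) = 0.
Proof.
have H B : past X a B -> igr P (fun w => \1_B w * (\1_(Ei i) w * (dur w - 2))) /\
   \int[P]_w (\1_B w * (\1_(Ei i) w * (dur w - 2))) = 0.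
  move=> pB; have [I0 E0] := dur_moment0 i pB; have [I1 E1] := dur_moment1 i pB.
  have Q w : \1_B w * (\1_(Ei i) w * (dur w - 2)) = \1_(B `&` Ei i) w * dur w - 2 * \1_(B `&` Ei i) w.
    have h1 C : \1_(B `&` C) w = \1_B w * \1_C w :> R by rewrite indicI.
    by rewrite h1; ring.
  split; first by under eq_fun do rewrite Q; apply: igrB => //; exact: igrZ.
  rewrite (eqE _ Q) EB ?EZ ?E1 ?E0 ?subrr//; exact: igrZ.
split=> [|B pB]; last exact: (H B pB).2.
have := (H setT (pastT sa)).1; congr igr; apply/funext => w.
by rewrite indicE in_setT mul1r.
Qed.

Lemma dur_sqr_centred i : igr P (fun w => \1_(Ei i) w * ((dur w - 2) ^+ 2 - 4 / 3)) /\
  forall B, past X a B -> \int[P]_w (\1_B w * (\1_(Ei i) w * ((dur w - 2) ^+ 2 - 4 / 3))) = 0.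
Proof.
have H B : past X a B -> igr P (fun w => \1_B w * (\1_(Ei i) w * ((dur w - 2) ^+ 2 - 4 / 3))) /\
   \int[P]_w (\1_B w * (\1_(Ei i) w * ((dur w - 2) ^+ 2 - 4 / 3))) = 0.
  move=> pB; have [I0 E0] := dur_moment0 i pB; have [I1 E1] := dur_moment1 i pB; have [I2 E2] := dur_moment2 i pB.
  have Q w : \1_B w * (\1_(Ei i) w * ((dur w - 2) ^+ 2 - 4 / 3)) =
     \1_(B `&` Ei i) w * dur w ^+ 2 - 4 * (\1_(B `&` Ei i) w * dur w) + 8 / 3 * \1_(B `&` Ei i) w.
    have h1 C : \1_(B `&` C) w = \1_B w * \1_C w :> R by rewrite indicI.
    by rewrite h1; field.
  have Ib : igr P (fun w => \1_(B `&` Ei i) w * dur w ^+ 2 - 4 * (\1_(B `&` Ei i) w * dur w)).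
    by apply: igrB => //; exact: igrZ.
  split; first by under eq_fun do rewrite Q; apply: igrD => //; exact: igrZ.
  have key (x : R) : 16 / 3 * x - 4 * (2 * x) + 8 / 3 * x = 0 by field.
  rewrite (eqE _ Q) ED; [|exact: Ib|exact: igrZ].
  rewrite EB; [|exact: I2|exact: igrZ].
  rewrite (EZ _ I1) (EZ _ I0) E2 E1 E0; exact: key.
split=> [|B pB]; last exact: (H B pB).2.
have := (H setT (pastT sa)).1; congr igr; apply/funext => w.
by rewrite indicE in_setT mul1r.
Qed.

Lemma dur_third i B : past X a B ->
  igr P (fun w => \1_(B `&` Ei i) w * `|dur w - 2| ^+ 3) /\
  \int[P]_w (\1_(B `&` Ei i) w * `|dur w - 2| ^+ 3) <= (4 * @moment_const R + 32) * (mass B / N%:R).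
Proof.
move=> pB; have [I0 E0] := dur_moment0 i pB; have [I3 E3] := dur_moment3 i pB.
have le3 w : `|\1_(B `&` Ei i) w * `|dur w - 2| ^+ 3| <= 4 * (\1_(B `&` Ei i) w * dur w ^+ 3) + 32 * \1_(B `&` Ei i) w.
  have /andP[i0' _] := ind01 (B `&` Ei i) w.
  rewrite normrM (ger0_norm i0') normrX normr_id.
  have key (p q : R) : 4 * (p * q) + 32 * p = p * (4 * q + 32) by ring.
  rewrite key ler_wpM2l//.
  have u0 := dur_ge0 w; move: (dur w) u0 => u u0.
  have : `|u - 2| <= u + 2 by rewrite (le_trans (ler_normB _ _))// !ger0_norm.
  move=> h; apply: (@le_trans _ _ ((u + 2) ^+ 3)); first by rewrite lerXn2r ?nnegrE ?addr_ge0.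
  (* Three times this quantity is the difference between [4 * u ^+ 3 + 32] and [(u + 2) ^+ 3]. *)
  have : 0 <= (u + 2) * (u - 2) ^+ 2 by rewrite mulr_ge0 ?sqr_ge0 ?addr_ge0.
  rewrite (_ : (u + 2) * (u - 2) ^+ 2 = u ^+ 3 - 2 * u ^+ 2 - 4 * u + 8); last by ring.
  rewrite (_ : (u + 2) ^+ 3 = u ^+ 3 + 6 * u ^+ 2 + 12 * u + 8); last by ring.
  by move: (u ^+ 3) (u ^+ 2) => u3 u2; lra.
have Ir : igr P (fun w => 4 * (\1_(B `&` Ei i) w * dur w ^+ 3) + 32 * \1_(B `&` Ei i) w).
  by apply: igrD; exact: igrZ.
have I : igr P (fun w => \1_(B `&` Ei i) w * `|dur w - 2| ^+ 3).
  apply: igr_le le3 Ir; have [I1 _] := dur_moment1 i pB.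
  rewrite (_ : (fun w => _) = (fun w => `|\1_(B `&` Ei i) w * dur w - 2 * \1_(B `&` Ei i) w| ^+ 3)).
    apply: measurable_funX; apply: measurableT_comp => //; apply: measurable_funB.
      exact: igr_meas I1.
    by apply: measurable_funM => //; exact: igr_meas I0.
  apply/funext => w; rewrite indicE; case: (_ \in _); rewrite ?mul1r ?mulr1//.
  by rewrite !mul0r mulr0 subr0 normr0 expr0n.
split=> //; rewrite mulrDl -mulrA.
apply: (@le_trans _ _ (\int[P]_w (4 * (\1_(B `&` Ei i) w * dur w ^+ 3) + 32 * \1_(B `&` Ei i) w))).
  by apply: le_E => // w; exact: le_trans (ler_norm _) (le3 w).
rewrite ED ?EZ ?E0//; [|exact: igrZ|exact: igrZ].
by rewrite lerD2r ler_wpM2l.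
Qed.

(** The first term comes from [heat_space] and the third moment of the duration, the second from
    [heat_time] with the variance [4 / 3 / r ^+ 2] of one rescaled cycle. *)
Definition step_err (r v : R) : R :=
  2 * (4 * @moment_const R + 32) / (r ^+ 3 * Num.sqrt v ^+ 3) + 4 * (4 / 3 / r ^+ 2) ^+ 2 / v ^+ 2.

(** One cycle is exchanged for heat time [4 / 3 / r ^+ 2]. The linear term vanishes by the mean 2,
    and the quadratic one matches the time derivative [heat2 / 2]. The error carries the factor
    [mass A / N], the probability of the event considered, so that it can later be summed over leg
    sequences. *)
Lemma one_step i A (b v r y0 : R) : past X a A -> 0 < v -> 0 < r ->
  `| \int[P]_w (\1_(A `&` Ei i) w * heat b v ((fine (s w) - y0 - 2) / r)) -
     N%:R^-1 * \int[P]_w (\1_(A `&` [set w | (a w < +oo)%E]) w * heat b (v + 4 / 3 / r ^+ 2) ((fine (a w) - y0) / r)) |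
  <= mass A / N%:R * step_err r v.
Proof.
move=> pA v0 r0; set D := A `&` Ei i; set t := 4 / 3 / r ^+ 2.
pose f w := (fine (a w) - y0) / r; pose xi w := (dur w - 2) / r.
have mA := past_meas pA; have mD : measurable D by exact: meas_BEi.
have mf : measurable [set w | (a w < +oo)%E] by case: (past_fin hX sa).
have [I0 E0] := dur_moment0 i pA; have [I3 E3] := dur_third i pA.
have t0 : 0 <= t by rewrite !divr_ge0// exprn_ge0// ltW.
have aff (g : R -> R) : continuous g -> continuous (fun x => g ((x - y0) / r)).
  move=> cg x; apply: (cvg_comp (fun x => (x - y0) / r) g); last exact: cg.
  by apply: cvgM; [apply: cvgB; [exact: cvg_id|exact: cvg_cst]|exact: cvg_cst].
have sq0 : 0 < Num.sqrt v by rewrite sqrtr_gt0.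
have B0 v' x : `|heat b v' x| <= 1 by have /andP[h1 h2] := heat01 b v' x; rewrite ger0_norm.
have D1 w : D w -> a w \is a fin_num.
  move=> [_ [[_ _] /= soo]]; rewrite ge0_fin_numE ?sa.1//; exact: le_lt_trans (as_ w) soo.
have C0 := cond_int sa (leg_centred i).1 (aff _ (heat_continuous (b := b) (v := v))) (fun x => B0 v _) (leg_centred i).2 pA.
have C0t := cond_int sa (leg_centred i).1 (aff _ (heat_continuous (b := b) (v := v + t))) (fun x => B0 (v + t) _) (leg_centred i).2 pA.
have C1 := cond_int sa (dur_centred i).1 (aff _ (heat1_continuous (b := b) (v := v))) (fun x => heat1_bound b _ v0) (dur_centred i).2 pA.
have C2 := cond_int sa (dur_sqr_centred i).1 (aff _ (heat2_continuous (b := b) (v := v))) (fun x => heat2_bound b _ v0) (dur_sqr_centred i).2 pA.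
have C20 := cond_int sa (leg_centred i).1 (aff _ (heat2_continuous (b := b) (v := v))) (fun x => heat2_bound b _ v0) (leg_centred i).2 pA.
have aD w : \1_[set w | (a w < +oo)%E] w * \1_(Ei i) w = \1_(Ei i) w :> R.
  have [Ew|Ew] := boolP (w \in Ei i); rewrite [\1_(Ei i) w]indicE ?(negbTE Ew) ?Ew ?mulr0// mulr1.
  rewrite indicE mem_set//=; move: Ew; rewrite inE => -[_ /= soo].
  exact: le_lt_trans (as_ w) soo.
have h1 C w : \1_(A `&` C) w = \1_A w * \1_C w :> R by rewrite indicI.
(* [main] splits the difference into the three centred terms, the spatial and the temporal Taylor errors. *)
pose e1 w := \1_D w * (heat b v (f w + xi w) - heat b v (f w) - heat1 b v (f w) * xi w - heat2 b v (f w) / 2 * xi w ^+ 2).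
pose e2 w := \1_D w * (heat b (v + t) (f w) - heat b v (f w) - t / 2 * heat2 b v (f w)).
pose z1 w := \1_A w * (\1_[set w | (a w < +oo)%E] w * heat1 b v (f w) * (\1_(Ei i) w * (dur w - 2))).
pose z2 w := \1_A w * (\1_[set w | (a w < +oo)%E] w * heat2 b v (f w) * (\1_(Ei i) w * ((dur w - 2) ^+ 2 - 4 / 3))).
pose z0 w := \1_A w * (\1_[set w | (a w < +oo)%E] w * heat b (v + t) (f w) * (\1_(Ei i) w - N%:R^-1 * \1_[set w | (a w < +oo)%E] w)).
have r1 : r != 0 by rewrite gt_eqF.
have main w : \1_D w * heat b v ((fine (s w) - y0 - 2) / r) -
    N%:R^-1 * (\1_(A `&` [set w | (a w < +oo)%E]) w * heat b (v + t) ((fine (a w) - y0) / r)) =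
    e1 w - e2 w + (r^-1 * z1 w + (2^-1 * r^-2) * z2 w + z0 w).
  have -> : \1_D w * heat b v ((fine (s w) - y0 - 2) / r) = \1_D w * heat b v (f w + xi w).
    have [Dw|Dw] := boolP (w \in D); last by rewrite indicE (negbTE Dw) !mul0r.
    congr (_ * heat _ _ _); rewrite /f /xi /dur ifT; last by move: Dw; rewrite inE => -[_ []].
    by field.
  (* Here [p] and [q] stand for the indicators of a finite start and of [Ei]; the latter event is
     contained in the former. *)
  have key (A1 p q H Hx Ht H1 H2 u n : R) : (p = 0 /\ q = 0) \/ p = 1 ->
      A1 * q * Hx - n * (A1 * p * Ht) =
      A1 * q * (Hx - H - H1 * (u / r) - H2 / 2 * (u / r) ^+ 2) -
      A1 * q * (Ht - H - 4 / 3 / r ^+ 2 / 2 * H2) +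
      (r^-1 * (A1 * (p * H1 * (q * u))) + 2^-1 * r ^- 2 * (A1 * (p * H2 * (q * (u ^+ 2 - 4 / 3)))) +
       A1 * (p * Ht * (q - n * p))).
    by case=> [[-> ->]|->]; field.
  rewrite /e1 /e2 /z1 /z2 /z0 /D !h1 -/(f w) /xi /t; apply: key.
  have := aD w; rewrite [\1_[set w | _] w]indicE; case: (_ \in _); last by rewrite mul0r => <-; left.
  by right.
have iz c g : igr P g -> \int[P]_w g w = 0 -> igr P (fun w => c * g w) /\ \int[P]_w (c * g w) = 0.
  by move=> Ig Eg; split; [exact: igrZ|rewrite EZ// Eg mulr0].
have [Iz1 Ez1] := iz r^-1 z1 C1.1 C1.2.
have [Iz2 Ez2] := iz (2^-1 * r ^- 2) z2 C2.1 C2.2.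
pose zz w := r^-1 * z1 w + (2^-1 * r ^- 2) * z2 w + z0 w.
have I12 : igr P (fun w => r^-1 * z1 w + (2^-1 * r ^- 2) * z2 w) by exact: igrD.
have Izz : igr P zz by apply: igrD; [exact: I12|exact: C0t.1].
have Ezz : \int[P]_w zz w = 0.
  by rewrite /zz ED; [rewrite ED// Ez1 Ez2 C0t.2 !addr0|exact: I12|exact: C0t.1].
have mh (b' v' : R) (g : T -> R) : measurable_fun setT g -> measurable_fun setT (fun w => heat b' v' (g w)).
  move=> mg; apply: (measurableT_comp _ mg); apply: continuous_measurable_fun.
  exact: heat_continuous.
have maff (g : T -> R) (c : R) : measurable_fun setT g -> measurable_fun setT (fun w => (g w - c) / r).
  by move=> mg; apply: measurable_funM => //; apply: measurable_funB.
have bh (B : set T) (v' : R) (g : T -> R) : measurable B -> measurable_fun setT g -> igr P (fun w => \1_B w * heat b v' (g w)).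
  move=> mB mg; apply/bmf_igr/bmfM; first exact: bmf_ind.
  by split; [exact: mh|exists 1 => w; exact: B0].
have IS : igr P (fun w => \1_D w * heat b v ((fine (s w) - y0 - 2) / r)).
  apply: bh => //; apply: maff; apply: measurable_funB => //; exact: stopping_measurable.
have IA : igr P (fun w => \1_(A `&` [set w | (a w < +oo)%E]) w * heat b (v + t) ((fine (a w) - y0) / r)).
  by apply: bh; [exact: measurableI|apply: maff; exact: stopping_measurable].
have IAn : igr P (fun w => N%:R^-1 * (\1_(A `&` [set w | (a w < +oo)%E]) w * heat b (v + t) ((fine (a w) - y0) / r))).
  exact: igrZ.
rewrite -(EZ _ IA) -(EB IS IAn).
rewrite -[X in `|X|]subr0 -Ezz -(EB _ Izz); last exact: igrB.
pose K1 : R := 2 / (r ^+ 3 * Num.sqrt v ^+ 3); pose K2 : R := 4 * t ^+ 2 / v ^+ 2.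
pose g w := K1 * (\1_D w * `|dur w - 2| ^+ 3) + K2 * \1_D w.
have IK1 : igr P (fun w => K1 * (\1_D w * `|dur w - 2| ^+ 3)) by exact: igrZ.
have IK2 : igr P (fun w => K2 * \1_D w) by exact: igrZ.
have K10 : 0 <= K1 by rewrite /K1 divr_ge0// mulr_ge0// exprn_ge0// ltW.
have bound w : `|\1_D w * heat b v ((fine (s w) - y0 - 2) / r) -
    N%:R^-1 * (\1_(A `&` [set w | (a w < +oo)%E]) w * heat b (v + t) ((fine (a w) - y0) / r)) - zz w| <= g w.
  rewrite main addrK; apply: (le_trans (ler_normB _ _)).
  have /andP[d0 _] := ind01 D w.
  rewrite /e1 /e2 !normrM (ger0_norm d0) /g; apply: lerD.
    rewrite [leRHS]mulrCA ler_wpM2l//.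
    have := heat_space b (f w) v0 (xi w); rewrite /xi normrM normfV (gtr0_norm r0).
    have key (u : R) : 2 * (u / r) ^+ 3 / Num.sqrt v ^+ 3 = K1 * u ^+ 3.
      by rewrite /K1; field; rewrite r1 (gt_eqF sq0).
    by rewrite key.
  by rewrite mulrC ler_wpM2r// /K2; exact: heat_time.
apply: le_trans (norm_E_le _ _ bound) _.
- by apply: igrB => //; exact: igrB.
- exact: igrD.
rewrite /g (ED IK1 IK2) (EZ _ I3) (EZ _ I0) E0 /step_err -/t.
apply: (@le_trans _ _ (K1 * ((4 * @moment_const R + 32) * (mass A / N%:R)) + K2 * (mass A / N%:R))).
  by rewrite lerD2r ler_wpM2l.
have key (c M p q : R) : 2 / q * (M * p) + c * p = p * (2 * M / q + c) by ring.
by rewrite key.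
Qed.
End OneStep.

(** * Sequences of visited legs *)

Section Patterns.
Context {R : realType} {d : measure_display} {T : measurableType d}.
Variable P : probability T R.
Variables (N : nat) (i0 : 'I_N) (X : 'I_N -> R -> T -> R).
Hypothesis hX : spider_BM P X.

Definition sg (k : nat) (w : T) : \bar R := cov_sigma (fun i t => X i t w) k.

Lemma stopping_sg k : stopping X (sg k) /\ at0 X (sg k).
Proof.
elim: k => [|k [sa a0]]; last by split; [exact: (stopping_sig hX sa a0)|exact: (sig_at0 hX sa a0)].
split; last by move=> w _ i /=; case: hX => _ _ _ + _; apply.
split=> // t; have [t0|t0] := leP t 0.
  rewrite (_ : [set _ | _] = set0); first exact: Ft0.
  by apply/seteqP; split => // w /=; rewrite lte_fin ltNge t0.
rewrite (_ : [set _ | _] = setT); first exact: FtT.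
by apply/seteqP; split => // w _ /=; rewrite lte_fin.
Qed.

Lemma sg_le k w : (sg k w <= sg k.+1 w)%E.
Proof.
have [sa a0] := stopping_sg k.
exact: (le_trans (rho_ge sa w) (sig_ge hX sa a0 w)).
Qed.

Lemma sg_leq j k w : (j <= k)%N -> (sg j w <= sg k w)%E.
Proof.
move=> /subnK <-; elim: (k - j)%N => // n IH; exact: le_trans IH (sg_le _ _).
Qed.

(** The legs are given by an infinite sequence so that the same [p] serves for every [n] in the
    induction. *)
Definition pat (n : nat) (p : nat -> 'I_N) : set T :=
  [set w | (sg n w < +oo)%E /\ forall k, (k < n)%N -> EL X (sg k) (p k) w].

Lemma patS n p : pat n.+1 p = pat n p `&` Ei X (sg n) (p n).
Proof.
apply/seteqP; split => w /=.
  move=> [soo H]; split; last by split; [exact: H|].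
  by split; [exact: le_lt_trans (sg_le _ _) soo|move=> k kn; apply: H; exact: ltnW].
move=> [[soo H] [En soo']]; split => // k; rewrite ltnS leq_eqVlt => /orP[/eqP ->//|]; exact: H.
Qed.

Lemma pat0 p : pat 0 p = setT.
Proof. by apply/seteqP; split => // w _; split => //; exact: ltry. Qed.

Lemma past_pat n p : past X (sg n) (pat n p).
Proof.
have [sa a0] := stopping_sg n.
elim: n sa a0 => [|n IH] sa a0; first by rewrite pat0; exact: pastT.
have [sa' a0'] := stopping_sg n; rewrite patS; apply: pastI; last exact: (Ei_past hX sa' a0').
by apply: past_mono (IH _ _) => // w; exact: sg_le.
Qed.

Lemma pat_fin n p : pat n p `&` [set w | (sg n w < +oo)%E] = pat n p.
Proof. by apply/seteqP; split => w /=; [case|move=> [h1 h2]]. Qed.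

Lemma P_pat n p : fine (P (pat n p)) = N%:R ^- n.
Proof.
elim: n => [|n IH]; first by rewrite pat0 probability_setT expr0 invr1.
have [sa a0] := stopping_sg n.
rewrite patS (mass_Ei i0 hX sa a0 _ (past_pat n p)) /mass pat_fin IH.
by rewrite -invfM exprSr.
Qed.

Definition dev_ (r : R) (n : nat) (w : T) : R := (fine (sg n w) - 2 * n%:R) / r.

(** The variance grows along the replacement, so the error at the initial smoothing [v0] bounds that
    of all cycles. *)
Lemma step_err_mono (r v0 v : R) : 0 < r -> 0 < v0 -> v0 <= v -> step_err r v <= step_err r v0.
Proof.
move=> r0 v00 vv; have v1 := lt_le_trans v00 vv; rewrite /step_err.
have s0 : 0 < Num.sqrt v0 by rewrite sqrtr_gt0.
have s1 : 0 < Num.sqrt v by rewrite sqrtr_gt0.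
have M0 : 0 <= 4 * @moment_const R by rewrite mulr_ge0//; case: (@moment_constP R).
apply: lerD; rewrite ler_wpM2l ?mulr_ge0 ?addr_ge0 ?exprn_ge0 ?divr_ge0 ?invr_ge0 ?exprn_ge0 ?(ltW r0)//; first last.
  by rewrite lef_pV2 ?posrE ?exprn_gt0// lerXn2r ?nnegrE ?(ltW v1) ?(ltW v00).
rewrite lef_pV2 ?posrE ?mulr_gt0 ?exprn_gt0// ler_wpM2l ?exprn_ge0 ?(ltW r0)//.
by rewrite lerXn2r ?nnegrE ?(ltW s0) ?(ltW s1)// ler_wsqrtr.
Qed.

(** The last cycle is exchanged first, which adds its variance to [v]; the induction hypothesis at
    the larger [v] handles the earlier ones. After all exchanges the starting point 0 and the total
    variance remain. *)
Lemma pat_heat (b r v0 v : R) n p : 0 < r -> 0 < v0 -> v0 <= v ->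
  `| \int[P]_w (\1_(pat n p) w * heat b v (dev_ r n w)) -
     N%:R ^- n * heat b (v + n%:R * (4 / 3 / r ^+ 2)) 0 | <= n%:R * N%:R ^- n * step_err r v0.
Proof.
move=> r0 v00; set t := 4 / 3 / r ^+ 2.
have t0 : 0 <= t by rewrite /t !divr_ge0// exprn_ge0// ltW.
elim: n v => [|n IH] v vv.
  rewrite !mul0r addr0 expr0 invr1 mul1r.
  rewrite (eqE _ (g := fun=> heat b v 0)) ?E_cst ?subrr ?normr0//.
  by move=> w; rewrite pat0 indicE in_setT mul1r /dev_ /= mulr0 subrr mul0r.
have [sa a0] := stopping_sg n.
have := one_step i0 hX sa a0 (p n) b (2 * n%:R) (past_pat n p) (lt_le_trans v00 vv) r0.
rewrite -patS pat_fin /mass pat_fin P_pat -/t => H1.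
have N0 : 0 <= N%:R^-1 :> R by rewrite invr_ge0.
have Nn0 : 0 <= N%:R ^- n :> R by rewrite invr_ge0 exprn_ge0.
have v1 : v0 <= v + t by rewrite (le_trans vv)// lerDl.
have := ler_wpM2l N0 (IH _ v1).
rewrite -[X in X * `|_| <= _](ger0_norm N0) -normrM => H2.
have {}H1 := le_trans H1 (ler_wpM2l (mulr_ge0 Nn0 N0) (step_err_mono r0 v00 vv)).
have -> : \int[P]_w (\1_(pat n.+1 p) w * heat b v (dev_ r n.+1 w)) =
  \int[P]_w (\1_(pat n.+1 p) w * heat b v ((fine (sig_of X (rho_of X (sg n)) w) - 2 * n%:R - 2) / r)).
  by apply: eqE => w; rewrite /dev_ -[n.+1%:R]natr1 mulrDr mulr1 opprD addrA.
move: (\int[P]_w _) (\int[P]_w _) H1 H2 => I2 I1.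
rewrite (_ : v + t + n%:R * t = v + n.+1%:R * t); last by rewrite -natr1; ring.
rewrite -/(dev_ r n).
set h := heat _ _ _ => H1 H2.
have E : N%:R ^- n.+1 = N%:R^-1 * N%:R ^- n :> R by rewrite exprS invfM.
rewrite E.
rewrite (_ : I1 - _ = (I1 - N%:R^-1 * I2) + N%:R^-1 * (I2 - N%:R ^- n * h)); last by ring.
apply: (le_trans (ler_normD _ _)).
apply: (le_trans (lerD H1 H2)); rewrite -natr1.
have key (a c e m : R) : a * c * e + c * (m * a * e) = (m + 1) * (c * a) * e by ring.
by rewrite key.
Qed.

Definition leg (k : nat) (w : T) : 'I_N := xget i0 [set i | EL X (sg k) i w].
Definition legs n (w : T) : n.-tuple 'I_N := [tuple leg k w | k < n].

Lemma rho_fin k n w : (k < n)%N -> (sg n w < +oo)%E -> (rho_of X (sg k) w < +oo)%E.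
Proof.
move=> kn; have [sa a0] := stopping_sg k; apply: le_lt_trans.
exact: le_trans (sig_ge hX sa a0 w) (sg_leq w kn).
Qed.

Lemma legP k n w i : (k < n)%N -> (sg n w < +oo)%E -> EL X (sg k) i w <-> leg k w = i.
Proof.
move=> kn soo; have [sa a0] := stopping_sg k.
have [j Ej] := EL_sum i0 hX sa a0 (rho_fin kn soo).
have Ll : EL X (sg k) (leg k w) w by exact: (@xgetI _ i0 [set i | EL X (sg k) i w] j Ej).
by split => [Ei|<-//]; exact: (EL_inj hX sa a0 Ll Ei).
Qed.

Lemma patP n (t : n.-tuple 'I_N) w :
  pat n (nth i0 t) w <-> (sg n w < +oo)%E /\ t = legs n w.
Proof.
split=> [[soo H]|[soo ->]]; split=> //.
  apply: eq_from_tnth => k; rewrite tnth_mktuple (tnth_nth i0); symmetry.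
  by apply/(legP _ (ltn_ord k) soo); exact: H.
move=> k kn; apply/(legP _ kn soo).
by rewrite -[k]/(val (Ordinal kn)) -tnth_nth tnth_mktuple.
Qed.

Definition legev n (Q : pred (n.-tuple 'I_N)) : set T :=
  [set w | (sg n w < +oo)%E /\ Q (legs n w)].

Lemma legev_ind n Q w : \1_(legev Q) w = \sum_(t : n.-tuple 'I_N | Q t) \1_(pat n (nth i0 t)) w :> R.
Proof.
have [soo|soo] := pselect (sg n w < +oo)%E; last first.
  rewrite indicE memNset; last by case.
  by rewrite big1// => t _; rewrite indicE memNset//; case.
have H (t : n.-tuple 'I_N) : \1_(pat n (nth i0 t)) w = (t == legs n w)%:R :> R.
  rewrite indicE; congr (_ %:R); congr nat_of_bool; apply/idP/eqP.
    by rewrite inE => /patP[].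
  by move=> ->; rewrite inE; apply/patP.
under eq_bigr do rewrite H.
rewrite indicE; have [Qw|Qw] := boolP (Q (legs n w)).
  rewrite mem_set//; symmetry.
  by rewrite (bigD1 (legs n w))//= eqxx big1 ?addr0// => t /andP[_ /negbTE ->].
rewrite memNset ?big1//; last by case=> _; exact/negP.
by move=> t Qt; case: eqP => // E; move: Qw; rewrite -E Qt.
Qed.

Lemma legev_meas n (Q : pred (n.-tuple 'I_N)) : measurable (legev Q).
Proof.
rewrite (_ : legev Q = \big[setU/set0]_(t <- enum {: n.-tuple 'I_N} | Q t) pat n (nth i0 t)).
  by apply: bigsetU_measurable => t _; case: (past_pat n (nth i0 t)).
rewrite -bigcup_seq_cond; apply/seteqP; split => w /=.
  by move=> [soo Qw]; exists (legs n w); [rewrite /= mem_enum Qw|apply/patP].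
by move=> [t /= /andP[_ Qt] /patP[soo E]]; split => //; rewrite -E.
Qed.

Lemma igr_pat n p (g : T -> R) : measurable_fun setT g -> (forall w, `|g w| <= 1) ->
  igr P (fun w => \1_(pat n p) w * g w).
Proof.
move=> mg g1; apply/bmf_igr/bmfM; last by split => //; exists 1.
by apply: bmf_ind; case: (past_pat n p).
Qed.

Lemma E_legev n (Q : pred (n.-tuple 'I_N)) (g : T -> R) : measurable_fun setT g -> (forall w, `|g w| <= 1) ->
  \int[P]_w (\1_(legev Q) w * g w) =
  \sum_(t : n.-tuple 'I_N | Q t) \int[P]_w (\1_(pat n (nth i0 t)) w * g w).
Proof.
move=> mg g1; rewrite -big_filter -E_sum; last by move=> t; exact: igr_pat.
by apply: eqE => w; rewrite legev_ind big_filter mulr_suml.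
Qed.

Lemma P_legev n (Q : pred (n.-tuple 'I_N)) : fine (P (legev Q)) = #|Q|%:R * N%:R ^- n.
Proof.
rewrite -E_ind; last exact: legev_meas.
rewrite (eqE _ (g := fun w => \1_(legev Q) w * 1)); last by move=> w; rewrite mulr1.
rewrite E_legev//; last by move=> w; rewrite normr1.
rewrite (eq_bigr (fun=> N%:R ^- n)); first by rewrite sumr_const mulr_natl.
move=> t _; rewrite -(P_pat n (nth i0 t)) -E_ind; last by case: (past_pat n (nth i0 t)).
by apply: eqE => w; rewrite mulr1.
Qed.

Lemma dev_meas (r : R) n : measurable_fun setT (dev_ r n).
Proof.
apply: measurable_funM => //; apply: measurable_funB => //.
by apply: (stopping_measurable hX); case: (stopping_sg n).
Qed.

(** Summing [pat_heat] over the sequences in [Q] turns the equal weights [N ^- n] into the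
    probability of the event, in the main term and in the error alike. *)
Lemma legev_heat (b r v0 v : R) n (Q : pred (n.-tuple 'I_N)) : 0 < r -> 0 < v0 -> v0 <= v ->
  `| \int[P]_w (\1_(legev Q) w * heat b v (dev_ r n w)) -
     fine (P (legev Q)) * heat b (v + n%:R * (4 / 3 / r ^+ 2)) 0 |
  <= n%:R * fine (P (legev Q)) * step_err r v0.
Proof.
move=> r0 v00 vv; rewrite E_legev; first last.
- by move=> w; have /andP[h1 h2] := heat01 b v (dev_ r n w); rewrite ger0_norm.
- apply: (measurableT_comp _ (dev_meas r n)); apply: continuous_measurable_fun.
  exact: heat_continuous.
have sE (c : R) : #|Q|%:R * c = \sum_(t : n.-tuple 'I_N | Q t) c by rewrite sumr_const mulr_natl.
rewrite P_legev sE mulr_suml -sumrB.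
apply: (le_trans (ler_norm_sum _ _ _)).
rewrite mulr_sumr mulr_suml; apply: ler_sum => t _.
exact: pat_heat.
Qed.
End Patterns.

(** * The coupon collector *)

Section CouponCount.
Variable R : realType.

Lemma sum_tuple_prod (I : finType) n (f : I -> R) :
  \sum_(t : n.-tuple I) \prod_(k < n) f (tnth t k) = (\sum_i f i) ^+ n.
Proof.
have -> : (\sum_i f i) ^+ n = \prod_(k < n) \sum_i f i by rewrite prodr_const card_ord.
rewrite bigA_distr_bigA/=.
rewrite (reindex (fun g : {ffun 'I_n -> I} => [tuple g k | k < n])).
  by apply: eq_bigr => g _; apply: eq_bigr => k _; rewrite tnth_mktuple.
exists (fun t : n.-tuple I => [ffun k => tnth t k]) => [g _|t _].
  by apply/ffunP => k; rewrite ffunE tnth_mktuple.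
by apply: eq_from_tnth => k; rewrite tnth_mktuple ffunE.
Qed.

Definition onto (N n : nat) : pred (n.-tuple 'I_N) := fun t => [forall i, i \in t].
Arguments onto : clear implicits.

(** The indicator of surjectivity is the product over [i] of one minus the indicator that [i] is
    missed. Expanding it over sets [J] of missed legs and summing over tuples gives
    [(N - #|J|) ^+ n] for each [J]. *)
Lemma onto_count (N n : nat) :
  #|onto N n|%:R = \sum_(m < N.+1) 'C(N, m)%:R * ((-1) ^+ m * (N - m)%:R ^+ n) :> R.
Proof.
rewrite -sum1_card natr_sum big_mkcond /=.
pose F m : R := (-1) ^+ m * (N - m)%:R ^+ n.
have -> : \sum_(t : n.-tuple 'I_N) (if t \in onto N n then 1 else 0) =
   \sum_(J : {set 'I_N}) F #|J|.
  transitivity (\sum_(t : n.-tuple 'I_N) \sum_(J : {set 'I_N})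
      (-1) ^+ #|J| * \prod_(k < n) (tnth t k \notin J)%:R : R).
    apply: eq_bigr => t _.
    transitivity (\prod_(i < N) (- (i \notin t)%:R + 1) : R).
      rewrite unfold_in /onto; case: ifPn => [/forallP H|].
        by rewrite big1// => i _; rewrite H oppr0 add0r.
      by rewrite negb_forall => /existsP[i it]; rewrite (bigD1 i)//= it addNr mul0r.
    rewrite bigA_distr; apply: eq_bigr => J _.
    rewrite -big_mkcond/= prodrN; congr (_ * _).
    have [/existsP[k kJ]|] := boolP [exists k : 'I_n, tnth t k \in J].
      rewrite (bigD1 (tnth t k))//= mem_tnth mul0r.
      by rewrite (bigD1 k)//= kJ mul0r.
    rewrite negb_exists => /forallP H.
    rewrite big1 ?big1// => [k _|i iJ]; first by rewrite H.
    by case: (boolP (i \in t)) => // /tnthP[k E]; move: (H k); rewrite -E iJ.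
  rewrite exchange_big; apply: eq_bigr => J _; rewrite -mulr_sumr.
  rewrite (sum_tuple_prod n (fun i => (i \notin J)%:R)); congr (_ * _ ^+ _).
  rewrite -natr_sum; congr _%:R.
  rewrite (eq_bigr (fun i => if i \in ~: J then 1%N else 0%N)); last by move=> i _; rewrite inE; case: (_ \in _).
  by rewrite -big_mkcond sum1_card cardsCs finset.setCK card_ord.
rewrite (partition_big (fun J : {set 'I_N} => inord #|J| : 'I_N.+1) xpredT)//=.
apply: eq_bigr => m _.
rewrite (eq_big (fun J : {set 'I_N} => J \in [set A : {set 'I_N} | #|A| == m]%SET) (fun=> F m)).
- by rewrite sumr_const card_draws card_ord -[in LHS]mulr_natl.
- move=> J; rewrite inE -val_eqE /= inordK//.
  by rewrite ltnS -[X in (_ <= X)%N](card_ord N) max_card.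
- move=> J; rewrite -val_eqE /= inordK; first by move=> /eqP ->.
  by rewrite ltnS -[X in (_ <= X)%N](card_ord N) max_card.
Qed.

Definition coupon (N n : nat) : R := #|onto N n|%:R * N%:R ^- n.

Lemma couponE N n : (0 < N)%N -> coupon N n =
  \sum_(m < N.+1) 'C(N, m)%:R * ((-1) ^+ m * (1 - m%:R / N%:R) ^+ n).
Proof.
move=> N0; rewrite /coupon onto_count mulr_suml; apply: eq_bigr => m _.
rewrite -!mulrA -exprVn -exprMn; congr (_ * (_ * _ ^+ _)).
rewrite natrB; last by rewrite -ltnS.
by rewrite mulrBl divff// pnatr_eq0 -lt0n.
Qed.

(** Dominated convergence for series: beyond a fixed [M] both sums have tails controlled by the
    series of [b], and the first [M] terms converge one by one. *)
Lemma tannery (u : nat -> nat -> R) (l b : nat -> R) :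
  (forall m, u ^~ m @ \oo --> l m) ->
  (\forall n \near \oo, forall m, `|u n m| <= b m) -> cvgn (series b) ->
  (fun n => \sum_(m < n.+1) u n m) @ \oo --> limn (series l).
Proof.
move=> ul ub cb.
have lb m : `|l m| <= b m.
  rewrite -(cvg_lim (@Rhausdorff R) (cvg_norm (ul m))).
  apply: limr_le; first by apply/cvg_ex; exists `|l m|; exact: cvg_norm.
  by near=> n; near: n; apply: filterS ub => n; exact.
have b0 m : 0 <= b m by exact: le_trans (normr_ge0 _) (lb m).
have ndb : nondecreasing_seq (series b).
  by apply/nondecreasing_seqP => n; rewrite seriesSr lerDl.
have cl : cvgn (series l).
  apply: normed_cvg; apply: (series_le_cvg _ b0 lb cb) => m /=; exact: normr_ge0.
apply/cvgrPdist_le => e e0.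
have e3 : 0 < e / 3 by rewrite divr_gt0.
have [M _ HM] : \forall M \near \oo, `|limn (series b) - series b M| <= e / 3.
  by move/cvgrPdist_le : cb => /(_ _ e3).
have tail (v : nat -> R) n : (forall m, `|v m| <= b m) -> (M <= n)%N ->
    `|series v n - series v M| <= e / 3.
  move=> vb Mn; rewrite sub_series_geq//.
  apply: (le_trans (ler_norm_sum _ _ _)).
  apply: (@le_trans _ _ (\sum_(M <= k < n) b k)); first exact: ler_sum.
  rewrite -sub_series_geq//; have := HM M (leqnn M).
  apply: le_trans; rewrite ger0_norm ?subr_ge0; last exact: nondecreasing_cvgn_le.
  by rewrite lerD2r; exact: nondecreasing_cvgn_le.
have cS : (fun n => series (u n) M) @ \oo --> series l M.
  rewrite /series/=; elim: (M) => [|k IH].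
    by rewrite big_nil; under eq_fun do rewrite big_nil; exact: cvg_cst.
  rewrite big_nat_recr//=; under eq_fun do rewrite big_nat_recr//=.
  exact: cvgD.
have hl : `|limn (series l) - series l M| <= e / 3.
  have : (fun n => `|series l n - series l M|) @ \oo --> `|limn (series l) - series l M|.
    by apply: cvg_norm; apply: cvgB => //; exact: cvg_cst.
  move=> H; rewrite -(cvg_lim (@Rhausdorff R) H).
  apply: limr_le; first by apply/cvg_ex; eexists; exact: H.
  by exists M => // n /= Mn; exact: tail.
move/cvgrPdist_le : cS => /(_ _ e3) cS.
near=> n.
have Mn : (M <= n.+1)%N by rewrite leqW//; near: n; exact: nbhs_infty_ge.
have un m : `|u n m| <= b m by move: m; near: n.
have h2 : `|series l M - series (u n) M| <= e / 3 by near: n.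
have h1 := tail (u n) n.+1 un Mn.
rewrite -(big_mkord xpredT (u n)) -/(series (u n) n.+1).
have key (p q r s : R) : p - q = (p - r) + (r - s) - (q - s) by ring.
rewrite -/(series (u n) n.+1) (key _ _ (series l M) (series (u n) M)).
apply: (le_trans (ler_normB _ _)).
apply: (@le_trans _ _ (e / 3 + e / 3 + e / 3)); last by lra.
by apply: lerD => //; apply: (le_trans (ler_normD _ _)); exact: lerD.
Unshelve. all: by end_near. Qed.

Lemma invn_cvg0 : (fun N : nat => N%:R^-1) @ \oo --> (0 : R).
Proof.
apply/gtr0_cvgV0; last exact: cvgr_idn.
by near=> N; rewrite ltr0n; near: N; exact: nbhs_infty_gt.
Unshelve. all: by end_near. Qed.

(** Writing [N] as the square of its root gives [ln N <= 2 * sqrt N]. *)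
Lemma lnN_div_cvg0 : (fun N : nat => ln N%:R / N%:R) @ \oo --> (0 : R).
Proof.
apply/cvgrPdist_le => e e0; near=> N.
have N0 : 0 < N%:R :> R by rewrite ltr0n; near: N; exact: nbhs_infty_gt.
have s0 : 0 < Num.sqrt N%:R :> R by rewrite sqrtr_gt0.
have N1 : 1 <= N%:R :> R by rewrite ler1n; near: N; exact: nbhs_infty_gt.
have sq : N%:R = Num.sqrt N%:R ^+ 2 :> R by rewrite sqr_sqrtr// ltW.
rewrite sub0r normrN ger0_norm ?divr_ge0 ?ln_ge0// {1}sq lnXn// ler_pdivrMr//.
apply: (@le_trans _ _ (2 * Num.sqrt N%:R)).
  by rewrite mulr_natl lerMn2r/= ltW// ln_sublinear.
rewrite {2}sq expr2 mulrA ler_wpM2r ?(ltW s0)//.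
have : 2 / e <= Num.sqrt N%:R.
  have h : 0 <= 2 / e by rewrite divr_ge0// ltW.
  rewrite -(ger0_norm h) -sqrtr_sqr ler_wsqrtr//.
  by near: N; exact: nbhs_infty_ger.
by rewrite ler_pdivrMr// mulrC.
Unshelve. all: by end_near. Qed.

(** For the lower bound, put [z = y + y^2] in [exp (- z) <= 1 - z + z^2 / 2] and note that
    [z^2 = y^2 (1 + y)^2 <= 2 y^2]. *)
Lemma ln_pow_bounds (y : R) : 0 <= y -> y <= 4^-1 ->
  expR (- (y + y ^+ 2)) <= 1 - y <= expR (- y).
Proof.
move=> y0 y4; rewrite expR_ge1Dx andbT.
have z0 : 0 <= y + y ^+ 2 by rewrite addr_ge0 ?sqr_ge0.
have [_ _ _ [_ _ h _ _]] := expN_bounds z0.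
move: h; rewrite subr_ge0 => h; apply: (le_trans h).
have : (1 + y) ^+ 2 <= 2 by apply: (@le_trans _ _ ((1 + 4^-1) ^+ 2)); [rewrite lerXn2r ?nnegrE ?lerD2l//; lra|lra].
have y20 : 0 <= y ^+ 2 by exact: sqr_ge0.
move=> /(ler_wpM2l y20).
rewrite (_ : (y + y ^+ 2) ^+ 2 = y ^+ 2 * (1 + y) ^+ 2); last by ring.
by move: (_ * _) => q; lra.
Qed.

Lemma ffact_ratio_cvg m : (fun N : nat => (N ^_ m)%:R / N%:R ^+ m) @ \oo --> (1 : R).
Proof.
elim: m => [|m IH].
  by under eq_fun do rewrite ffactn0 expr0 divr1; exact: cvg_cst.
have h : (fun N : nat => (N - m)%:R / N%:R) @ \oo --> (1 : R).
  have c : (fun N : nat => 1 - m%:R * N%:R^-1) @ \oo --> (1 - m%:R * 0 : R).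
    apply: cvgB; first exact: cvg_cst.
    by apply: cvgM; [exact: cvg_cst|exact: invn_cvg0].
  rewrite mulr0 subr0 in c; apply: cvg_trans c; apply: near_eq_cvg.
  near=> N; rewrite natrB ?mulrBl ?divff//.
    by rewrite pnatr_eq0 -lt0n; near: N; exact: nbhs_infty_gt.
  by near: N; exact: nbhs_infty_ge.
rewrite -[X in _ --> X](mulr1 1).
rewrite (_ : (fun N : nat => _) = fun N : nat => (N ^_ m)%:R / N%:R ^+ m * ((N - m)%:R / N%:R)).
  exact: cvgM.
by apply/funext => N; rewrite ffactnSr natrM exprSr invfM; ring.
Unshelve. all: by end_near. Qed.

(** * The Gumbel limit of the coupon collector probabilities *)

Section CouponLimit.
Variables (nn : nat -> nat) (x : R).
Hypothesis hn : (fun N => (nn N)%:R / N%:R - ln N%:R) @ \oo --> x.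

(** By [ln_pow_bounds] the term lies between [exp (- m s)] and that value corrected by [m^2 n / N^2]
    in the exponent, where [s = n / N - ln N]. The correction vanishes because [n / N] grows like
    [ln N]. *)
Lemma coupon_term_cvg m :
  (fun N : nat => (N%:R ^+ m * (1 - m%:R / N%:R) ^+ nn N)) @ \oo --> expR (- (m%:R * x)).
Proof.
pose s N := (nn N)%:R / N%:R - ln N%:R : R.
have V0 : (fun N : nat => N%:R^-1) @ \oo --> (0 : R) by exact: invn_cvg0.
have q0 : (fun N => m%:R ^+ 2 * ((s N + ln N%:R) * N%:R^-1)) @ \oo --> (0 : R).
  rewrite -[X in _ --> X](mulr0 (m%:R ^+ 2)); apply: cvgM; first exact: cvg_cst.
  rewrite (_ : (fun N => _) = fun N => s N * N%:R^-1 + ln N%:R / N%:R); last first.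
    by apply/funext => N; rewrite mulrDl.
  rewrite -[X in _ --> X](addr0 0); apply: cvgD; last exact: lnN_div_cvg0.
  by rewrite -(mulr0 x); exact: cvgM.
apply: (@squeeze_cvgr _ _ _ _ (fun N => expR (- (m%:R * s N) - m%:R ^+ 2 * ((s N + ln N%:R) * N%:R^-1)))
  (fun N => expR (- (m%:R * s N)))).
- near=> N.
  have N0 : 0 < N%:R :> R by rewrite ltr0n; near: N; exact: nbhs_infty_gt.
  have N1 : N%:R != 0 :> R by rewrite gt_eqF.
  have y4 : m%:R / N%:R <= 4^-1 :> R.
    rewrite ler_pdivrMr// mulrC ler_pdivlMr// -natrM ler_nat.
    by near: N; exact: nbhs_infty_ge.
  have /andP[l1 l2] := ln_pow_bounds (divr_ge0 (ler0n R m) (ltW N0)) y4.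
  have NE : N%:R ^+ m = expR (m%:R * ln N%:R) :> R by rewrite expRM_natl lnK.
  have sE : s N + ln N%:R = (nn N)%:R / N%:R by rewrite /s subrK.
  have y1 : 0 <= 1 - m%:R / N%:R :> R by exact: le_trans (expR_ge0 _) l1.
  apply/andP; split.
    rewrite (_ : - _ - _ = m%:R * ln N%:R + (nn N)%:R * - (m%:R / N%:R + (m%:R / N%:R) ^+ 2)).
      rewrite expRD -NE ler_wpM2l ?exprn_ge0 ?(ltW N0)// expRM_natl.
      by rewrite lerXn2r ?nnegrE ?expR_ge0.
    by rewrite sE /s; field.
  rewrite (_ : - _ = m%:R * ln N%:R + (nn N)%:R * - (m%:R / N%:R)).
    rewrite expRD -NE ler_wpM2l ?exprn_ge0 ?(ltW N0)// expRM_natl.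
    by rewrite lerXn2r ?nnegrE ?expR_ge0.
  by rewrite /s; field.
- apply: continuous_cvg; first exact: continuous_expR.
  rewrite -[X in _ --> X]subr0; apply: cvgB => //.
  by apply: cvgN; apply: cvgM => //; exact: cvg_cst.
- apply: continuous_cvg; first exact: continuous_expR.
  by apply: cvgN; apply: cvgM => //; exact: cvg_cst.
Unshelve. all: by end_near. Qed.

Lemma coupon_cvg : (fun N => coupon N (nn N)) @ \oo --> expR (- expR (- x)).
Proof.
pose u N m : R := 'C(N, m)%:R * ((-1) ^+ m * (1 - m%:R / N%:R) ^+ nn N).
pose L := expR (- x) + 1.
have uE N m : (0 < N)%N -> u N m = (-1) ^+ m / m`!%:R * ((N ^_ m)%:R / N%:R ^+ m) * (N%:R ^+ m * (1 - m%:R / N%:R) ^+ nn N).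
  move=> N0; have N1 : N%:R != 0 :> R by rewrite pnatr_eq0 -lt0n.
  rewrite -(bin_ffact N m) natrM /u.
  have f1 : m`!%:R != 0 :> R by rewrite pnatr_eq0 -lt0n fact_gt0.
  have key (c s a p q : R) : q != 0 -> p != 0 -> c * (s * a) = s / q * (c * q / p) * (p * a).
    by move=> q1 p1; field; rewrite p1.
  by apply: key => //; rewrite expf_neq0.
have ul m : u ^~ m @ \oo --> exp_coeff (- expR (- x)) m.
  have h : (fun N : nat => (-1) ^+ m / m`!%:R * ((N ^_ m)%:R / N%:R ^+ m) * (N%:R ^+ m * (1 - m%:R / N%:R) ^+ nn N))
     @ \oo --> (-1) ^+ m / m`!%:R * 1 * expR (- (m%:R * x)).
    apply: cvgM; last exact: coupon_term_cvg.
    by apply: cvgM; [exact: cvg_cst|exact: ffact_ratio_cvg].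
  rewrite (_ : exp_coeff _ m = (-1) ^+ m / m`!%:R * 1 * expR (- (m%:R * x))).
    apply: cvg_trans h; apply: near_eq_cvg; near=> N; rewrite uE//.
    by near: N; exact: nbhs_infty_gt.
  have key (p e q : R) : p * e / q = p / q * 1 * e by rewrite mulr1 mulrAC.
  by rewrite -key -mulrN expRM_natl /exp_coeff/= -exprMn mulN1r.
(* The bounds [C(N, m) <= N^m / m!] and [1 - y <= exp (- y)] give [exp (- s)^m / m!], and eventually
   [exp (- s) < L]. For [m > N] the binomial coefficient is 0. *)
have ub : \forall N \near \oo, forall m, `|u N m| <= exp_coeff L m.
  have sL : (fun N => expR (- ((nn N)%:R / N%:R - ln N%:R))) @ \oo --> expR (- x).
    by apply: continuous_cvg; [exact: continuous_expR|exact: cvgN].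
  have : \forall N \near \oo, expR (- ((nn N)%:R / N%:R - ln N%:R)) < L.
    by apply: cvgr_lt sL _ _; rewrite /L ltrDl.
  move=> HL; near=> N => m.
  have N0 : (0 < N)%N by near: N; exact: nbhs_infty_gt.
  have N0' : 0 < N%:R :> R by rewrite ltr0n.
  have NL : expR (- ((nn N)%:R / N%:R - ln N%:R)) < L by near: N.
  have L0 : 0 <= L by rewrite addr_ge0 ?expR_ge0.
  have e0 : 0 <= exp_coeff L m by rewrite /exp_coeff/= divr_ge0 ?exprn_ge0.
  have [mN|Nm] := leqP m N; last by rewrite /u bin_small// mul0r normr0.
  have y1 : 0 <= 1 - m%:R / N%:R :> R by rewrite subr_ge0 ler_pdivrMr// mul1r ler_nat.
  rewrite /u normrM normrM normrX normrN1 expr1n mul1r !ger0_norm ?exprn_ge0//.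
  apply: (@le_trans _ _ (N%:R ^+ m / m`!%:R * expR ((nn N)%:R * - (m%:R / N%:R)))).
    apply: ler_pM => //; rewrite ?exprn_ge0//.
      rewrite ler_pdivlMr ?ltr0n ?fact_gt0// -natrM bin_ffact -natrX ler_nat.
      elim: (m) => // k IH; by rewrite ffactnSr expnSr leq_mul// leq_subr.
    by rewrite expRM_natl lerXn2r ?nnegrE ?expR_ge0// expR_ge1Dx.
  rewrite /exp_coeff /= mulrAC ler_wpM2r ?invr_ge0//.
  rewrite (_ : N%:R ^+ m = expR (m%:R * ln N%:R)); last by rewrite expRM_natl lnK.
  rewrite -expRD (_ : _ + _ = m%:R * - ((nn N)%:R / N%:R - ln N%:R)); last by field; rewrite gt_eqF.
  by rewrite expRM_natl lerXn2r ?nnegrE ?expR_ge0// ltW.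
have := tannery ul ub (is_cvg_series_exp_coeff L).
rewrite -/(expR (- expR (- x))) => H; apply: cvg_trans H; apply: near_eq_cvg.
near=> N; rewrite couponE//; near: N; exact: nbhs_infty_gt.
Unshelve. all: by end_near. Qed.
End CouponLimit.
End CouponCount.

(** * Weak convergence in the plane *)

Section Grid.
Variable R : realType.
Variables (g : R * R -> R) (M : R).
Hypothesis cg : continuous g.
Hypothesis gM : forall z, `|g z| <= M.

(** Only [z] is confined to the box: the covering argument controls a whole neighbourhood of each
    point. *)
Lemma uniform_on_box (A : R) (e : R) : 0 < e -> exists n : nat, forall z z' : R * R,
  - A <= z.1 <= A -> - A <= z.2 <= A -> `|z.1 - z'.1| <= n.+1%:R^-1 -> `|z.2 - z'.2| <= n.+1%:R^-1 ->
  `|g z - g z'| <= e.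
Proof.
move=> e0; have e2 : 0 < e / 2 by rewrite divr_gt0.
have cK : compact (`[- A, A]%classic `*` `[- A, A]%classic : set (R * R)).
  by apply: compact_setX; exact: segment_compact.
pose Q (n : nat) (z : R * R) := forall z' : R * R,
  `|z.1 - z'.1| <= n.+1%:R^-1 -> `|z.2 - z'.2| <= n.+1%:R^-1 -> `|g z - g z'| <= e.
have : \forall n \near \oo, (`[- A, A]%classic `*` `[- A, A]%classic : set (R * R)) `<=` Q n.
  move/compact_near_coveringP : cK; apply => [z _].
  have := @cg z; move/cvgrPdist_le => /(_ _ e2) /nbhs_ballP[r /= r0 hr].
  have r2 : 0 < r / 2 by rewrite divr_gt0.
  exists (ball z (r / 2), [set n | n.+1%:R^-1 < r / 2]).
    by split; [exact: nbhsx_ballx|exact: near_infty_natSinv_lt (PosNum r2)].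
  move=> [z1 n] /= [[b1 b2] nr] z' d1 d2.
  rewrite (_ : g z1 - g z' = (g z - g z') - (g z - g z1)); last by ring.
  apply: (le_trans (ler_normB _ _)); rewrite [leRHS](splitr e); apply: lerD.
    apply: hr; split; rewrite /ball /= in b1 b2 *.
      rewrite (_ : z.1 - z'.1 = (z.1 - z1.1) + (z1.1 - z'.1)); last by ring.
      apply: (le_lt_trans (ler_normD _ _)); rewrite [ltRHS](splitr r); apply: ltrD => //.
      exact: le_lt_trans nr.
    rewrite (_ : z.2 - z'.2 = (z.2 - z1.2) + (z1.2 - z'.2)); last by ring.
    apply: (le_lt_trans (ler_normD _ _)); rewrite [ltRHS](splitr r); apply: ltrD => //.
    exact: le_lt_trans nr.
  have rr : r / 2 <= r by lra.
  by apply: hr; split; [exact: (le_ball rr b1)|exact: (le_ball rr b2)].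
move=> [n _ /(_ n (leqnn n)) H]; exists n => z z' z1 z2; apply: H.
by split; rewrite /= in_itv.
Qed.

Definition grid (A n : nat) (i : nat) : R := - A%:R + i%:R / n.+1%:R.
(** Half-open on the left, so that rectangle masses are differences of distribution functions and
    neighbouring cells do not overlap. *)
Definition cell (A n i : nat) (x : R) : bool := (grid A n i < x) && (x <= grid A n i.+1).
Definition cells (A n : nat) : nat := (2 * A * n.+1)%N.
Definition inbox (A : nat) (z : R * R) : bool :=
  [&& - A%:R < z.1, z.1 <= A%:R, - A%:R < z.2 & z.2 <= A%:R].

Lemma grid_last A n : grid A n (cells A n) = A%:R.
Proof. by rewrite /grid /cells natrM mulfK ?pnatr_eq0// natrM; ring. Qed.

Lemma grid_mono A n i j : (grid A n i <= grid A n j) = (i <= j)%N.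
Proof. by rewrite /grid lerD2l ler_pM2r ?invr_gt0// ler_nat. Qed.

Lemma cell_ex A n (x : R) : - A%:R < x -> x <= A%:R -> exists2 i, (i < cells A n)%N & cell A n i x.
Proof.
move=> x0 x1.
have ex : exists k, x <= grid A n k by exists (cells A n); rewrite grid_last.
case: (ex_minnP ex) => -[|k] xk kmin.
  by move: xk; rewrite /grid mul0r addr0 leNgt x0.
exists k; first by apply: kmin; rewrite grid_last.
by rewrite /cell xk andbT ltNge; apply/negP => /kmin; rewrite ltnn.
Qed.

Lemma cell_uniq A n i j (x : R) : cell A n i x -> cell A n j x -> i = j.
Proof.
move=> /andP[i1 i2] /andP[j1 j2]; apply/eqP; rewrite eqn_leq -(ltnS i) -(ltnS j).
apply/andP; split; rewrite ltnNge -(grid_mono A n) -ltNge.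
  exact: lt_le_trans i1 j2.
exact: lt_le_trans j1 i2.
Qed.

Definition step (A n : nat) (z : R * R) : R :=
  \sum_(i < cells A n) \sum_(j < cells A n)
    g (grid A n i, grid A n j) * (cell A n i z.1 && cell A n j z.2)%:R.

Lemma step_close (A : nat) (e : R) : 0 < e -> exists n, forall z,
  `|g z - step A n z| <= e + M * (~~ inbox A z)%:R.
Proof.
move=> e0; have [n H] := uniform_on_box A%:R e0; exists n => z.
have M0 : 0 <= M by exact: le_trans (normr_ge0 _) (gM (0, 0)).
have [/and4P[x1 x2 y1 y2]|zb] := boolP (inbox A z).
  rewrite mulr0 addr0.
  have [i iK ci] := cell_ex n x1 x2; have [j jK cj] := cell_ex n y1 y2.
  rewrite /step (bigD1 (Ordinal iK))//= (bigD1 (Ordinal jK))//= ci cj mulr1.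
  rewrite big1 => [|j' jj]; last first.
    case cj' : (cell A n j' z.2); last by rewrite mulr0.
    by move: jj; rewrite -val_eqE /= (cell_uniq cj' cj) eqxx.
  rewrite big1 => [|i' ii]; last first.
    rewrite big1// => j' _; case ci' : (cell A n i' z.1); last by rewrite mulr0.
    by move: ii; rewrite -val_eqE /= (cell_uniq ci' ci) eqxx.
  rewrite !addr0.
  have near_grid k (x : R) : cell A n k x -> `|x - grid A n k| <= n.+1%:R^-1.
    move=> /andP[k1 k2]; rewrite ger0_norm ?subr_ge0 ?(ltW k1)// lerBlDl.
    by apply: (le_trans k2); rewrite /grid -natr1 mulrDl mul1r addrA.
  apply: H => /=; [by rewrite (ltW x1)|by rewrite (ltW y1)|exact: near_grid|exact: near_grid].
rewrite mulr1 /step big1 ?subr0; last first.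
  move=> i _; rewrite big1// => j _; case: andP; last by rewrite mulr0.
  move=> [/andP[i1 i2] /andP[j1 j2]]; case/negP: zb.
  have lo k : - A%:R <= grid A n k by rewrite /grid lerDl divr_ge0.
  have hi (k : 'I_(cells A n)) : grid A n k.+1 <= A%:R by rewrite -[leRHS](grid_last A n) grid_mono.
  by apply/and4P; split; [exact: le_lt_trans i1|exact: le_trans i2 _|exact: le_lt_trans j1|exact: le_trans j2 _].
by rewrite (le_trans (gM z))// lerDr ltW.
Qed.
End Grid.

Lemma continuous_measurable_fun_plane (R : realType) (h : R * R -> R) :
  continuous h -> measurable_fun setT h.
Proof.
move=> ch; have := @measurable_joint R _ R (fun t x => h (x, t)).
rewrite (_ : (fun p : R * R => h (p.1, p.2)) = h); last by apply/funext => -[].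
apply=> [t|x].
  apply: continuous_measurable_fun => x.
  apply: (cvg_comp (fun x => (x, t)) h); last exact: ch.
  exact: (cvg_pair cvg_id (cvg_cst _)).
move=> t; apply: (cvg_comp (fun t => (x, t)) h); last exact: ch.
exact: (cvg_pair (cvg_cst _) cvg_id).
Qed.

Section DensityLaw.
Variable R : realType.
Variables (g : R * R -> R) (M : R).
Hypothesis cg : continuous g.
Hypothesis gM : forall z, `|g z| <= M.
Variables (dm : measure_display) (U : measurableType dm) (m : {measure set U -> \bar R}) (q : U -> R).
Variables (z1 z2 : U -> R).
Hypothesis q0 : forall u, 0 <= q u.
Hypothesis Iq : m.-integrable setT (EFin \o q).
Hypothesis mz1 : measurable_fun setT z1.
Hypothesis mz2 : measurable_fun setT z2.

(** A weight [q] lets one argument serve both sides: constant 1 under [P N], and the limit density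
    under planar Lebesgue measure. *)
Definition wint (f : U -> R) := \int[m]_u (f u * q u).
Let bd (f : U -> R) := measurable_fun setT f /\ exists K, forall u, `|f u| <= K.

Lemma wint_igr f : bd f -> m.-integrable setT (fun u => (f u * q u)%:E).
Proof.
move=> [mf [K fK]]; have IK : m.-integrable setT (fun u => (K * q u)%:E).
  by under eq_fun do rewrite EFinM; exact: integrableZl.
apply: le_integrable IK => //.
  apply/measurable_EFinP; apply: measurable_funM => //.
  exact/measurable_EFinP/(measurable_int m).
move=> u _ /=; rewrite lee_fin !normrM ler_wpM2r//.
exact: le_trans (fK u) (ler_norm _).
Qed.

Lemma wintZ c f : bd f -> wint (fun u => c * f u) = c * wint f.
Proof.
move=> bf; rewrite /wint -RintegralZl//; last exact: (wint_igr bf).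
by apply: eq_Rintegral => u _; rewrite mulrA.
Qed.

Lemma wintB f h : bd f -> bd h -> wint (fun u => f u - h u) = wint f - wint h.
Proof.
move=> bf bh; rewrite /wint -RintegralB//; [|exact: (wint_igr bf)|exact: (wint_igr bh)].
by apply: eq_Rintegral => u _; rewrite mulrBl.
Qed.

Lemma wintD f h : bd f -> bd h -> wint (fun u => f u + h u) = wint f + wint h.
Proof.
move=> bf bh; rewrite /wint -RintegralD//; [|exact: (wint_igr bf)|exact: (wint_igr bh)].
by apply: eq_Rintegral => u _; rewrite mulrDl.
Qed.

Lemma bd_cst c : bd (fun=> c).
Proof. by split=> //; exists `|c|. Qed.

Lemma bdD f h : bd f -> bd h -> bd (fun u => f u + h u).
Proof.
move=> [mf [K fK]] [mh [L hL]]; split; first exact: measurable_funD.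
by exists (K + L) => u; apply: (le_trans (ler_normD _ _)); exact: lerD.
Qed.

Lemma bdZ c f : bd f -> bd (fun u => c * f u).
Proof.
move=> [mf [K fK]]; split; first exact: measurable_funM.
by exists (`|c| * K) => u; rewrite normrM ler_wpM2l.
Qed.

Lemma bd_sum (I : Type) (s : seq I) (F : I -> U -> R) :
  (forall i, bd (F i)) -> bd (fun u => \sum_(i <- s) F i u).
Proof.
move=> bF; elim: s => [|i s IH].
  by under eq_fun do rewrite big_nil; exact: bd_cst.
by under eq_fun do rewrite big_cons; exact: bdD.
Qed.

Lemma wint_sum (I : Type) (s : seq I) (F : I -> U -> R) :
  (forall i, bd (F i)) -> wint (fun u => \sum_(i <- s) F i u) = \sum_(i <- s) wint (F i).
Proof.
move=> bF; elim: s => [|i s IH].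
  rewrite big_nil /wint (_ : (fun u => _) = fun=> 0); first by rewrite Rintegral_cst// mul0r.
  by apply/funext => u; rewrite big_nil mul0r.
rewrite big_cons -IH -wintD//; last exact: bd_sum.
by congr wint; apply/funext => u; rewrite big_cons.
Qed.

Lemma wint_close f h k : bd f -> bd h -> bd k ->
  (forall u, `|f u - h u| <= k u) -> `|wint f - wint h| <= wint k.
Proof.
move=> bf bh bk fh; rewrite -wintB//.
have bfh : bd (fun u => f u - h u).
  under eq_fun do rewrite -[X in _ + X]mulN1r.
  exact: (bdD bf (bdZ (-1) bh)).
apply: (le_trans (le_normr_Rintegral _ (wint_igr bfh))) => //.
apply: le_Rintegral => //; last 2 first.
- exact: (wint_igr bk).
- by move=> u _; rewrite normrM (ger0_norm (q0 u)) ler_wpM2r.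
by have := integrable_abse (wint_igr bfh).
Qed.

Lemma bd_bool (b : U -> bool) : measurable [set u | b u] -> bd (fun u => (b u)%:R).
Proof.
move=> mb; split; last by exists 1 => u; case: (b u); rewrite ?normr1 ?normr0.
rewrite (_ : (fun u => _) = \1_[set u | b u]); first exact: measurable_indic.
apply/funext => u; rewrite indicE; congr (_ %:R); congr nat_of_bool.
by apply/idP/idP => [bu|]; [rewrite mem_set|rewrite inE].
Qed.

Lemma meas_slab (z : U -> R) (a b : R) : measurable_fun setT z -> measurable [set u | a < z u <= b].
Proof.
move=> mz; rewrite (_ : [set u | _] = setT `&` z @^-1` `]a, b]%classic); first exact: mz.
by apply/seteqP; split => u /=; rewrite in_itv/=; [move=> ->|case].
Qed.

Lemma meas_rect (a b c e : R) : measurable [set u | (a < z1 u <= b) && (c < z2 u <= e)].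
Proof.
rewrite (_ : [set u | _] = [set u | a < z1 u <= b] `&` [set u | c < z2 u <= e]).
  by apply: measurableI; exact: meas_slab.
by apply/seteqP; split => u /= => [/andP|] [-> ->].
Qed.

Definition rect (a b c e : R) (u : U) : R := ((a < z1 u <= b) && (c < z2 u <= e))%:R.

Lemma wint_step A n : wint (fun u => step g A n (z1 u, z2 u)) =
  \sum_(i < cells A n) \sum_(j < cells A n) g (grid R A n i, grid R A n j) *
    wint (rect (grid R A n i) (grid R A n i.+1) (grid R A n j) (grid R A n j.+1)).
Proof.
rewrite /step wint_sum; last first.
  by move=> i; apply: bd_sum => j; apply: bdZ; apply: bd_bool; exact: meas_rect.
apply: eq_bigr => i _; rewrite wint_sum; last first.
  by move=> j; apply: bdZ; apply: bd_bool; exact: meas_rect.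
by apply: eq_bigr => j _; rewrite wintZ//; apply: bd_bool; exact: meas_rect.
Qed.

Lemma wint_approx (A : nat) (e : R) n : wint (fun=> 1) = 1 ->
  (forall z, `|g z - step g A n z| <= e + M * (~~ inbox A z)%:R) ->
  `|wint (fun u => g (z1 u, z2 u)) - wint (fun u => step g A n (z1 u, z2 u))| <=
  e + M * (1 - wint (rect (- A%:R) A%:R (- A%:R) A%:R)).
Proof.
move=> w1 H.
have bg : bd (fun u => g (z1 u, z2 u)).
  split; last by exists M => u.
  apply: (measurableT_comp (f := g)); first exact: continuous_measurable_fun_plane.
  exact: measurable_fun_pair.
have bs : bd (fun u => step g A n (z1 u, z2 u)).
  by apply: bd_sum => i; apply: bd_sum => j; apply: bdZ; apply: bd_bool; exact: meas_rect.
have br : bd (rect (- A%:R) A%:R (- A%:R) A%:R) by apply: bd_bool; exact: meas_rect.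
have b1 := bd_cst 1.
have bn : bd (fun u => 1 - rect (- A%:R) A%:R (- A%:R) A%:R u).
  under eq_fun do rewrite -[X in _ + X]mulN1r.
  exact: (bdD b1 (bdZ (-1) br)).
apply: le_trans (wint_close bg bs (bdD (bdZ e b1) (bdZ M bn)) _) _.
  move=> u; apply: le_trans (H _) _; rewrite mulr1 lerD2l.
  rewrite /rect (_ : inbox _ _ = (- A%:R < z1 u <= A%:R) && (- A%:R < z2 u <= A%:R)).
    by case: (_ && _); rewrite /= ?subrr ?subr0.
  by rewrite /inbox /= andbA.
by rewrite (wintD (bdZ e b1) (bdZ M bn)) (wintZ e b1) (wintZ M bn) (wintB b1 br) w1 mulr1.
Qed.
End DensityLaw.

Lemma cvg_sumr (R : realType) (I : Type) (s : seq I) (F : I -> nat -> R) (l : I -> R) :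
  (forall i, F i @ \oo --> l i) -> (fun n => \sum_(i <- s) F i n) @ \oo --> \sum_(i <- s) l i.
Proof.
move=> H; elim: s => [|i s IH].
  by rewrite big_nil; under eq_fun do rewrite big_nil; exact: cvg_cst.
by rewrite big_cons; under eq_fun do rewrite big_cons; exact: cvgD.
Qed.

(** Tightness is asked of the limit alone: the mass of one large box converges too, so the
    approximating laws lose little mass outside it. Inside the box [g] is replaced by a step
    function, a finite combination of rectangles. *)
Lemma weak_cvg (R : realType) (g : R * R -> R) (M : R) (d : measure_display) (T : nat -> measurableType d)
   (P : forall N, {measure set (T N) -> \bar R}) (p : forall N, T N -> R)
   (X Y : forall N, T N -> R)
   (d' : measure_display) (U : measurableType d') (m : {measure set U -> \bar R}) (q x y : U -> R) :
  continuous g -> (forall z, `|g z| <= M) ->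
  (forall N w, 0 <= p N w) -> (forall N, (P N).-integrable setT (EFin \o p N)) ->
  (forall N, measurable_fun setT (X N)) -> (forall N, measurable_fun setT (Y N)) ->
  (forall u, 0 <= q u) -> m.-integrable setT (EFin \o q) ->
  measurable_fun setT x -> measurable_fun setT y ->
  (forall N, wint (P N) (p N) (fun=> 1) = 1) -> wint m q (fun=> 1) = 1 ->
  (forall a b c e, a <= b -> c <= e ->
     (fun N => wint (P N) (p N) (rect (X N) (Y N) a b c e)) @ \oo --> wint m q (rect x y a b c e)) ->
  (forall e : R, 0 < e -> exists A : nat, 1 - e <= wint m q (rect x y (- A%:R) A%:R (- A%:R) A%:R)) ->
  (fun N => wint (P N) (p N) (fun w => g (X N w, Y N w))) @ \oo --> wint m q (fun u => g (x u, y u)).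
Proof.
move=> cg gM p0 Ip mX mY q0 Iq mx my P1 m1 cR tight.
have M0 : 0 <= M by exact: le_trans (normr_ge0 _) (gM (0, 0)).
apply/cvgrPdist_le => e e0.
have e5 : 0 < e / 6 by rewrite divr_gt0.
have eM : 0 < e / (6 * (M + 1)) by rewrite divr_gt0// mulr_gt0// ltr_wpDl.
have [A HA] := tight _ eM.
have [n Hn] := step_close cg gM A e5.
have AA : - A%:R <= A%:R :> R by rewrite (@le_trans _ _ 0)// oppr_le0.
have box := cR _ _ _ _ AA AA.
have cS : (fun N => wint (P N) (p N) (fun w => step g A n (X N w, Y N w))) @ \oo -->
    wint m q (fun u => step g A n (x u, y u)).
  rewrite wint_step//.
  under eq_fun do rewrite wint_step//.
  apply: cvg_sumr => i; apply: cvg_sumr => j; apply: cvgM; first exact: cvg_cst.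
  by apply: cR; rewrite grid_mono.
have e5' : 0 < M * (e / (6 * (M + 1))) + e / 6 by rewrite ltr_wpDl// mulr_ge0// ltW.
move/cvgrPdist_le : cS => /(_ _ e5) cS.
have cB : (fun N => M * (1 - wint (P N) (p N) (rect (X N) (Y N) (- A%:R) A%:R (- A%:R) A%:R))) @ \oo -->
   M * (1 - wint m q (rect x y (- A%:R) A%:R (- A%:R) A%:R)).
  by apply: cvgM; [exact: cvg_cst|apply: cvgB => //; exact: cvg_cst].
have Me : M * (e / (6 * (M + 1))) <= e / 6.
  rewrite (_ : M * _ = e / 6 * (M / (M + 1))); last by field; rewrite gt_eqF// ltr_wpDl.
  by rewrite ler_piMr ?(ltW e5)// ler_pdivrMr ?ltr_wpDl// mul1r lerDl.
have mm : M * (1 - wint m q (rect x y (- A%:R) A%:R (- A%:R) A%:R)) <= e / 6.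
  by apply: le_trans Me; rewrite ler_wpM2l// lerBlDr -lerBlDl.
have {}cB : \forall N \near \oo, M * (1 - wint (P N) (p N) (rect (X N) (Y N) (- A%:R) A%:R (- A%:R) A%:R)) < e / 6 + e / 6.
  by apply: (cvgr_lt _ cB); rewrite (le_lt_trans mm)// ltrDl.
near=> N.
have h1 := wint_approx cg gM q0 Iq mx my m1 Hn.
have h2 := wint_approx cg gM (p0 N) (Ip N) (mX N) (mY N) (P1 N) Hn.
have h3 : `|wint m q (fun u => step g A n (x u, y u)) - wint (P N) (p N) (fun w => step g A n (X N w, Y N w))| <= e / 6.
  by near: N.
have h4 : M * (1 - wint (P N) (p N) (rect (X N) (Y N) (- A%:R) A%:R (- A%:R) A%:R)) < e / 6 + e / 6 by near: N.
move: h1 h2 h3 h4 mm.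
move: (wint m q (fun u => g _)) (wint m q (fun u => step _ _ _ _)) => a b.
move: (wint (P N) (p N) (fun u => g _)) (wint (P N) (p N) (fun u => step _ _ _ _)) => a' b'.
move: (M * _) (M * _) => r s h1 h2 h3 h4 h5.
rewrite (_ : a - a' = (a - b) + (b - b') - (a' - b')); last by ring.
apply: (le_trans (ler_normB _ _)).
apply: (le_trans (lerD (ler_normD _ _) (lexx _))).
apply: (le_trans (lerD (lerD h1 h3) h2)); lra.
Unshelve. all: by end_near. Qed.

(** * The limit law *)

Section LimitLaw.
Variable R : realType.
Local Notation mu := (@lebesgue_measure R).
Local Notation gamma := (@gumbel_pdf R).
Local Notation phi := (@phi R).

Definition gumbel_cdf (x : R) : R := expR (- expR (- x)).

Lemma gumbel_pdf_ge0 x : 0 <= gamma x.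
Proof. by rewrite mulr_ge0 ?expR_ge0. Qed.

Lemma d_gumbel_cdf x : is_derive x (1 : R) gumbel_cdf (gamma x).
Proof.
have h (y : R) : is_derive y (1 : R) (fun y => - expR (- y)) (expR (- y)).
  have := dZ (-1) (dexp (-1) 0 y).
  rewrite (_ : (fun _ => _) = (fun y => - expR (- y))); last first.
    by apply/funext => z; rewrite addr0 !mulN1r.
  by move/is_derive_eq; apply; rewrite addr0 !mulN1r opprK.
apply: is_derive_eq (dcomp (is_derive_expR _) (h x)) _.
by rewrite /gumbel_pdf mulrC.
Qed.

Lemma gumbel_pdf_continuous : continuous gamma.
Proof.
have h : continuous (fun x : R => expR (- x)).
  by move=> x; apply: continuous_comp; [exact: continuousN|exact: continuous_expR].
move=> x; apply: cvgM; first exact: h.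
exact: (d_continuous d_gumbel_cdf).
Qed.

Lemma gumbel_pdf_meas : measurable_fun setT gamma.
Proof. exact: continuous_measurable_fun gumbel_pdf_continuous. Qed.

Lemma gumbel_itv (a b : R) : a <= b ->
  (\int[mu]_(x in `]a, b]) (gamma x)%:E = (gumbel_cdf b - gumbel_cdf a)%:E)%E.
Proof.
rewrite le_eqVlt => /predU1P[->|ab]; first by rewrite set_itvoc0 integral_set0 subrr.
have mg : measurable_fun setT (fun x => (gamma x)%:E).
  by apply/measurable_EFinP; exact: gumbel_pdf_meas.
rewrite integral_itv_obnd_cbnd; last exact: measurable_funTS.
have cG : continuous gumbel_cdf by exact: (d_continuous d_gumbel_cdf).
rewrite (continuous_FTC2 (F := gumbel_cdf) ab)//.
- by apply: continuous_subspaceT; exact: gumbel_pdf_continuous.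
- split => [x _| |].
  + by have [] := d_gumbel_cdf x.
  + by apply: cvg_at_right_filter; exact: cG.
  + by apply: cvg_at_left_filter; exact: cG.
- by move=> x _; rewrite derive1E; have [_] := d_gumbel_cdf x.
Qed.

Lemma expN_nat_cvg0 : (fun n : nat => expR (- n%:R)) @ \oo --> (0 : R).
Proof.
have := @expR_nat_cvg0 R 1 0 ltr01.
by under eq_fun do rewrite subr0 mulN1r.
Qed.

Lemma gumbel_cdf_top (e : R) : 0 < e -> \forall n \near \oo, 1 - e <= gumbel_cdf n%:R.
Proof.
move=> e0.
have h : continuous (fun x : R => expR (- x)).
  by move=> x; apply: continuous_comp; [exact: continuousN|exact: continuous_expR].
have c : (fun n : nat => gumbel_cdf n%:R) @ \oo --> expR (- 0 : R).
  exact: (cvg_comp (fun n : nat => expR (- n%:R)) (fun x : R => expR (- x)) expN_nat_cvg0 (@h 0)).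
by rewrite oppr0 expR0 in c; apply: (cvgr_ge _ c); rewrite gtrBl.
Qed.

Lemma gumbel_cdf_bot (e : R) : 0 < e -> \forall n \near \oo, gumbel_cdf (- n%:R) <= e.
Proof.
move=> e0; have := expN_nat_cvg0.
move=> /(cvgr_lt _) /(_ _ e0); apply: filterS => n; move/ltW; apply: le_trans.
rewrite /gumbel_cdf opprK ler_expR lerN2.
by apply: le_trans (expR_ge1Dx _); rewrite lerDr.
Qed.

(** Exhaust the line by []- n, n]], where the integral is an increment of [gumbel_cdf]. *)
Lemma gumbel_total : (\int[mu]_x (gamma x)%:E = 1)%E.
Proof.
have mg : measurable_fun setT (fun x => (gamma x)%:E).
  by apply/measurable_EFinP; exact: gumbel_pdf_meas.
pose S (n : nat) : set R := `]- n%:R, n%:R]%classic.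
have ndS : nondecreasing_seq S.
  move=> i j ij; rewrite subsetEset; move=> x; rewrite /S/= !in_itv/= => /andP[h1 h2].
  rewrite (le_lt_trans _ h1) ?lerN2 ?ler_nat//= (le_trans h2)//.
  by rewrite ler_nat.
have cv := @ge0_nondecreasing_set_cvg_integral _ (measurableTypeR R) R S _ mu ndS
  (fun i => measurable_itv _) (fun i => measurable_funTS mg) (fun i x _ => (gumbel_pdf_ge0 x : (0 <= (gamma x)%:E)%E)).
have ST : \bigcup_i S i = setT.
  apply/seteqP; split => // x _; exists (Num.truncn `|x|).+1 => //=.
  have := truncnS_gt `|x|; rewrite /S/= ltr_norml in_itv/= => /andP[-> /ltW ->]//.
rewrite ST in cv; apply: (cvg_unique _ cv) => //.
have -> : (fun i => \int[mu]_(x in S i) (gamma x)%:E)%E = (fun i : nat => (gumbel_cdf i%:R - gumbel_cdf (- i%:R))%:E).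
  by apply/funext => i; rewrite gumbel_itv// (@le_trans _ _ 0)// oppr_le0.
apply: cvg_EFin; first by near=> n.
rewrite -[X in _ --> X]subr0; apply: cvgB.
  apply/cvgrPdist_le => e /gumbel_cdf_top; apply: filterS => n h.
  rewrite ger0_norm ?subr_ge0 ?lerBlDr -?lerBlDl//.
  by rewrite -expR0 ler_expR oppr_le0 expR_ge0.
apply/cvgrPdist_le => e /gumbel_cdf_bot; apply: filterS => n h.
by rewrite sub0r normrN ger0_norm// expR_ge0.
Unshelve. all: by end_near. Qed.

Local Notation m2 := (mu \x mu)%E.

Lemma prod_integral (u v : R -> R) : measurable_fun setT u -> measurable_fun setT v ->
  (forall x, 0 <= u x) -> (forall x, 0 <= v x) ->
  (\int[m2]_z (u z.1 * v z.2)%:E = (\int[mu]_x (u x)%:E) * (\int[mu]_y (v y)%:E))%E.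
Proof.
move=> mu_ mv u0 v0.
have mf : measurable_fun setT (fun z : R * R => (u z.1 * v z.2)%:E).
  apply/measurable_EFinP; apply: measurable_funM.
    exact: (measurableT_comp mu_ measurable_fst).
  exact: (measurableT_comp mv measurable_snd).
have f0 z : (0 <= (u z.1 * v z.2)%:E)%E by rewrite lee_fin mulr_ge0.
apply: etrans (@fubini_tonelli1 _ _ (measurableTypeR R) (measurableTypeR R) R mu mu _ mf f0) _.
rewrite /fubini_F/=.
have mvE : measurable_fun setT (fun y => (v y)%:E) by exact/measurable_EFinP.
transitivity (\int[mu]_x ((u x)%:E * \int[mu]_y (v y)%:E))%E.
  apply: eq_integral => x _; under eq_integral do rewrite EFinM.
  by rewrite ge0_integralZl ?lee_fin// => y _; rewrite lee_fin.
have [v_ v_0] : exists v_, (\int[mu]_y (v y)%:E = v_)%E /\ (0 <= v_)%E.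
  by exists (\int[mu]_y (v y)%:E)%E; split => //; apply: integral_ge0 => y _; rewrite lee_fin.
rewrite ge0_integralZr//; first exact/measurable_EFinP.
  by move=> x _; rewrite lee_fin.
by apply: integral_ge0 => y _; rewrite lee_fin.
Qed.

Definition limit_pdf (z : R * R) : R := gamma z.1 * phi z.2.

Lemma limit_pdf_ge0 z : 0 <= limit_pdf z.
Proof. by rewrite mulr_ge0 ?gumbel_pdf_ge0 ?phi_ge0. Qed.

Lemma phi_meas : measurable_fun setT phi.
Proof. exact: measurable_normal_pdf. Qed.

Lemma limit_pdf_meas : measurable_fun setT limit_pdf.
Proof.
apply: measurable_funM.
  exact: (measurableT_comp gumbel_pdf_meas measurable_fst).
exact: (measurableT_comp phi_meas measurable_snd).
Qed.

Lemma limit_pdf_total : (\int[m2]_z (limit_pdf z)%:E = 1)%E.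
Proof.
rewrite /limit_pdf (prod_integral gumbel_pdf_meas phi_meas gumbel_pdf_ge0 (@phi_ge0 R)).
by rewrite gumbel_total (integral_normal_pdf 0 1) mule1.
Qed.

Lemma limit_pdf_igr : m2.-integrable setT (EFin \o limit_pdf).
Proof.
apply/integrableP; split; first by apply/measurable_EFinP; exact: limit_pdf_meas.
under eq_integral do rewrite gee0_abs ?lee_fin ?limit_pdf_ge0//.
by rewrite limit_pdf_total ltry.
Qed.

Lemma limit_one : wint m2 limit_pdf (fun=> 1) = 1.
Proof.
rewrite /wint /Rintegral; under eq_integral do rewrite mul1r.
by rewrite limit_pdf_total.
Qed.

Lemma phi_itv (c e : R) : c <= e ->
  (\int[mu]_(y in `]c, e]) (phi y)%:E = (Phi e - Phi c)%:E)%E.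
Proof.
move=> ce; pose Q : probability _ R := normal_prob (0 : R) 1.
have -> : (\int[mu]_(y in `]c, e]) (phi y)%:E = Q `]c, e]%classic)%E by [].
have E : Q `]-oo, e]%classic = (Q `]-oo, c]%classic + Q `]c, e]%classic)%E.
  rewrite -measureU//; last first.
    by apply/seteqP; split => // y /=; rewrite !in_itv/= => -[yc /andP[]]; rewrite ltNge yc.
  congr (Q _); apply/seteqP; split => y /=; rewrite !in_itv/=.
    by move=> ye; have [|] := leP y c; [left|right].
  by move=> [yc|/andP[]//]; exact: le_trans ce.
rewrite /Phi -/Q E fineD ?fin_num_measure//.
by rewrite addrC addKr fineK// fin_num_measure.
Qed.

Lemma limit_rect (a b c e : R) : a <= b -> c <= e ->
  wint m2 limit_pdf (rect fst snd a b c e) = (gumbel_cdf b - gumbel_cdf a) * (Phi e - Phi c).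
Proof.
move=> ab ce; rewrite /wint /Rintegral.
pose u x := \1_(`]a, b]%classic : set R) x * gamma x : R.
pose v x := \1_(`]c, e]%classic : set R) x * phi x : R.
have i01 (S : set R) x : 0 <= (\1_S x : R) by rewrite indicE.
transitivity (fine (\int[m2]_z (u z.1 * v z.2)%:E)%E).
  congr fine; apply: eq_integral => -[x y] _; congr EFin.
  rewrite /rect /u /v /limit_pdf /= mulrACA; congr (_ * _).
  rewrite !indicE !mem_setE/= !in_itv/=.
  by case: (a < x <= b); rewrite ?mul1r ?mul0r//=; case: (_ < _ <= _).
rewrite prod_integral; last 4 first.
- by apply: measurable_funM; [exact: measurable_indic|exact: gumbel_pdf_meas].
- by apply: measurable_funM; [exact: measurable_indic|exact: phi_meas].
- by move=> x; rewrite mulr_ge0 ?gumbel_pdf_ge0.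
- by move=> x; rewrite mulr_ge0 ?phi_ge0.
have I (S : set R) (f : R -> R) : (\int[mu]_x (\1_S x * f x)%:E = \int[mu]_(x in S) (f x)%:E)%E.
  rewrite [RHS]integral_mkcond; apply: eq_integral => x _.
  by rewrite patchE indicE; case: (x \in S); rewrite ?mul1r ?mul0r.
by rewrite /u /v !I gumbel_itv// phi_itv// -EFinM.
Qed.

Lemma limit_tight (e : R) : 0 < e -> exists A : nat,
  1 - e <= wint m2 limit_pdf (rect fst snd (- A%:R) A%:R (- A%:R) A%:R).
Proof.
move=> e0; have e4 : 0 < e / 4 by rewrite divr_gt0.
have [n1 H1] := Phi_top e4; have [n2 H2] := Phi_bot e4.
have [N _ HN] : \forall n \near \oo, 1 - e / 4 <= gumbel_cdf n%:R /\ gumbel_cdf (- n%:R) <= e / 4.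
  near=> n; split; near: n; [exact: gumbel_cdf_top|exact: gumbel_cdf_bot].
pose A := maxn N (maxn n1 n2); exists A.
have AA : - A%:R <= A%:R :> R by rewrite (@le_trans _ _ 0)// oppr_le0.
rewrite limit_rect//; have [g1 g2] := HN A (leq_maxl _ _).
have p1 : 1 - e / 4 <= Phi A%:R.
  by apply: (le_trans H1); apply: Phi_mono; rewrite ler_nat /A !leq_max leqnn orbT.
have p2 : Phi (- A%:R) <= e / 4.
  by apply: le_trans H2; apply: Phi_mono; rewrite lerN2 ler_nat /A !leq_max leqnn !orbT.
have /andP[p3 p4] := Phi01 (- A%:R : R); have /andP[_ p5] := Phi01 (A%:R : R).
have g3 : 0 <= gumbel_cdf (- A%:R) by exact: expR_ge0.
have g4 : gumbel_cdf A%:R <= 1 by rewrite -expR0 ler_expR oppr_le0 expR_ge0.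
have [e1|e1] := leP 1 e.
  rewrite (@le_trans _ _ 0) ?subr_le0// mulr_ge0// subr_ge0 ?Phi_mono//.
  by rewrite ler_expR lerN2 ler_expR lerN2.
apply: (@le_trans _ _ ((1 - e / 2) * (1 - e / 2))); last first.
  clear -g1 g2 p1 p2 e1; by apply: ler_pM; lra.
have : 0 <= e / 2 * (e / 2) by rewrite mulr_ge0// divr_ge0// ltW.
have key (x : R) : (1 - x / 2) * (1 - x / 2) = 1 - x + x / 2 * (x / 2) by field.
by move=> h; rewrite key lerDl.
Unshelve. all: by end_near. Qed.

Lemma limit_iterated (g : R * R -> R) (M : R) : continuous g -> (forall z, `|g z| <= M) ->
  (wint m2 limit_pdf g)%:E =
  (\int[mu]_x \int[mu]_y (g (x, y) * gamma x * normal_pdf 0 1 y)%:E)%E.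
Proof.
move=> cg gM.
have Ig : m2.-integrable setT (fun z => (g z * limit_pdf z)%:E).
  apply: wint_igr => //; first exact: limit_pdf_igr.
  by split; [exact: continuous_measurable_fun_plane|exists M].
rewrite /wint /Rintegral fineK; last exact: integrable_fin_num.
rewrite -(integral12_prod_meas1 Ig)/= /fubini_F.
by apply: eq_integral => x _; apply: eq_integral => y _; rewrite /limit_pdf /= mulrA.
Qed.
End LimitLaw.

(** * The covering index *)

Section Cover.
Context {R : realType} {d : measure_display} {T : measurableType d}.
Variable P : probability T R.
Variables (N : nat) (i0 : 'I_N) (X : 'I_N -> R -> T -> R).
Hypothesis hX : spider_BM P X.

Definition cycles_cover (k : nat) (w : T) : Prop := covered (fun i t => X i t w) k.
Definition covering_time (w : T) : \bar R := cover_time (fun i t => X i t w).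
Definition nu (w : T) : nat :=
  xget 0%N [set k | cycles_cover k w /\ forall j, cycles_cover j w -> (k <= j)%N].

(** Selects the sequences completed exactly by their last entry, so that [nu = n] becomes a
    condition on the visited legs alone. *)
Definition first n : pred (n.-tuple 'I_N) :=
  fun t => [forall i, i \in t] && ~~ [forall i, i \in take n.-1 (tval t)].

Local Notation legs := (legs i0 X).
Local Notation legev := (@legev R d T N i0 X _).
Local Notation Cv n := (legev (@first n)).

Lemma coveredP k w : (sg X k w < +oo)%E -> cycles_cover k w <-> [forall i, i \in legs k w].
Proof.
move=> soo; split.
  move=> H; apply/forallP => i; have [[|j] [/andP[// _ jk] [r [rE xr]]]] := H i.
  have EE : EL X (sg X j) i w by split; rewrite /rho_of -/(cov_rho _ j.+1) -?[cov_sigma _ _]/(sg X j w) rE//= ltry.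
  have <- : tnth (legs k w) (Ordinal jk) = i by rewrite tnth_mktuple; apply/(legP i0 hX i jk soo).
  exact: mem_tnth.
move=> /forallP H i; have /tnthP[j] := H i; rewrite tnth_mktuple => E.
have /(legP i0 hX i (ltn_ord j) soo) [roo xr] := esym E.
exists j.+1; split; first by rewrite /= ltn_ord.
exists (fine (rho_of X (sg X j) w)); split=> //.
have [sa _] := stopping_sg hX j.
have := roo; have : (0 <= rho_of X (sg X j) w)%E := le_trans (sa.1 w) (rho_ge sa w).
by rewrite /cov_rho /= -/(rho_of X (sg X j) w); case: (rho_of X (sg X j) w).
Qed.

Lemma cycles_cover_mono j k w : (j <= k)%N -> cycles_cover j w -> cycles_cover k w.
Proof.
move=> jk H i; have [l [/andP[l1 lj] h]] := H i; exists l; split => //.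
by rewrite l1 (leq_trans lj).
Qed.

Lemma cycles_cover0 w : ~ cycles_cover 0 w.
Proof. by move=> /(_ i0)[j [/andP[j1 j0]]]; rewrite leqn0 in j0; rewrite (eqP j0) in j1. Qed.

Lemma legsE n w : tval (legs n w) = mkseq (fun k => leg i0 X k w) n.
Proof.
apply: (@eq_from_nth _ i0); first by rewrite size_tuple size_mkseq.
move=> k; rewrite size_tuple => kn; rewrite nth_mkseq//.
by rewrite -[k]/(val (Ordinal kn)) -tnth_nth tnth_mktuple.
Qed.

Lemma firstP n w : (sg X n w < +oo)%E ->
  first (legs n w) <-> cycles_cover n w /\ ~ cycles_cover n.-1 w.
Proof.
move=> soo; have soo' : (sg X n.-1 w < +oo)%E := le_lt_trans (sg_leq hX w (leq_pred n)) soo.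
have E : take n.-1 (tval (legs n w)) = tval (legs n.-1 w).
  by rewrite !legsE -map_take take_iota; congr (map _ (iota _ _)); apply/minn_idPl; exact: leq_pred.
rewrite /first E.
split=> [/andP[h1 h2]|[/(coveredP soo) -> h2]] /=.
  split; first exact/(coveredP soo).
  by move=> /(coveredP soo') h; rewrite h in h2.
by apply/negP => h; apply: h2; exact/(coveredP soo').
Qed.

Lemma nu_min k w : cycles_cover k w -> cycles_cover (nu w) w /\ forall j, cycles_cover j w -> (nu w <= j)%N.
Proof.
move=> ck; have ex : exists k, `[< cycles_cover k w >] by exists k; apply/asboolP.
rewrite -[_ /\ _]/([set k | cycles_cover k w /\ forall j, cycles_cover j w -> (k <= j)%N] (nu w)).
apply: xgetPex; case: (ex_minnP ex) => m /asboolP cm mm.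
by exists m; split => // j cj; apply: mm; exact/asboolP.
Qed.

Lemma covering_time_sg k w : cycles_cover k w -> covering_time w = sg X (nu w) w.
Proof. by move=> ck; rewrite /covering_time /cover_time ifT//; apply/asboolP; exists k. Qed.

(** On this event the random index is the constant [n], which makes quantities evaluated at [nu]
    accessible to [legev_heat]. *)
Lemma first_nu n w : Cv n w -> nu w = n /\ covering_time w = sg X n w.
Proof.
move=> [soo /(firstP soo)[cn cn1]]; have [c1 c2] := nu_min cn.
have E : nu w = n.
  apply/eqP; rewrite eqn_leq c2//= leqNgt; apply/negP => lt; apply: cn1.
  by apply: cycles_cover_mono c1; case: (n) lt.
by rewrite (covering_time_sg cn) E.
Qed.

Lemma covering_time_first w : (covering_time w < +oo)%E -> Cv (nu w) w.
Proof.
move=> too; have [k ck] : exists k, cycles_cover k w.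
  by move: too; rewrite /covering_time /cover_time; case: asboolP => // [[k ck] _]; exists k.
rewrite (covering_time_sg ck) in too; split => //; apply/(firstP too).
have [c1 c2] := nu_min ck; split => // h; have := c2 _ h.
by case E : (nu w) c1 => [|m]; [move=> /cycles_cover0|rewrite /= ltnn].
Qed.

Lemma covering_time_fin w : (covering_time w < +oo)%E <-> exists n, Cv n w.
Proof.
split=> [/covering_time_first h|[n Cn]]; first by exists (nu w).
by have [_ ->] := first_nu Cn; case: Cn.
Qed.

Lemma covering_time_meas : measurable [set w | (covering_time w < +oo)%E].
Proof.
rewrite (_ : [set w | _] = \bigcup_n Cv n).
  by apply: bigcupT_measurable => n; exact: (legev_meas i0 hX).
by apply/seteqP; split => w /= => [/covering_time_fin[n Cn]|[n _ Cn]]; [exists n|apply/covering_time_fin; exists n].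
Qed.

(** The [N ^ n] patterns have probability [N ^- n] each, a value found by letting [l] tend to 0 in
    the Laplace transform; almost sure return therefore needs no separate argument. *)
Lemma P_sg n : P [set w | (sg X n w < +oo)%E] = 1%E.
Proof.
have E : [set w | (sg X n w < +oo)%E] = legev (@predT (n.-tuple 'I_N)).
  by apply/seteqP; split => w //=; case.
have m1 : measurable [set w | (sg X n w < +oo)%E] by rewrite E; exact: (legev_meas i0 hX).
rewrite -[LHS]fineK ?fin_num_measure// E (P_legev i0 hX).
rewrite card_tuple card_ord natrX divff// expf_neq0// pnatr_eq0.
by rewrite -lt0n (leq_ltn_trans _ (ltn_ord i0)).
Qed.

(** Coverage within [n + 1] cycles splits according to whether [n] cycles already sufficed. *)
Lemma P_first n : fine (P (Cv n.+1)) = coupon R N n.+1 - coupon R N n.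
Proof.
rewrite /coupon -!(P_legev i0 hX).
pose S : set T := [set w | (sg X n.+1 w < +oo)%E].
have mS : measurable S by case: (past_fin hX (stopping_sg hX n.+1).1).
have mL k (Q : pred (k.-tuple 'I_N)) : measurable (legev Q) by exact: (legev_meas i0 hX).
(* Events indexed by [n] require only [n] completed cycles; by [P_sg], asking for one more changes
   no probability. *)
have -> : fine (P (legev (@onto N n))) = fine (P (legev (@onto N n) `&` S)).
  congr fine; apply/eqP; rewrite eq_le; apply/andP; split; last first.
    by apply: le_measure; rewrite ?inE//; exact: measurableI.
  have PC : P (~` S) = 0%E by rewrite probability_setC// P_sg subee.
  rewrite -[X in (P X <= _)%E](setUIDK (legev (@onto N n)) S).
  have mI : measurable (legev (@onto N n) `&` S) by exact: measurableI.
  have mD : measurable (legev (@onto N n) `\` S) by exact: measurableD.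
  apply: (le_trans (measureU2 P mI mD)).
  rewrite -[leRHS]adde0; apply: leeD => //; rewrite -PC; apply: le_measure; rewrite ?inE//.
  exact: measurableC.
have -> : legev (@onto N n.+1) = Cv n.+1 `|` (legev (@onto N n) `&` S).
  apply/seteqP; split => w /=.
    move=> [soo on]; have [c|c] := pselect (cycles_cover n w); [right|left].
      have soo' := le_lt_trans (sg_le hX n w) soo.
      by split => //; split => //; apply/(coveredP soo').
    by split => //; apply/(firstP soo); split => //; apply/(coveredP soo).
  move=> [[soo]|[[soo' on] soo]].
    by move=> /(firstP soo)[c _]; split => //; apply/(coveredP soo).
  split => //; apply/(coveredP soo); apply: (cycles_cover_mono (leqnSn n)).
  exact/(coveredP soo').
rewrite measureU ?fineD ?fin_num_measure ?addrK//; [exact: measurableI|exact: measurableI|].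
apply/seteqP; split => // w [[soo /(firstP soo)[_ c]] [[soo' on] _]]; apply: c.
exact/(coveredP soo').
Qed.

(** Taken at an [n] where the coupon probability is close to 1, this makes the uncovered event
    negligible in [uncovered_small]. *)
Lemma coupon_covering_time n : coupon R N n <= fine (P [set w | (covering_time w < +oo)%E]).
Proof.
rewrite /coupon -(P_legev i0 hX).
have mC := covering_time_meas; have mO : measurable (legev (@onto N n)) by exact: (legev_meas i0 hX).
apply: fine_le; rewrite ?fin_num_measure//; apply: le_measure; rewrite ?inE//.
move=> w [soo /(coveredP soo) c] /=; rewrite (covering_time_sg c).
by apply: le_lt_trans soo; apply: (sg_leq hX); have [_ ->] := nu_min c.
Qed.

(** Evaluation at the random index, with 0 where the spider is never covered; it is measurable as
    the limit of finite sums over the disjoint events [nu = k]. *)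
Definition atcover (F : nat -> T -> R) (w : T) : R :=
  if (covering_time w < +oo)%E then F (nu w) w else 0.

Lemma atcover_meas F : (forall n, measurable_fun setT (F n)) -> measurable_fun setT (atcover F).
Proof.
move=> mF; apply: (@measurable_fun_cvg _ _ _ _ (fun n w => \sum_(k < n) \1_(Cv k) w * F k w)).
  move=> n; apply: measurable_sum => k; apply: measurable_funM => //.
  by apply: measurable_indic; exact: (legev_meas i0 hX).
move=> w _; rewrite /atcover; case: ifPn => too.
  have Cw := covering_time_first too; apply: cvg_near_cst; exists (nu w).+1 => // n /= nn.
  rewrite (bigD1 (Ordinal nn))//= big1 ?addr0; first by rewrite indicE mem_set// mul1r.
  move=> k kn; rewrite indicE memNset ?mul0r// => /first_nu[E _].
  by move: kn; rewrite -val_eqE /= E eqxx.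
apply: cvg_near_cst; near=> n; rewrite big1// => k _.
rewrite indicE memNset ?mul0r// => Ck; apply: (negP too); apply/covering_time_fin; by exists k.
Unshelve. all: by end_near. Qed.

Definition slab (n1 n2 : nat) : set T := [set w | (covering_time w < +oo)%E /\ (n1 < nu w <= n2)%N].

Lemma slab_sum n1 n2 F w : (n1 <= n2)%N -> \1_(slab n1 n2) w * F (nu w) =
  \sum_(n1 <= m < n2) \1_(Cv m.+1) w * F m.+1 :> R.
Proof.
move=> n12; have [sl|sl] := pselect (slab n1 n2 w).
  have [too /andP[l1 l2]] := sl; rewrite indicE mem_set// mul1r.
  have Cw := covering_time_first too; case E : (nu w) l1 l2 Cw => [//|m] l1 l2 Cw.
  rewrite (bigD1_seq m)/= ?iota_uniq//; last by rewrite mem_index_iota -ltnS l1.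
  rewrite indicE mem_set// mul1r big1 ?addr0// => k km.
  rewrite indicE memNset ?mul0r// => /first_nu[]; rewrite E => -[km' _].
  by rewrite km' eqxx in km.
rewrite indicE memNset// mul0r big_nat big1// => m /andP[m1 m2].
rewrite indicE memNset ?mul0r// => Cm; apply: sl; have [E _] := first_nu Cm.
by split; [apply/covering_time_fin; exists m.+1|rewrite E ltnS m1].
Qed.

Lemma slab_meas n1 n2 : measurable (slab n1 n2).
Proof.
rewrite (_ : slab n1 n2 = \bigcup_(m in [set m | (n1 < m <= n2)%N]) Cv m).
  by apply: bigcup_measurable => m _; exact: (legev_meas i0 hX).
apply/seteqP; split => w /=; first by move=> [too l]; exists (nu w) => //; exact: covering_time_first.
by move=> [m /= l Cm]; have [E _] := first_nu Cm; split; [apply/covering_time_fin; exists m|rewrite E].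
Qed.

Lemma P_slab n1 n2 : (n1 <= n2)%N -> fine (P (slab n1 n2)) = coupon R N n2 - coupon R N n1.
Proof.
move=> n12; rewrite -E_ind; last exact: slab_meas.
rewrite (eqE _ (g := fun w => \sum_(n1 <= m < n2) \1_(Cv m.+1) w * 1)); last first.
  by move=> w; rewrite -(slab_sum (fun=> 1))// mulr1.
rewrite E_sum; last first.
  by move=> m; apply/bmf_igr/bmfM; [apply: bmf_ind; exact: (legev_meas i0 hX)|exact: bmf_cst].
rewrite -telescope_sumr//; apply: eq_bigr => m _.
by under eqE do rewrite mulr1; rewrite E_ind ?P_first//; exact: (legev_meas i0 hX).
Qed.
End Cover.

(** * The law of the duration on a slab of the covering index *)

Section Sandwich.
Variable R : realType.

(** At small variance [heat] is a smoothed indicator of [y <= b]; moving the threshold by [kap]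
    absorbs the transition zone up to [e]. *)
Lemma heat_sandwich (b kap v y e : R) : 0 < v -> 0 <= e ->
  1 - e <= Phi (kap / Num.sqrt v) -> Phi (- (kap / Num.sqrt v)) <= e ->
  heat (b - kap) v y - e <= (y <= b)%R%:R <= heat (b + kap) v y + e.
Proof.
move=> v0 e0 top bot; have s0 : 0 <= (Num.sqrt v)^-1 by rewrite invr_ge0 sqrtr_ge0.
have /andP[l0 l1] := heat01 (b - kap) v y; have /andP[u0 u1] := heat01 (b + kap) v y.
have [yb|yb] := leP y b; apply/andP; split.
- by rewrite lerBlDr (le_trans l1)// lerDl.
- rewrite -lerBlDr (le_trans top)// Phi_mono// ler_wpM2r//.
  by rewrite addrAC lerDr subr_ge0.
- rewrite subr_le0 (le_trans _ bot)// Phi_mono// -mulNr ler_wpM2r//.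
  by rewrite addrAC gerDr subr_le0 ltW.
- by rewrite addr_ge0.
Qed.

Lemma heat_params (b e : R) : 0 < e -> exists kap v0 del : R, [/\ 0 < v0, 0 < del,
  1 - e <= Phi (kap / Num.sqrt v0), Phi (- (kap / Num.sqrt v0)) <= e &
  forall s, `|s - 1| <= del -> `|heat (b + kap) (v0 + s) 0 - Phi b| <= e /\
    `|heat (b - kap) (v0 + s) 0 - Phi b| <= e].
Proof.
move=> e0; have := @Phi_continuous R b; move/cvgrPdist_le => /(_ e e0) /nbhs_ballP[h /= h0 Hh].
have [n1 H1] := Phi_top e0; have [n2 H2] := Phi_bot e0.
(* The budget is the modulus [h] of continuity of [Phi] at [b]: the shift [kap] uses at most
   [h / 4], and replacing the variance by 1 another [4 * B * del <= h / 4], where [B] bounds the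
   shifted thresholds. *)
pose kap := Num.min 1 (h / 4).
have k0 : 0 < kap by rewrite lt_min ltr01 divr_gt0.
have k1 : kap <= 1 by rewrite ge_min lexx.
have kh : kap <= h / 4 by rewrite ge_min lexx orbT.
pose B := `|b| + 1; have B0 : 0 < B by rewrite ltr_wpDl.
pose del := Num.min 4^-1 (h / (16 * B)).
have hB : 0 < h / (16 * B) by rewrite divr_gt0// mulr_gt0.
have d0 : 0 < del by rewrite lt_min invr_gt0 hB andbT.
have d4 : del <= 4^-1 by rewrite ge_min lexx.
have dB : del <= h / (16 * B) by rewrite ge_min lexx orbT.
(* Taking [sqrt v0 <= q] makes [kap / sqrt v0] at least [n], beyond both levels supplied by
   [Phi_top] and [Phi_bot]. *)
pose n := maxn n1 n2; pose q := kap / n.+1%:R.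
have q0 : 0 < q by rewrite divr_gt0.
pose v0 := Num.min del (q ^+ 2).
have v00 : 0 < v0 by rewrite lt_min d0 exprn_gt0.
have vd : v0 <= del by rewrite ge_min lexx.
have sv : Num.sqrt v0 <= q.
  by rewrite -[leRHS](ger0_norm (ltW q0)) -sqrtr_sqr ler_wsqrtr// ge_min lexx orbT.
have sv0 : 0 < Num.sqrt v0 by rewrite sqrtr_gt0.
have nk : n%:R <= kap / Num.sqrt v0.
  rewrite ler_pdivlMr//; apply: (@le_trans _ _ (n.+1%:R * q)).
    by apply: ler_pM => //; rewrite ler_nat.
  by rewrite /q mulrCA divff ?mulr1// pnatr_eq0.
exists kap, v0, del; split => //.
- by apply: (le_trans H1); apply: Phi_mono; apply: le_trans nk; rewrite ler_nat leq_maxl.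
- apply: le_trans H2; apply: Phi_mono; rewrite lerN2; apply: le_trans nk.
  by rewrite ler_nat leq_maxr.
move=> s sd; have vs : `|v0 + s - 1| <= del + del.
  rewrite -addrA; apply: (le_trans (ler_normD _ _)); apply: lerD => //.
  by rewrite gtr0_norm.
have vs2 : 2^-1 <= v0 + s by move: vs; rewrite ler_norml => /andP[]; lra.
set z := v0 + s in vs vs2 *.
have z0 : 0 < z by lra.
have sz : 2^-1 <= Num.sqrt z.
  have h2 : 0 <= 2^-1 :> R by rewrite invr_ge0.
  rewrite -(ger0_norm h2) -sqrtr_sqr ler_wsqrtr// expr2; lra.
have sq : Num.sqrt z ^+ 2 = z by rewrite sqr_sqrtr// ltW.
have iz : `|(Num.sqrt z)^-1 - 1| <= 2 * (del + del).
  move: (Num.sqrt z) sz sq => u u2 uz.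
  have u0 : 0 < u by lra.
  rewrite (_ : u^-1 - 1 = (1 - z) / (u * (1 + u))); last by rewrite -uz; field; rewrite !gt_eqF//; lra.
  have p0 : 0 < u * (1 + u) by rewrite mulr_gt0//; lra.
  rewrite normrM normfV (gtr0_norm p0) ler_pdivrMr// distrC (le_trans vs)//.
  have : 0 <= (del + del) * (2 * (u * (1 + u)) - 1).
    by rewrite mulr_ge0//; [lra|nra].
  by nra.
have H c : `|c - b| <= kap -> `|heat c z 0 - Phi b| <= e.
  move=> cb; rewrite distrC; apply: Hh; rewrite /ball /= subr0.
  have cB : `|c| <= B.
    rewrite (_ : c = b + (c - b)); last by rewrite addrC subrK.
    by rewrite (le_trans (ler_normD _ _))// lerD2l (le_trans cb).
  rewrite (_ : b - c / Num.sqrt z = (b - c) - c * ((Num.sqrt z)^-1 - 1)); last by ring.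
  apply: (le_lt_trans (ler_normB _ _)); rewrite normrM distrC.
  apply: (@le_lt_trans _ _ (h / 4 + B * (2 * (del + del)))).
    by apply: lerD; [exact: le_trans kh|exact: ler_pM].
  have : B * del <= h / 16.
    apply: (le_trans (ler_wpM2l (ltW B0) dB)).
    by rewrite le_eqVlt; apply/orP; left; apply/eqP; field; rewrite gt_eqF.
  move: (h0) => {}h0; rewrite (_ : B * (2 * (del + del)) = 4 * (B * del)); last by ring.
  by move: (B * del) => x; lra.
by split; apply: H; rewrite addrAC subrr add0r ?normrN gtr0_norm.
Qed.
End Sandwich.

Lemma step_err_ge0 (R : realType) (r v : R) : 0 < r -> 0 < v -> 0 <= step_err r v.
Proof.
move=> r0 v0; have s0 : 0 < Num.sqrt v by rewrite sqrtr_gt0.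
have M0 : 0 <= 2 * (4 * @moment_const R + 32).
  by have [M0 _] := @moment_constP R; rewrite mulr_ge0// addr_ge0// mulr_ge0.
rewrite /step_err addr_ge0//.
  by rewrite divr_ge0// mulr_ge0// exprn_ge0// ltW.
by rewrite divr_ge0 ?sqr_ge0// mulr_ge0// sqr_ge0.
Qed.

Section SlabLaw.
Context {R : realType} {d : measure_display} {T : measurableType d}.
Variable P : probability T R.
Variables (N : nat) (i0 : 'I_N) (X : 'I_N -> R -> T -> R).
Hypothesis hX : spider_BM P X.
Local Notation Cv n := (legev i0 X (@first N n)).

Lemma slab_bmf n1 n2 (F : nat -> T -> R) : (n1 <= n2)%N -> (forall n, bmf (F n)) ->
  bmf (fun w => \1_(slab X n1 n2) w * F (nu X w) w).
Proof.
move=> n12 bF.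
rewrite (_ : (fun w => _) = fun w => \sum_(n1 <= m < n2) \1_(Cv m.+1) w * F m.+1 w).
  apply: bmf_sum => m; apply: bmfM => //; apply: bmf_ind; exact: (legev_meas i0 hX).
by apply/funext => w; exact: (slab_sum i0 hX (F ^~ w) w n12).
Qed.

Lemma slab_E n1 n2 (F : nat -> T -> R) : (n1 <= n2)%N -> (forall n, bmf (F n)) ->
  \int[P]_w (\1_(slab X n1 n2) w * F (nu X w) w) =
  \sum_(n1 <= m < n2) \int[P]_w (\1_(Cv m.+1) w * F m.+1 w).
Proof.
move=> n12 bF; rewrite -E_sum; last first.
  by move=> m; apply/bmf_igr/bmfM => //; apply: bmf_ind; exact: (legev_meas i0 hX).
by apply: eqE => w; exact: (slab_sum i0 hX (F ^~ w) w n12).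
Qed.

Lemma heat_dev_bmf (b v r : R) n : bmf (fun w => heat b v (dev_ X r n w)).
Proof.
split; last by exists 1 => w; have /andP[h1 h2] := heat01 b v (dev_ X r n w); rewrite ger0_norm.
apply: (measurableT_comp _ (dev_meas hX r n)); apply: continuous_measurable_fun.
exact: heat_continuous.
Qed.

Lemma dev_le_bmf (b r : R) n : bmf (fun w => (dev_ X r n w <= b)%R%:R : R).
Proof.
split; last by exists 1 => w; case: (dev_ X r n w <= b)%R; rewrite ?normr1 ?normr0.
rewrite (_ : (fun w => _) = \1_[set w | dev_ X r n w <= b]).
  apply: measurable_indic; rewrite (_ : [set w | _] = setT `&` dev_ X r n @^-1` `]-oo, b]%classic).
    by apply: (dev_meas hX r n).
  by apply/seteqP; split => w /=; rewrite in_itv/=; [move=> ->|case].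
apply/funext => w; rewrite indicE; congr (_ %:R); congr nat_of_bool.
by apply/idP/idP => [h|]; [rewrite mem_set|rewrite inE].
Qed.

Variables (b r e kap v0 del : R) (n1 n2 : nat).
Hypotheses (r0 : 0 < r) (e0 : 0 < e) (v00 : 0 < v0) (n12 : (n1 <= n2)%N).
Let t : R := 4 / 3 / r ^+ 2.
Hypothesis top : 1 - e <= Phi (kap / Num.sqrt v0).
Hypothesis bot : Phi (- (kap / Num.sqrt v0)) <= e.
Hypothesis near_b : forall s, `|s - 1| <= del -> `|heat (b + kap) (v0 + s) 0 - Phi b| <= e /\
    `|heat (b - kap) (v0 + s) 0 - Phi b| <= e.
Hypothesis tm : forall m, (n1 <= m < n2)%N -> `|m.+1%:R * t - 1| <= del.
Hypothesis err : n2%:R * step_err r v0 <= e.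

Let W : R := coupon R N n2 - coupon R N n1.
Let PC m : 0 <= fine (P (Cv m)). Proof. exact: fine_ge0. Qed.
Let WE : W = \sum_(n1 <= m < n2) fine (P (Cv m.+1)).
Proof. by rewrite /W -telescope_sumr//; apply: eq_bigr => m _; rewrite (P_first i0 hX). Qed.
Let W01 : 0 <= W <= 1.
Proof.
rewrite /W -(P_slab i0 hX n12) fine_ge0//= -lee_fin fineK; first exact: probability_le1 (slab_meas i0 hX _ _).
by rewrite fin_num_measure//; exact: (slab_meas i0 hX).
Qed.

(** Sum [legev_heat] over the values of [nu] in the slab: each Gaussian term is within [e] of the
    same number [Phi b], so the total weight [W] factors out. This is where the limit law becomes a
    product. *)
Lemma slab_heat (c : R) : (forall s, `|s - 1| <= del -> `|heat c (v0 + s) 0 - Phi b| <= e) ->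
  `|\int[P]_w (\1_(slab X n1 n2) w * heat c v0 (dev_ X r (nu X w) w)) - W * Phi b| <= e + e.
Proof.
move=> nb; have se0 := step_err_ge0 r0 v00.
have EE := slab_E (F := fun n w => heat c v0 (dev_ X r n w)) n12 (heat_dev_bmf c v0 r).
rewrite /= in EE; rewrite EE {EE}.
rewrite WE mulr_suml -sumrB; apply: (le_trans (ler_norm_sum _ _ _)).
apply: (@le_trans _ _ (\sum_(n1 <= m < n2) fine (P (Cv m.+1)) * (e + e))); last first.
  by rewrite -mulr_suml -WE ler_piMl ?addr_ge0 ?(ltW e0)//; case/andP: W01.
rewrite big_nat [leRHS]big_nat; apply: ler_sum => m mm.
have H1 := legev_heat i0 hX c (@first N m.+1) r0 v00 (lexx v0).
have H2 := nb _ (tm mm); rewrite -/t in H1.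
set I := \int[P]_w _ in H1 *; set p := fine _ in H1 *.
rewrite (_ : I - p * Phi b = (I - p * heat c (v0 + m.+1%:R * t) 0) + p * (heat c (v0 + m.+1%:R * t) 0 - Phi b)); last by ring.
apply: (le_trans (ler_normD _ _)); rewrite [leRHS]mulrDr; apply: lerD.
  apply: (le_trans H1); rewrite mulrAC mulrC ler_wpM2l ?PC// (le_trans _ err)//.
  by rewrite ler_wpM2r// ler_nat; case/andP: mm.
by rewrite normrM (ger0_norm (PC _)) ler_wpM2l ?PC.
Qed.

Lemma slab_law :
  `|\int[P]_w (\1_(slab X n1 n2) w * (dev_ X r (nu X w) w <= b)%R%:R) - W * Phi b| <= e + e + e.
Proof.
have U := slab_heat (fun s sd => (near_b sd).1).
have L := slab_heat (fun s sd => (near_b sd).2).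
have mS : measurable (slab X n1 n2) by exact: (slab_meas i0 hX).
have bS : bmf (\1_(slab X n1 n2) : T -> R) by exact: bmf_ind.
have IS : igr P (\1_(slab X n1 n2)) by exact: bmf_igr.
have ES : \int[P]_w (\1_(slab X n1 n2) w : R) = W by rewrite E_ind// (P_slab i0 hX).
have Ih c : igr P (fun w => \1_(slab X n1 n2) w * heat c v0 (dev_ X r (nu X w) w)).
  exact/bmf_igr/(slab_bmf n12 (heat_dev_bmf c v0 r)).
have Ib : igr P (fun w => \1_(slab X n1 n2) w * (dev_ X r (nu X w) w <= b)%R%:R).
  exact/bmf_igr/(slab_bmf n12 (dev_le_bmf b r)).
have IeS : igr P (fun w => e * \1_(slab X n1 n2) w) by exact: igrZ.
have S01 w : 0 <= (\1_(slab X n1 n2) w : R) by rewrite indicE.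
have sw w := heat_sandwich b (dev_ X r (nu X w) w) v00 (ltW e0) top bot.
have /andP[W0 W1] := W01.
have We : e * W <= e by rewrite ler_piMr// ltW.
set Ib_ := \int[P]_w _.
have up : Ib_ <= \int[P]_w (\1_(slab X n1 n2) w * heat (b + kap) v0 (dev_ X r (nu X w) w)) + e.
  apply: (@le_trans _ _ (\int[P]_w (\1_(slab X n1 n2) w * heat (b + kap) v0 (dev_ X r (nu X w) w) + e * \1_(slab X n1 n2) w))).
    apply: le_E => //; first exact: igrD.
    move=> w; rewrite [e * _]mulrC -mulrDr ler_wpM2l//; by case/andP: (sw w).
  by rewrite (ED (Ih _) IeS) (EZ _ IS) ES lerD2l.
have lo : \int[P]_w (\1_(slab X n1 n2) w * heat (b - kap) v0 (dev_ X r (nu X w) w)) - e <= Ib_.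
  apply: (@le_trans _ _ (\int[P]_w (\1_(slab X n1 n2) w * heat (b - kap) v0 (dev_ X r (nu X w) w) - e * \1_(slab X n1 n2) w))).
    by rewrite (EB (Ih _) IeS) (EZ _ IS) ES lerD2l lerN2.
  apply: le_E => //; first exact: igrB.
  move=> w; rewrite [e * _]mulrC -mulrBr ler_wpM2l//; by case/andP: (sw w).
move: U L up lo; move: (\int[P]_w _) (\int[P]_w _) => IU IL.
move: (W * Phi b) Ib_ => p q; rewrite !ler_norml => /andP[_ u] /andP[l _] up lo.
by apply/andP; split; lra.
Qed.
End SlabLaw.

(** * Asymptotics *)

Section Asymptotics.
Variable R : realType.
Local Notation lnN N := (ln (N%:R : R)).

Lemma lnN_ge (K : R) : \forall N \near \oo, K <= lnN N.
Proof.
near=> N; have N0 : 0 < N%:R :> R by rewrite ltr0n; near: N; exact: nbhs_infty_gt.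
rewrite -ler_expR lnK//; near: N; exact: nbhs_infty_ger.
Unshelve. all: by end_near. Qed.

Definition scale (N : nat) : R := Num.sqrt (4 / 3) * Num.sqrt (N%:R * lnN N).
(** For [N] large, [nu / N - ln N <= a] is the same as [nu <= idx a N]; this translates intervals of
    [zeta_] into slabs. *)
Definition idx (a : R) (N : nat) : nat := Num.truncn (N%:R * (lnN N + a)).

Lemma scale_sq N : (1 <= N)%N -> scale N ^+ 2 = 4 / 3 * (N%:R * lnN N).
Proof. by move=> N1; rewrite exprMn !sqr_sqrtr// mulr_ge0// ln_ge0// ler1n. Qed.

Lemma scale_gt0 N : (2 <= N)%N -> 0 < scale N.
Proof.
move=> N2; rewrite mulr_gt0 ?sqrtr_gt0// mulr_gt0 ?ltr0n ?ln_gt0 ?ltr1n//.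
exact: ltnW.
Qed.

Lemma scale_time N : (2 <= N)%N -> 4 / 3 / scale N ^+ 2 = (N%:R * lnN N)^-1.
Proof.
move=> N2; rewrite scale_sq; last exact: ltnW.
have : N%:R * lnN N != 0.
  by rewrite mulf_neq0 ?gt_eqF ?ltr0n ?ln_gt0 ?ltr1n// ltnW.
by move: (_ * _) => u u0; field.
Qed.

Lemma scale_ge (K : R) : \forall N \near \oo, K <= scale N.
Proof.
pose L := Num.max K 0; have L0 : 0 <= L by rewrite le_max lexx orbT.
near=> N; apply: (@le_trans _ _ L); first by rewrite le_max lexx.
have N1 : (1 <= N)%N by near: N; exact: nbhs_infty_ge.
have l0 : 0 <= lnN N by rewrite ln_ge0// ler1n.
have s0 : 0 <= scale N by rewrite mulr_ge0 ?sqrtr_ge0.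
rewrite -(@ler_pXn2r _ 2%N)// scale_sq//.
have h : L ^+ 2 <= lnN N by near: N; exact: lnN_ge.
apply: (le_trans h); rewrite mulrA ler_peMl//.
have : 1 <= N%:R :> R by rewrite ler1n.
lra.
Unshelve. all: by end_near. Qed.

(** Only for large [N], because truncation gives the integer part of nonnegative numbers only. *)
Lemma idx_itv (a : R) : \forall N \near \oo, (idx a N)%:R <= N%:R * (lnN N + a) < (idx a N).+1%:R.
Proof.
near=> N; apply: truncn_itv; rewrite mulr_ge0// -lerBlDr sub0r.
near: N; exact: lnN_ge.
Unshelve. all: by end_near. Qed.

Lemma idx_cvg (a : R) : (fun N => (idx a N)%:R / N%:R - lnN N) @ \oo --> a.
Proof.
apply/cvgrPdist_le => e e0; near=> N.
have N0 : 0 < N%:R :> R by rewrite ltr0n; near: N; exact: nbhs_infty_gt.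
have /andP[h1 h2] : (idx a N)%:R <= N%:R * (lnN N + a) < (idx a N).+1%:R by near: N; exact: idx_itv.
have Ne : N%:R^-1 <= e.
  rewrite invf_ple ?posrE//; near: N; exact: nbhs_infty_ger.
rewrite (_ : a - _ = (N%:R * (lnN N + a) - (idx a N)%:R) * N%:R^-1); last by field; rewrite gt_eqF.
rewrite ger0_norm ?mulr_ge0 ?subr_ge0 ?invr_ge0 ?(ltW N0)//.
apply: le_trans Ne; rewrite -[leRHS]mul1r ler_wpM2r ?invr_ge0 ?(ltW N0)//.
by rewrite lerBlDr nat1r ltW.
Unshelve. all: by end_near. Qed.

Lemma idx_mono (a b : R) N : a <= b -> (idx a N <= idx b N)%N.
Proof. by move=> ab; apply: le_truncn; rewrite ler_wpM2l// lerD2l. Qed.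

(** Throughout the slab the number of cycles is [N ln N] up to [O(N)], and one rescaled cycle has
    variance [1 / (N ln N)]. *)
Lemma idx_time (a b del : R) : 0 < del -> \forall N \near \oo, forall m,
  (idx a N <= m < idx b N)%N -> `|m.+1%:R * (4 / 3 / scale N ^+ 2) - 1| <= del.
Proof.
move=> d0; near=> N => m /andP[m1 m2].
have N2 : (2 <= N)%N by near: N; exact: nbhs_infty_ge.
have N0 : 0 < N%:R :> R by rewrite ltr0n ltnW.
have l0 : 0 < lnN N by rewrite ln_gt0// ltr1n.
have /andP[_ h1] : (idx a N)%:R <= N%:R * (lnN N + a) < (idx a N).+1%:R by near: N; exact: idx_itv.
have /andP[h2 _] : (idx b N)%:R <= N%:R * (lnN N + b) < (idx b N).+1%:R by near: N; exact: idx_itv.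
have la : `|a| / del <= lnN N by near: N; exact: lnN_ge.
have lb : `|b| / del <= lnN N by near: N; exact: lnN_ge.
rewrite ler_pdivrMr// in la; rewrite ler_pdivrMr// in lb.
rewrite scale_time//; set u := N%:R * lnN N; have u0 : 0 < u by rewrite mulr_gt0.
rewrite (_ : _ - 1 = (m.+1%:R - u) / u); last by field; rewrite gt_eqF.
rewrite normrM normfV (gtr0_norm u0) ler_pdivrMr//.
have k1 : N%:R * (lnN N + a) <= m.+1%:R by rewrite (le_trans (ltW h1))// ler_nat.
have k2 : m.+1%:R <= N%:R * (lnN N + b) by apply: le_trans h2; rewrite ler_nat.
have ka : - (N%:R * (lnN N * del)) <= N%:R * a.
  rewrite -mulrN ler_wpM2l ?(ltW N0)// lerNl; apply: le_trans la.
  by rewrite -normrN ler_norm.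
have kb : N%:R * b <= N%:R * (lnN N * del).
  by rewrite ler_wpM2l ?(ltW N0)//; apply: le_trans lb; exact: ler_norm.
rewrite mulrDr -/u in k1; rewrite mulrDr -/u in k2.
have E : del * u = N%:R * (lnN N * del) by rewrite /u; ring.
rewrite E; move: (N%:R * (lnN N * del)) (N%:R * a) (N%:R * b) (m.+1%:R) k1 k2 ka kb => z x y s k1 k2 ka kb.
by rewrite ler_norml; apply/andP; split; lra.
Unshelve. all: by end_near. Qed.

(** With [u = N ln N] there are at most [2 u] cycles, each with an error of order
    [u^(-3/2) + u^(-2)]; the total tends to 0. *)
Lemma idx_err (b v e : R) : 0 < v -> 0 < e ->
  \forall N \near \oo, (idx b N)%:R * step_err (scale N) v <= e.
Proof.
move=> v0 e0; have s0 : 0 < Num.sqrt v by rewrite sqrtr_gt0.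
pose A := 2 * (4 * @moment_const R + 32); have A0 : 0 <= A.
  by have [M0 _] := @moment_constP R; rewrite mulr_ge0// addr_ge0// mulr_ge0.
pose c1 := 3 / 2 * A / Num.sqrt v ^+ 3; pose c2 := 8 / v ^+ 2.
have e2 : 0 < e / 2 by rewrite divr_gt0.
near=> N.
have N2 : (2 <= N)%N by near: N; exact: nbhs_infty_ge.
have N0 : 0 < N%:R :> R by rewrite ltr0n ltnW.
have l0 : 0 < lnN N by rewrite ln_gt0// ltr1n.
have /andP[h2 _] : (idx b N)%:R <= N%:R * (lnN N + b) < (idx b N).+1%:R by near: N; exact: idx_itv.
have lb : b <= lnN N by near: N; exact: lnN_ge.
have r0 := scale_gt0 N2; have se0 := step_err_ge0 r0 v0.
have q1 : c1 / (e / 2) <= scale N by near: N; exact: scale_ge.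
have q2 : c2 / (e / 2) <= lnN N by near: N; exact: lnN_ge.
set u := N%:R * lnN N; have u0 : 0 < u by rewrite mulr_gt0.
have lu : lnN N <= u by rewrite ler_peMl ?(ltW l0)// ler1n ltnW.
have iu : (idx b N)%:R <= 2 * u.
  have key (x : R) : 2 * x = x + x by ring.
  by apply: (le_trans h2); rewrite key /u mulrDr lerD2l ler_wpM2l ?(ltW N0)//.
apply: (le_trans (ler_wpM2r se0 iu)).
rewrite /step_err scale_time// -/u -/A.
have r2 : scale N ^+ 2 = 4 / 3 * u by rewrite scale_sq// ltnW.
have -> : 2 * u * (A / (scale N ^+ 3 * Num.sqrt v ^+ 3) + 4 * u^-1 ^+ 2 / v ^+ 2) = c1 / scale N + c2 / u.
  rewrite exprS r2 /c1 /c2; field.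
  by rewrite !gt_eqF.
rewrite [leRHS]splitr; apply: lerD.
  by rewrite ler_pdivrMr// mulrC -ler_pdivrMr.
by rewrite ler_pdivrMr// mulrC -ler_pdivrMr// (le_trans q2).
Unshelve. all: by end_near. Qed.
End Asymptotics.

(** * Convergence of the joint law on rectangles *)

Section RectLimit.
Variable R : realType.
Context (d : measure_display) (T : nat -> measurableType d).
Variables (P : forall N, probability (T N) R) (X : forall N : nat, 'I_N -> R -> T N -> R).
Hypothesis hX : forall N : nat, (2 <= N)%N -> spider_BM (P N) (@X N).

(** Nothing is known about [X N] for [N < 2]; the constant 0 keeps the variable measurable there. *)
Definition zeta_ N : T N -> R := fun w =>
  if (2 <= N)%N then atcover (@X N) (fun n _ => n%:R / N%:R - ln N%:R) w else 0.
Definition eta_ N : T N -> R := fun w =>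
  if (2 <= N)%N then atcover (@X N) (dev_ (@X N) (scale R N)) w else 0.

Arguments zeta_ : clear implicits.
Arguments eta_ : clear implicits.

Let leg0 N (N2 : (2 <= N)%N) : 'I_N := Ordinal (ltnW N2).

Lemma zetaE N : (2 <= N)%N -> zeta_ N = atcover (@X N) (fun n _ => n%:R / N%:R - ln N%:R).
Proof. by move=> N2; apply/funext => w; rewrite /zeta_ N2. Qed.

Lemma etaE N : (2 <= N)%N -> eta_ N = atcover (@X N) (dev_ (@X N) (scale R N)).
Proof. by move=> N2; apply/funext => w; rewrite /eta_ N2. Qed.

Lemma zeta_meas N : measurable_fun setT (zeta_ N).
Proof.
have [N2|N2] := boolP (2 <= N)%N; last first.
  by rewrite (_ : zeta_ N = fun=> 0)//; apply/funext => w; rewrite /zeta_ (negbTE N2).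
by rewrite zetaE//; apply: (atcover_meas (leg0 N2) (hX N2)).
Qed.

Lemma eta_meas N : measurable_fun setT (eta_ N).
Proof.
have [N2|N2] := boolP (2 <= N)%N; last first.
  by rewrite (_ : eta_ N = fun=> 0)//; apply/funext => w; rewrite /eta_ (negbTE N2).
by rewrite etaE//; apply: (atcover_meas (leg0 N2) (hX N2)) => n; exact: (dev_meas (hX N2)).
Qed.

Local Notation uncovered N := (1 - fine (P N [set w | (covering_time (@X N) w < +oo)%E])).

Lemma uncovered_small (e : R) : 0 < e -> \forall N \near \oo, uncovered N <= e.
Proof.
move=> e0; have e2 : 0 < e / 2 by rewrite divr_gt0.
have [n _ /(_ n (leqnn n)) /= Hn] := gumbel_cdf_top e2.
have := coupon_cvg (@idx_cvg R n%:R); rewrite -/(gumbel_cdf _).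
move/cvgrPdist_le => /(_ _ e2) Hc.
apply: filterS2 (nbhs_infty_ge 2) Hc => N N2 h.
have := coupon_covering_time (leg0 N2) (hX N2) (@idx R n%:R N).
move: h Hn; rewrite ler_norml => /andP[_ h] Hn; move: (fine _) => q; lra.
Qed.

Definition slab_cdf N (a b y : R) : R := \int[P N]_w
  (\1_(slab (@X N) (idx a N) (idx b N)) w * (dev_ (@X N) (scale R N) (nu (@X N) w) w <= y)%R%:R).

Lemma rect_slab N (a b c e : R) : (2 <= N)%N -> a <= b -> c <= e ->
  (idx a N)%:R <= N%:R * (ln N%:R + a) < (idx a N).+1%:R ->
  (idx b N)%:R <= N%:R * (ln N%:R + b) < (idx b N).+1%:R ->
  `|wint (P N) (fun=> 1) (rect (zeta_ N) (eta_ N) a b c e) - (slab_cdf N a b e - slab_cdf N a b c)| <= uncovered N.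
Proof.
move=> N2 ab ce ha hb; have i0 := leg0 N2; have hN := hX N2.
set S := slab (@X N) (idx a N) (idx b N).
have n12 : (idx a N <= idx b N)%N by exact: idx_mono.
have IF y : igr (P N) (fun w => \1_S w * (dev_ (@X N) (scale R N) (nu (@X N) w) w <= y)%R%:R).
  exact/bmf_igr/(slab_bmf i0 hN n12 (dev_le_bmf hN y (scale R N))).
pose C := [set w | (covering_time (@X N) w < +oo)%E].
have mC : measurable C by exact: (covering_time_meas i0 hN).
have IC : igr (P N) (fun w => 1 - \1_C w).
  by apply: igrB; [exact/bmf_igr/bmf_cst|exact/bmf_igr/bmf_ind].
have EC : \int[P N]_w (1 - \1_C w : R) = uncovered N.
  by rewrite EB ?E_cst ?E_ind//; [exact/bmf_igr/bmf_cst|exact/bmf_igr/bmf_ind].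
have Ir : igr (P N) (fun w => rect (zeta_ N) (eta_ N) a b c e w * 1).
  apply/bmf_igr/bmfM; last exact: bmf_cst.
  have [mr [K Kr]] := @bd_bool R _ (T N) _ (meas_rect (@zeta_meas N) (@eta_meas N) a b c e).
  by split => //; exists K.
rewrite /wint /slab_cdf -/S -(EB (IF e) (IF c)) -(EB Ir); last exact: igrB.
rewrite -EC; apply: norm_E_le => //; first by apply: igrB => //; exact: igrB.
move=> w; have [Cw|Cw] := pselect (C w); last first.
  (* Where the spider is never covered, the default values 0 may fall in the rectangle although the
     slab is missed; the discrepancy is at most 1. *)
  rewrite [\1_C w]indicE memNset// subr0 [\1_S w]indicE memNset; last by case.
  rewrite !mul0r subrr subr0 mulr1 /rect; case: (_ && _); by rewrite ?normr1 ?normr0.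
rewrite [\1_C w]indicE mem_set// subrr.
suff -> : rect (zeta_ N) (eta_ N) a b c e w * 1 =
  \1_S w * (dev_ (@X N) (scale R N) (nu (@X N) w) w <= e)%R%:R -
  \1_S w * (dev_ (@X N) (scale R N) (nu (@X N) w) w <= c)%R%:R by rewrite subrr normr0.
rewrite mulr1 /rect /zeta_ /eta_ N2 /atcover (_ : (covering_time _ w < +oo)%E)//.
set y := dev_ _ _ _ _; set n := nu _ _.
have N0 : 0 < N%:R :> R by rewrite ltr0n ltnW.
have toidx (x : R) : (idx x N)%:R <= N%:R * (ln N%:R + x) < (idx x N).+1%:R ->
    (n%:R / N%:R - ln N%:R <= x) = (n <= idx x N)%N.
  move=> /andP[h1 h2]; rewrite lerBlDl ler_pdivrMr// mulrC.
  apply/idP/idP => [h|h].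
    by rewrite -ltnS -(ltr_nat R) (le_lt_trans h).
  by apply: le_trans h1; rewrite ler_nat.
have -> : \1_S w = ((idx a N < n) && (n <= idx b N))%N%:R :> R.
  rewrite indicE; congr (_ %:R); congr nat_of_bool; apply/idP/idP; first by rewrite inE => -[].
  by move=> h; rewrite mem_set.
rewrite toidx// ltNge toidx// -ltnNge.
case: (idx a N < n <= idx b N)%N; rewrite ?mul0r ?subrr// !mul1r andTb.
have [yc|yc] := leP y c; first by rewrite (le_trans yc ce) subrr.
by rewrite subr0.
Qed.

Lemma rect_cvg (a b c e : R) : a <= b -> c <= e ->
  (fun N => wint (P N) (fun=> 1) (rect (zeta_ N) (eta_ N) a b c e)) @ \oo -->
  wint (@lebesgue_measure R \x @lebesgue_measure R)%E (@limit_pdf R) (rect fst snd a b c e).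
Proof.
move=> ab ce; rewrite limit_rect//; apply/cvgrPdist_le => eps eps0.
(* Eight shares: one for the coupon probabilities, three for each of the two applications of
   [slab_law], one for the uncovered event. *)
have e8 : 0 < eps / 8 by rewrite divr_gt0.
have [k1 [v1 [d1 [v10 d10 t1 b1 n1]]]] := heat_params e e8.
have [k2 [v2 [d2 [v20 d20 t2 b2 n2]]]] := heat_params c e8.
have cW : (fun N => coupon R N (idx b N) - coupon R N (idx a N)) @ \oo --> gumbel_cdf b - gumbel_cdf a.
  by apply: cvgB; apply: coupon_cvg; exact: idx_cvg.
move/cvgrPdist_le : cW => /(_ _ e8) cW.
near=> N; have N2 : (2 <= N)%N by near: N; exact: nbhs_infty_ge.
have n12 := idx_mono N ab.
have L1 := slab_law (leg0 N2) (hX N2) (scale_gt0 R N2) e8 v10 n12 t1 b1 n1.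
have T1 : forall m, (idx a N <= m < idx b N)%N -> `|m.+1%:R * (4 / 3 / scale R N ^+ 2) - 1| <= d1.
  by near: N; exact: idx_time.
have E1 : (idx b N)%:R * step_err (scale R N) v1 <= eps / 8 by near: N; exact: idx_err.
have {L1}L1 := L1 T1 E1.
have L2 := slab_law (leg0 N2) (hX N2) (scale_gt0 R N2) e8 v20 n12 t2 b2 n2.
have T2 : forall m, (idx a N <= m < idx b N)%N -> `|m.+1%:R * (4 / 3 / scale R N ^+ 2) - 1| <= d2.
  by near: N; exact: idx_time.
have E2 : (idx b N)%:R * step_err (scale R N) v2 <= eps / 8 by near: N; exact: idx_err.
have {L2}L2 := L2 T2 E2.
have hW : `|gumbel_cdf b - gumbel_cdf a - (coupon R N (idx b N) - coupon R N (idx a N))| <= eps / 8 by near: N.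
have hu : uncovered N <= eps / 8 by near: N; exact: uncovered_small.
have ha : (idx a N)%:R <= N%:R * (ln N%:R + a) < (idx a N).+1%:R by near: N; exact: idx_itv.
have hb : (idx b N)%:R <= N%:R * (ln N%:R + b) < (idx b N).+1%:R by near: N; exact: idx_itv.
have := le_trans (rect_slab N2 ab ce ha hb) hu.
have [p0 p1] : 0 <= Phi e - Phi c /\ Phi e - Phi c <= 1.
  have /andP[_ h1] := Phi01 e; have /andP[h2 _] := Phi01 c.
  by rewrite subr_ge0 Phi_mono// lerBlDr (le_trans h1)// lerDl.
rewrite -!/(slab_cdf N a b _) in L1 L2.
move: L1 L2 hW p0 p1; rewrite -/(slab_cdf N a b e) -/(slab_cdf N a b c).
move: (slab_cdf N a b e) (slab_cdf N a b c) (wint _ _ _) (Phi e) (Phi c) => Fe Fc w Pe Pc.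
move: (gumbel_cdf b - gumbel_cdf a) (coupon R N (idx b N) - coupon R N (idx a N)) => G W.
clear -eps0 => L1 L2 hW p0 p1 H.
rewrite (_ : G * (Pe - Pc) - w = (G - W) * (Pe - Pc) + ((Fc - W * Pc) - (Fe - W * Pe) - (w - (Fe - Fc)))); last by ring.
apply: (le_trans (ler_normD _ _)).
have h1 : `|(G - W) * (Pe - Pc)| <= eps / 8.
  rewrite normrM (ger0_norm p0); apply: le_trans hW.
  by rewrite ler_piMr.
have h2 : `|Fc - W * Pc - (Fe - W * Pe) - (w - (Fe - Fc))| <= `|Fc - W * Pc| + `|Fe - W * Pe| + `|w - (Fe - Fc)|.
  by apply: (le_trans (ler_normB _ _)); rewrite lerD2r; exact: ler_normB.
by move: `|_| `|_| `|_| `|_| `|_| h1 h2 L1 L2 H => q1 q2 q3 q4 q5 h1 h2 L1 L2 H; lra.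
Unshelve. all: by end_near. Qed.
End RectLimit.

Theorem theorem2p8 (R : realType) (d : measure_display)
  (T : nat -> measurableType d) (P : forall N, probability (T N) R)
  (X : forall N : nat, 'I_N -> R -> T N -> R)
  (hX : forall N : nat, (2 <= N)%N -> spider_BM (P N) (X N)) :
  let a : R := 2 in
  let sig : R := Num.sqrt (4 / 3) in
  exists zeta eta : forall N : nat, T N -> R,
    (forall N, measurable_fun setT (zeta N)) /\
    (forall N, measurable_fun setT (eta N)) /\
    (* (zeta_N, eta_N) converges in law to (Gumbel, N(0,1)) independent *)
    (forall g : R -> R -> R,
       continuous (fun p : R * R => g p.1 p.2) ->
       (exists M : R, forall x y, `|g x y| <= M) ->
       (fun N => (\int[P N]_w (g (zeta N w) (eta N w))%:E)%E) @ \oo -->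
       (\int[lebesgue_measure]_x \int[lebesgue_measure]_y
          (g x y * gumbel_pdf x * normal_pdf 0 1 y)%:E)%E) /\
    (* R_N = T_N - (a N ln N + a N zeta_N + sig sqrt(N ln N) eta_N) satisfies
       R_N sqrt(ln N / N) bounded in probability *)
    (forall e : R, 0 < e -> exists K : R, exists N0 : nat,
       forall N : nat, (N0 <= N)%N ->
       (P N [set w | K%:E <
          `| cover_time (fun i t => X N i t w)
             - (a * N%:R * ln N%:R + a * N%:R * zeta N w
                + sig * Num.sqrt (N%:R * ln N%:R) * eta N w)%:E |
          * (Num.sqrt (ln N%:R / N%:R))%:E] <= e%:E)%E).

Proof.
move=> a sig; exists (zeta_ X), (eta_ X); split=> [N|]; first exact: (zeta_meas hX).
split=> [N|]; first exact: (eta_meas hX).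
split=> [g cg [M gM]|e e0].
  pose gg (z : R * R) := g z.1 z.2.
  have gM' z : `|gg z| <= M by exact: gM.
  have one0 N (w : T N) : 0 <= 1 :> R by [].
  have I1 N : (P N).-integrable setT (EFin \o (fun=> 1 : R)) by exact/bmf_igr/bmf_cst.
  have w1 N : wint (P N) (fun=> 1) (fun=> 1) = 1 :> R by rewrite /wint mul1r E_cst.
  (* The law at stage [N] is taken with weight 1 under [P N], the limit with its density on the
     plane; [limit_iterated] then rewrites the limit as the iterated integral. *)
  have := @weak_cvg R gg M d T P (fun _ _ => 1) (zeta_ X) (eta_ X) _ (measurableTypeR R * measurableTypeR R)%type
    (lebesgue_measure \x lebesgue_measure)%E (@limit_pdf R) fst snd cg gM' one0 I1 (zeta_meas hX) (eta_meas hX)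
    (@limit_pdf_ge0 R) (@limit_pdf_igr R) measurable_fst measurable_snd w1 (@limit_one R)
    (rect_cvg hX) (@limit_tight R).
  move=> /(cvg_EFin _); rewrite /= => H.
  have := limit_iterated cg gM'; rewrite /gg /= => <-.
  have Ig N : igr (P N) (fun w => gg (zeta_ X w, eta_ X w) * 1).
    apply/bmf_igr/bmfM; last exact: bmf_cst.
    split; last by exists M => w; exact: gM.
    apply: (measurableT_comp (continuous_measurable_fun_plane cg)).
    by apply: measurable_fun_pair; [exact: (zeta_meas hX)|exact: (eta_meas hX)].
  apply: cvg_trans (H _); last by near=> N; apply: integrable_fin_num => //; exact: Ig.
  apply: near_eq_cvg; near=> N; rewrite /gg /=.
  by apply: eq_integral => w _; rewrite mulr1.
(* The threshold 0 suffices: the remainder is positive only where the cover time is infinite. *)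
exists 0; have [N0 _ HN] := uncovered_small hX e0.
exists (maxn 2 N0) => N; rewrite geq_max => /andP[N2 NN].
pose i0 : 'I_N := Ordinal (ltnW N2); have hN := hX N N2.
have mC := covering_time_meas i0 hN.
have N0' : 0 < N%:R :> R by rewrite ltr0n ltnW.
have l0 : 0 < ln N%:R :> R by rewrite ln_gt0// ltr1n.
have k0 : 0 < Num.sqrt (ln N%:R / N%:R) :> R by rewrite sqrtr_gt0 divr_gt0.
rewrite (_ : [set w | _] = ~` [set w | (covering_time (X N) w < +oo)%E]).
  rewrite probability_setC// -[P N _]fineK ?fin_num_measure// -EFinB lee_fin.
  exact: HN.
apply/seteqP; split => w /=.
  move=> + too; rewrite zetaE// etaE// /atcover too.
  have Cw := covering_time_first i0 hN too; have [_ tE] := first_nu hN Cw.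
  rewrite -/(covering_time (X N) w) tE; have : (sg (X N) (nu (X N) w) w < +oo)%E by rewrite -tE.
  have := (stopping_sg hN (nu (X N) w)).1.1 w; rewrite /dev_.
  case: (sg _ _ w) => [x| |]// _ _; rewrite /=.
  rewrite (_ : x - _ = 0); first by rewrite normr0 mul0e ltxx.
  rewrite /a /sig -/(scale R N).
  have s1 : scale R N != 0 by rewrite gt_eqF// scale_gt0.
  have n1 : N%:R != 0 :> R by rewrite gt_eqF.
  have key (n l k s y : R) : n != 0 -> s != 0 ->
    y - (2 * n * l + 2 * n * (k / n - l) + s * ((y - 2 * k) / s)) = 0.
    by move=> n0 s0; field; rewrite s0.
  exact: key.
move=> too; have : covering_time (X N) w = +oo%E by apply/eqP; rewrite -leye_eq leNgt; exact/negP.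
by rewrite /covering_time => ->; rewrite /= gt0_mulye ?lte_fin// ltry.
Unshelve. all: by end_near. Qed.
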